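(* Let $\beta>0$. The Jack polynomials can be defined recursively as follows. The Jack polynomials in the $J$-normalization, $J_\kappa^{(\beta)}(\lambda_1,\ldots,\lambda_n)$ ($n\ge1$, $\kappa=(\kappa_1,\ldots,\kappa_n)$ a partition with $l(\kappa)\le n$), form the unique family of symmetric polynomials satisfying, with $\Lambda=\mathrm{diag}(\lambda_1,\ldots,\lambda_n)$ an arbitrary real diagonal matrix: (i) (one variable) $J_{\kappa_1}^{(\beta)}(\lambda_1)=\lambda_1^{\kappa_1}\prod_{j=1}^{\kappa_1-1}\left(1+j\cdot\tfrac{2}{\beta}\right)$ for $n=1$; (ii) if $n\ge2$ and $\kappa_n>0$, then $$J_\kappa^{(\beta)}(\Lambda)=\det(\Lambda)\,J^{(\beta)}_{(\kappa_1-1,\ldots,\kappa_n-1)}(\Lambda)\prod_{i=1}^n\left(n-i+1+\tfrac{2}{\beta}(\kappa_i-1)\right);$$ (iii) if $n\ge2$ and $\kappa_n=0$, then $$J_\kappa^{(\beta)}(\Lambda)=\frac{C_\kappa^{(\beta)}(I_n)}{C_\kappa^{(\beta)}(I_{n-1})}\cdot\frac{2^{n-1}\Gamma(n\beta/2)}{\Gamma(\beta/2)^n}\int\prod_{i=1}^n q_i^{\beta-1}\,J_\kappa^{(\beta)}\big(\nu_1(\Lambda,q),\ldots,\nu_{n-1}(\Lambda,q)\big)\,dq,$$ where the integral is over unit vectors $q\in\mathbb{R}^n$ with positive entries, $dq$ is the surface area element, the integrand is the polynomial in $n-1$ variables, and $\nu_1,\ldots,\nu_{n-1},0$ are the eigenvalues,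 with multiplicity, of $(I-qq^t)\Lambda$.
   Context: Jack polynomials. A partition $\kappa\vdash k$ is a non-increasing sequence $\kappa_1\ge\kappa_2\ge\cdots\ge0$ of integers with sum $|\kappa|=k$; $l(\kappa)$ is the number of nonzero parts. Put $\rho_\kappa=\sum_i\kappa_i(\kappa_i-1-\beta(i-1))$. For partitions of $k$, $\mu\le\kappa$ (dominance) means $\mu_1+\cdots+\mu_j\le\kappa_1+\cdots+\kappa_j$ for all $j$; $m_\mu$ is the monomial symmetric polynomial. For $\kappa\vdash k$ with $l(\kappa)\le n$, the Jack polynomial in the $C$-normalization $C_\kappa^{(\beta)}(x_1,\ldots,x_n)$ is the homogeneous symmetric polynomial of degree $k$ of the form $\sum_{\mu\le\kappa}a_{\kappa\mu}m_\mu$, $a_{\kappa\kappa}\ne0$, which is an eigenfunction of $D_n^*=\sum_{i=1}^n x_i^2\frac{\partial^2}{\partial x_i^2}+\beta\sum_{i\ne j}\frac{x_i^2}{x_i-x_j}\frac{\partial}{\partial x_i}$ with eigenvalue $\rho_\kappa+\beta k(n-1)$, the scalings being fixed by $\sum_{\kappa\vdash k,\,l(\kappa)\le n}C_\kappa^{(\beta)}(x_1,\ldots,x_n)=(x_1+\cdots+x_n)^k$ for every $k$. For an $n\times n$ matrix $X$ with eigenvalues $x_1,\ldots,x_n$, a symmetric polynomial evaluated at $X$ means its value at $(x_1,\ldots,x_n)$; $I_n$ is the identity matrix. The constants $C_\kappa^{(\beta)}(I_n)$ are regarded as known. $J$-normalization: $J_\kappa^{(\beta)}$ is the scalar multiple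 of $C_\kappa^{(\beta)}$ in which the coefficient of $m_\kappa$ equals $\prod_{(i,j)\in\kappa}\left(\tfrac{2}{\beta}(\kappa_i-j)+(\kappa_j'-i)+1\right)$, the product being over cells $1\le i\le l(\kappa)$, $1\le j\le\kappa_i$ of the diagram of $\kappa$, with $\kappa'$ the conjugate partition; for the empty partition $J=1$. *)

(* Defs.v *)
From HB Require Import structures.
From mathcomp Require Import all_boot all_order all_algebra.
(* the notations of mpoly cannot be loaded together with those of
   mathcomp-analysis *)
From mathcomp.multinomials Require Import -(notations) mpoly.
From mathcomp Require Import all_classical all_reals all_analysis.

Set Implicit Arguments.
Unset Strict Implicit.
Unset Printing Implicit Defensive.

Import Order.TTheory GRing.Theory Num.Theory.
Import numFieldNormedType.Exports.

Local Open Scope classical_set_scope.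
Local Open Scope ring_scope.

Notation "{ 'mpoly' T [ n ] }" := (mpoly n T).
Notation "p ^`M ( i )" := (mderiv i p).
Notation "p .@[ v ]" := (meval v p).

Section Partitions.
Local Open Scope nat_scope.
Implicit Types (n k : nat) (kappa mu : seq nat).

(* A partition is the sequence of its nonzero parts, so that l(kappa) is
   size kappa, |kappa| is sumn kappa, and the (1-based) part kappa_i is
   nth 0 kappa i.-1. *)
Definition is_part kappa := sorted geq kappa && (0 \notin kappa).

Definition conj_part kappa j := count (leq j) kappa.

Definition dominated mu kappa : Prop :=
  forall j, sumn (take j mu) <= sumn (take j kappa).

Definition strip (s : seq nat) := [seq x <- s | x != 0].

(* duplicate-free list of the partitions of k into at most n parts *)
Definition partns n k : seq (seq nat) :=
  [seq strip (map val t) | t : n.-tuple 'I_k.+1 <- enum {: n.-tuple 'I_k.+1}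
     & sorted geq (map val t) && (sumn (map val t) == k)].

Lemma strip_cat_nseq kappa n : 0 \notin kappa -> strip (kappa ++ nseq n 0) = kappa.
Proof.
move=> k0; rewrite /strip filter_cat filter_nseq eqxx /= cats0.
by apply/all_filterP/allP => x xk; apply: contraNneq k0 => <-.
Qed.

Lemma sorted_strip s : sorted geq s ->
  s = strip s ++ nseq (size s - size (strip s)) 0.
Proof.
elim: s => // x s IHs /= ss.
have sx : all (geq x) s.
  by apply: order_path_min ss => a b c; move=> /= ab bc; apply: leq_trans bc ab.
have {}IHs := IHs (path_sorted ss).
rewrite {1}IHs; case: eqVneq => [x0|x0] /=; last by rewrite subSS.
have -> : strip s = [::].
  rewrite /strip; apply/eqP; rewrite -[_ == _]negbK -has_filter.
  by apply/hasPn => y /(allP sx); rewrite x0 /= leqn0 negbK.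
by rewrite /= x0 !subn0.
Qed.

Lemma mem_partns n k kappa :
  (kappa \in partns n k) = [&& is_part kappa, size kappa <= n & sumn kappa == k].
Proof.
have sum0 m : sumn (nseq m 0) = 0 by rewrite sumn_nseq.
apply/mapP/and3P => [[t]|[/andP[ks k0] kn /eqP kk]].
  rewrite mem_filter => /andP[/andP[ts /eqP tk] _] ->.
  have te := sorted_strip ts.
  split.
  - rewrite /is_part mem_filter eqxx andbT.
    apply: sorted_filter ts => a b c /= ab bc; exact: leq_trans bc ab.
  - by rewrite size_filter (leq_trans (count_size _ _))// size_map size_tuple.
  - by apply/eqP; rewrite -[RHS]tk [in RHS]te sumn_cat sum0 addn0.
have ub : all (leq^~ k) (kappa ++ nseq (n - size kappa) 0).
  rewrite all_cat all_nseq leq0n orbT andbT -kk.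
  elim: kappa {ks k0 kn kk} => //= x s IHs; rewrite leq_addr /=.
  by apply: sub_all IHs => y /leq_trans; apply; rewrite leq_addl.
have sz : size (map (@inord k) (kappa ++ nseq (n - size kappa) 0)) == n.
  by rewrite size_map size_cat size_nseq subnKC.
have vE : map val (map (@inord k) (kappa ++ nseq (n - size kappa) 0))
    = kappa ++ nseq (n - size kappa) 0.
  rewrite -map_comp map_id_in// => x /(allP ub) xk /=.
  by rewrite inordK// ltnS.
exists (Tuple sz); rewrite ?mem_filter ?mem_enum ?andbT /= vE; last by rewrite strip_cat_nseq.
rewrite sumn_cat sum0 addn0 kk eqxx andbT.
have geqT : transitive geq by move=> a b c /= ab bc; exact: leq_trans bc ab.
rewrite (sorted_pairwise geqT) pairwise_cat -!(sorted_pairwise geqT) ks.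
rewrite -enumT mem_enum andbT; apply/andP; split.
  by apply/allrelP => a b _ /nseqP[-> _] /=.
by elim: (n - _) => // -[].
Qed.

Lemma uniq_partns n k : uniq (partns n k).
Proof.
rewrite map_inj_in_uniq ?filter_uniq -?enumT ?enum_uniq// => s t.
rewrite !mem_filter => /andP[/andP[ss _] _] /andP[/andP[ts _] _] st.
apply/val_inj/(inj_map val_inj) => /=.
by rewrite (sorted_strip ss) (sorted_strip ts) st !size_map !size_tuple.
Qed.

(* cells are indexed from 0: the cell (i, j) below is (i + 1, j + 1) in
   1-based notation *)
Definition hooks (R : realType) (beta : R) kappa : R :=
  (\prod_(0 <= i < size kappa) \prod_(0 <= j < nth 0%N kappa i)
    (2 / beta * (nth 0 kappa i - j.+1)%N%:R
       + (conj_part kappa j.+1 - i.+1)%N%:R + 1))%R.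

End Partitions.

Section Jack.
Variable R : realType.
Implicit Types (n k : nat) (kappa : seq nat) (beta : R).

(* monomial symmetric polynomial: sum of the distinct monomials whose exponents
   are a rearrangement of mu padded with zeros *)
Definition msym_mono n (mu : seq nat) : {mpoly R[n]} :=
  \sum_(m : bmultinom n (sumn mu).+1
         | perm_eq (strip (bmnm m)) mu) mpolyX R (bmnm m).

Definition expo n kappa : multinom n :=
  Multinom [tuple nth 0%N kappa i | i < n].

Definition Dstar n beta (p : {mpoly R[n]}) (x : 'I_n -> R) : R :=
  \sum_i x i ^+ 2 * p^`M(i)^`M(i).@[x]
  + beta * \sum_i \sum_(j | j != i) x i ^+ 2 / (x i - x j) * p^`M(i).@[x].

Definition rho beta kappa : R :=
  \sum_(0 <= i < size kappa)
    (nth 0%N kappa i)%:R * ((nth 0%N kappa i)%:R - 1 - beta * i%:R).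

(* The coefficients of Dstar have poles on the diagonals x_i = x_j, hence the
   eigenvalue equation is required at the points with distinct coordinates. *)
Record is_jack n beta kappa (p : {mpoly R[n]}) : Prop := IsJack {
  jack_sym : p \is symmetric (n := n) (R := R);
  jack_homog : p \is ishomog1 (sumn kappa) mdeg;
  jack_triangular : exists2 a : seq nat -> R, a kappa != 0 &
    p = \sum_(mu <- partns n (sumn kappa) | `[< dominated mu kappa >])
          a mu *: msym_mono n mu;
  jack_eigen : forall x : 'I_n -> R, injective x ->
    Dstar beta p x
    = (rho beta kappa + beta * (sumn kappa)%:R * (n%:R - 1)) * p.@[x] }.

Definition poly_family := forall n, seq nat -> {mpoly R[n]}.

(* C n kappa is the polynomial attached to kappa in n variables; its values are
   constrained (and used) only for 0 < n and kappa a partition with at most n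
   parts. *)
Record is_jackC beta (C : poly_family) : Prop := IsJackC {
  jackC_jack : forall n kappa, (0 < n)%N -> is_part kappa ->
    (size kappa <= n)%N -> is_jack beta kappa (C n kappa);
  jackC_sum : forall n k, (0 < n)%N ->
    \sum_(kappa <- partns n k) C n kappa
    = (\sum_(i < n) mpolyX R (mnm1 i)) ^+ k }.

Definition jackJ beta (C : poly_family) : poly_family := fun n kappa =>
  (hooks beta kappa / mcoeff (expo n kappa) (C n kappa)) *: C n kappa.

End Jack.

Section ConsMeasure.
Context d (T : measurableType d) (R : realType).
Variables (n : nat) (mu : {sigma_finite_measure set T -> \bar R})
  (nu : {sigma_finite_measure set (n.-tuple T) -> \bar R}).

Definition tuple_of_pair (p : T * n.-tuple T) : n.+1.-tuple T :=
  [tuple of p.1 :: p.2].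

Lemma measurable_tuple_of_pair : measurable_fun setT tuple_of_pair.
Proof. by apply: measurable_cons; [exact: measurable_fst|exact: measurable_snd]. Qed.

Definition cons_measure : set (n.+1.-tuple T) -> \bar R :=
  pushforward (mu \x nu)%E tuple_of_pair.

Let cons0 : cons_measure set0 = 0%E.
Proof. by rewrite /cons_measure /pushforward preimage_set0 measure0. Qed.

Let cons_ge0 A : (0 <= cons_measure A)%E.
Proof. by rewrite /cons_measure /pushforward. Qed.

Let cons_sigma_additive : semi_sigma_additive cons_measure.
Proof.
move=> F mF tF mUF; rewrite /cons_measure /pushforward preimage_bigcup.
apply: measure_semi_sigma_additive.
- by move=> k; rewrite -[X in measurable X]setTI; exact: measurable_tuple_of_pair.
- apply/trivIsetP => /= i j _ _ ij; rewrite -preimage_setI.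
  by move/trivIsetP : tF => /(_ _ _ _ _ ij) ->//; rewrite preimage_set0.
- by rewrite -preimage_bigcup -[X in measurable X]setTI; exact: measurable_tuple_of_pair.
Qed.

HB.instance Definition _ := isMeasure.Build _ _ _
  cons_measure cons0 cons_ge0 cons_sigma_additive.

Let cons_sigma_finite : sigma_finite setT cons_measure.
Proof.
have [F FT Foo] : sigma_finite setT (mu \x nu)%E.
  have /sigma_finiteP[F [TF ndF Foo]] := sigma_finiteT mu.
  have /sigma_finiteP[G [TG ndG Goo]] := sigma_finiteT nu.
  exists (fun k => F k `*` G k).
    rewrite -setXTT TF TG predeqE => -[x y]; split.
      move=> [/= [i _ Fnx] [k _ Gky]]; exists (maxn i k) => //; split.
      - by move: x Fnx; exact/subsetPset/ndF/leq_maxl.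
      - by move: y Gky; exact/subsetPset/ndG/leq_maxr.
    by move=> [i _ []/= ? ?]; split; exists i.
  move=> k; have [? ?] := Foo k; have [? ?] := Goo k.
  split; first exact: measurableX.
  by rewrite product_measure1E// lte_mul_pinfty// ge0_fin_numE.
pose g (t : n.+1.-tuple T) : T * n.-tuple T := (thead t, [tuple of behead t]).
have gK : cancel tuple_of_pair g.
  by case=> x t; congr pair; apply/val_inj.
have mg : measurable_fun setT g.
  apply/measurable_fun_pairP; split; first exact: measurable_tnth.
  exact: measurable_behead.
exists (fun i => g @^-1` F i).
  by rewrite -preimage_bigcup -FT preimage_setT.
move=> i; have [mF Fi] := Foo i; split.
  by rewrite -[X in measurable X]setTI; exact: mg.
rewrite /cons_measure /pushforward (_ : _ @^-1` _ = F i)//.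
by apply/seteqP; split=> p /=; rewrite gK.
Qed.

HB.instance Definition _ := Measure_isSigmaFinite.Build _ _ _
  cons_measure cons_sigma_finite.

End ConsMeasure.

Section LebesgueTuple.
Variable R : realType.

(* n-fold product of lebesgue_measure; mathcomp-analysis has binary products of
   measures only *)
Fixpoint lebesgue_tuple n :
    {sigma_finite_measure set (n.-tuple (measurableTypeR R)) -> \bar R} :=
  match n with
  | 0 => \d_ [tuple]
  | n.+1 => cons_measure (@lebesgue_measure R) (lebesgue_tuple n)
  end.

End LebesgueTuple.

Section Recursion.
Variable R : realType.
Implicit Types (n : nat) (kappa : seq nat) (beta : R).

(* The open positive part of the unit sphere of R^(n+1) is the graph of
   hemisphere over the positive part of the open unit ball of R^n; sphere_pt
   appends hemisphere y as last coordinate. *)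
Definition hemisphere n (y : 'rV[R]_n) : R :=
  Num.sqrt (1 - \sum_i y ord0 i ^+ 2).

Definition sphere_pt n (y : 'rV[R]_n) : 'cV[R]_n.+1 :=
  \col_i oapp (y ord0) (hemisphere y) (unlift ord_max i).

(* surface area element of the graph of phi : R^n -> R *)
Definition area_elt n (phi : 'rV[R]_n -> R) (y : 'rV[R]_n) : R :=
  Num.sqrt (1 + \sum_i ('D_(delta_mx ord0 i) phi y) ^+ 2).

Definition pos_ball n : set (n.-tuple (measurableTypeR R)) :=
  [set t | (forall i, 0 < tnth t i :> R) /\ \sum_i (tnth t i : R) ^+ 2 < 1].

(* integral of f over the unit vectors of R^(n+1) with positive entries, with
   respect to surface area *)
Definition pos_sphere_integral n (f : 'cV[R]_n.+1 -> R) : \bar R :=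
  (\int[lebesgue_tuple R n]_(t in @pos_ball n)
     (f (sphere_pt (\row_i tnth t i))
      * area_elt (@hemisphere n) (\row_i tnth t i))%:E)%E.

Definition has_eigenvalues n (A : 'M[R]_n) (s : seq R) : Prop :=
  char_poly A = \prod_(x <- s) ('X - x%:P).

(* nu_1, ..., nu_n, 0 are the eigenvalues of (I - q q^T) Lambda, with
   multiplicity. They are real for a unit vector q, since (I - q q^T) Lambda and
   the symmetric matrix (I - q q^T) Lambda (I - q q^T) have the same spectrum.
   Their order is immaterial: they are only used as arguments of symmetric
   polynomials. *)
Definition nu n (lam : 'rV[R]_n.+1) (q : 'cV[R]_n.+1) : n.-tuple R :=
  xget [tuple of nseq n 0] [set v : n.-tuple R |
    has_eigenvalues ((1%:M - q *m q^T) *m diag_mx lam) (rcons v 0)].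

Definition Gamma (a : R) : R :=
  \int[lebesgue_measure]_(t in `]0, +oo[) (t `^ (a - 1) * expR (- t)).

(* p(Lambda) for Lambda = diag_mx lam, and p(I_n) *)
Definition eval_diag n (p : {mpoly R[n]}) (lam : 'rV[R]_n) : R :=
  p.@[lam ord0].

Definition eval_id n (p : {mpoly R[n]}) : R := p.@[fun=> 1].

(* As kappa consists of nonzero parts only, kappa_n > 0 reads size kappa = n in
   rec_full, and (rec_drop being stated with n.+1 variables) kappa_(n+1) = 0
   reads size kappa <= n. *)
Record jack_recursion beta (C F : poly_family R) : Prop := JackRecursion {
  rec_sym : forall n kappa, (0 < n)%N -> is_part kappa -> (size kappa <= n)%N ->
    F n kappa \is symmetric (n := n) (R := R);
  rec_one : forall kappa, is_part kappa -> (size kappa <= 1)%N ->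
    forall x : R, (F 1%N kappa).@[fun=> x]
      = x ^+ nth 0%N kappa 0
        * \prod_(1 <= j < nth 0%N kappa 0) (1 + j%:R * (2 / beta));
  rec_full : forall n kappa, (1 < n)%N -> is_part kappa -> size kappa = n ->
    forall lam : 'rV[R]_n, eval_diag (F n kappa) lam
      = \det (diag_mx lam) * eval_diag (F n (strip (map predn kappa))) lam
        * \prod_(i < n) ((n - i)%N%:R + 2 / beta * ((nth 0%N kappa i)%:R - 1));
  rec_drop : forall n kappa, (0 < n)%N -> is_part kappa -> (size kappa <= n)%N ->
    forall lam : 'rV[R]_n.+1, (eval_diag (F n.+1 kappa) lam)%:E
      = ((eval_id (C n.+1 kappa) / eval_id (C n kappa)
          * (2 ^+ n * Gamma (n.+1%:R * beta / 2) / Gamma (beta / 2) ^+ n.+1))%:E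
        * pos_sphere_integral (fun q =>
            (\prod_i q i ord0 `^ (beta - 1))
              * (F n kappa).@[tnth (nu lam q)])%R)%E }.

End Recursion.

(* Main.v *)
(* Put a = beta/2. For unit q > 0 the matrix (1 - q q^T) Lambda has the
   characteristic polynomial z Q(z), where
     Q(z) = sum_i w_i prod_{j <> i} (z - lambda_j),   w_i = q_i^2,
   so the elementary symmetric polynomials of nu_1, ..., nu_n are linear in w,
   and w has a Dirichlet(a, ..., a) distribution under the density
   prod_i q_i^(beta - 1). The integral in (iii) is thus an operator A which
   sends f = F(e_1, ..., e_n) to a symmetric polynomial in n + 1 variables.
   A intertwines D_n^* + beta * (Euler operator) with D_{n+1}^*: comparing the
   second order parts (both are computed through the values of Q) leaves a sum
   over pairs l <> m of terms with the factor w_l w_m (d/dw_l - d/dw_m), which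
   integration by parts against the Dirichlet density cancels with what the
   first order parts leave. As A also respects the dominance order, it maps
   C_kappa in n variables to a multiple of C_kappa in n + 1 variables, a Jack
   polynomial being determined up to scaling by symmetry, triangularity and its
   eigenvalue. Evaluation at the identity, where all nu_i are 1, gives the
   constant; the coefficient of m_kappa in C_kappa does not depend on n, because
   setting the last variable to 0 maps C_kappa to C_kappa. Similarly (ii) holds
   because the product of all variables and a Jack polynomial is an
   eigenfunction. *)
From HB Require Import structures.
Require Import Defs.
From mathcomp Require Import all_boot all_order all_algebra perm.
From mathcomp.multinomials Require Import -(notations) mpoly.
From mathcomp.real_closed Require Import complex.
From mathcomp Require Import ring lra zify.
From mathcomp Require Import all_classical all_reals all_analysis.
From mathcomp Require Import measurable_realfun.

Set Implicit Arguments.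
Unset Strict Implicit.
Unset Printing Implicit Defensive.

Import Order.TTheory GRing.Theory Num.Theory.
Import numFieldNormedType.Exports.

Local Open Scope classical_set_scope.
Local Open Scope ring_scope.

(** The poles of [Dstar] shape the argument. Its eigenvalue equation is available at distinct
    coordinates only, while the roots of Q are not shown to be distinct; so the equation is
    rewritten in the coordinates e_1, ..., e_n, where its coefficients are polynomial and it holds
    everywhere. The poles also explain the Vandermonde factor in the computation of eigenvalues and
    the shift along (1, ..., 1) used before a variable is set to 0. Integration is kept apart from
    algebra: the measure enters through the Dirichlet moments of monomials, and A is the linear map
    that these moments define on polynomials. Relations that hold on the simplex sum w_i = 1 only
    are brought in by reading A as an integral again. Different partitions of k may share an
    eigenvalue. Along the dominance order it increases strictly, which is why every construction has
    to carry a bound on its support. The division by C_kappa(I_n) requires a nonzero value. This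
    follows from the steps (ii) and (iii) themselves, by induction on n + |kappa|, which is also the
    induction behind uniqueness. *)

(* The lemmas of mpoly, with their structures resolved for a realType: the
   generic statements leave unification problems that big_split and the like do
   not solve. *)
Section RealMpoly.
Variables (R : realType) (n : nat).
Implicit Types (p q : {mpoly R[n]}) (x : 'I_n -> R) (m : multinom n).

Lemma evalD x p q : (p + q).@[x] = p.@[x] + q.@[x] :> R.
Proof. exact: mevalD. Qed.

Lemma evalB x p q : (p - q).@[x] = p.@[x] - q.@[x] :> R.
Proof. exact: mevalB. Qed.

Lemma evalN x p : (- p).@[x] = - p.@[x] :> R.
Proof. exact: mevalN. Qed.

Lemma evalM x p q : (p * q).@[x] = p.@[x] * q.@[x] :> R.
Proof. exact: mevalM. Qed.

Lemma evalZ x c p : (c *: p).@[x] = c * p.@[x] :> R.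
Proof. exact: mevalZ. Qed.

Lemma evalC x c : (mpolyC n c).@[x] = c :> R.
Proof. exact: mevalC. Qed.

Lemma evalU x i : (mpolyX R (mnm1 i)).@[x] = x i :> R.
Proof. exact: mevalXU. Qed.

Lemma evalX x m : (mpolyX R m).@[x] = \prod_i x i ^+ m i :> R.
Proof. exact: mevalX. Qed.

Lemma evalXn x p k : (p ^+ k).@[x] = p.@[x] ^+ k :> R.
Proof. exact: rmorphXn. Qed.

Lemma eval_sum x (I : Type) (r : seq I) (P : pred I) (F : I -> {mpoly R[n]}) :
  (\sum_(i <- r | P i) F i).@[x] = \sum_(i <- r | P i) (F i).@[x] :> R.
Proof. exact: raddf_sum. Qed.

Lemma eval_prod x (I : Type) (r : seq I) (P : pred I) (F : I -> {mpoly R[n]}) :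
  (\prod_(i <- r | P i) F i).@[x] = \prod_(i <- r | P i) (F i).@[x] :> R.
Proof. exact: rmorph_prod. Qed.

Lemma mcoefD m p q : mcoeff m (p + q) = mcoeff m p + mcoeff m q :> R.
Proof. exact: mcoeffD. Qed.

Lemma mcoefB m p q : mcoeff m (p - q) = mcoeff m p - mcoeff m q :> R.
Proof. exact: mcoeffB. Qed.

Lemma mcoefZ m c p : mcoeff m (c *: p) = c * mcoeff m p :> R.
Proof. exact: mcoeffZ. Qed.

Lemma mcoef_sum m (I : Type) (r : seq I) (P : pred I) (F : I -> {mpoly R[n]}) :
  mcoeff m (\sum_(i <- r | P i) F i) = \sum_(i <- r | P i) mcoeff m (F i) :> R.
Proof. exact: raddf_sum. Qed.

Lemma derD i p q : (p + q)^`M(i) = p^`M(i) + q^`M(i) :> {mpoly R[n]}.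
Proof. exact: mderivD. Qed.

Lemma derZ i c p : (c *: p)^`M(i) = c *: p^`M(i) :> {mpoly R[n]}.
Proof. exact: mderivZ. Qed.

Lemma derM i p q : (p * q)^`M(i) = p^`M(i) * q + p * q^`M(i) :> {mpoly R[n]}.
Proof. exact: mderivM. Qed.

Lemma der_sum i (I : Type) (r : seq I) (P : pred I) (F : I -> {mpoly R[n]}) :
  (\sum_(k <- r | P k) F k)^`M(i) = \sum_(k <- r | P k) (F k)^`M(i)
  :> {mpoly R[n]}.
Proof. exact: (linear_sum (mderiv i)). Qed.

End RealMpoly.

(** * Uniqueness of Jack polynomials *)

Section EvalZero.
Variable R : realType.
Implicit Types n : nat.

Lemma base_expansion_inj n (B : nat) (f g : 'I_n -> nat) :
  (forall i, f i < B)%N -> (forall i, g i < B)%N ->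
  (\sum_(i < n) f i * B ^ i = \sum_(i < n) g i * B ^ i)%N -> f =1 g.
Proof.
elim: n f g => [|n IHn] f g fB gB; first by move=> _ [].
rewrite !big_ord_recl /= !expn0 !muln1.
have shift (h : 'I_n.+1 -> nat) :
    (\sum_(i < n) h (lift ord0 i) * B ^ bump 0 i
     = (\sum_(i < n) h (lift ord0 i) * B ^ i) * B)%N.
  by rewrite big_distrl; apply: eq_bigr => i _; rewrite /= expnSr mulnA.
rewrite !shift => E.
have B0 : (0 < B)%N by apply: leq_ltn_trans (fB ord0).
have E0 : f ord0 = g ord0.
  have := congr1 (modn^~ B) E.
  by rewrite ![(_ + _ * B)%N]addnC !modnMDl !modn_small.
have {}E : f \o lift ord0 =1 g \o lift ord0.
  apply: IHn => [i|i|]; [exact: fB|exact: gB|].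
  apply/eqP; rewrite -(eqn_pmul2r B0); apply/eqP.
  by move: E; rewrite E0 => /addnI.
by move=> i; case: (unliftP ord0 i) => [j ->|->//]; exact: E.
Qed.

(* Evaluation along the curve x_i = t ^ (B ^ i) turns distinct monomials into
   distinct powers of t. *)
Lemma mpoly_eq0_injective n (p : {mpoly R[n]}) :
  (forall x : 'I_n -> R, injective x -> p.@[x] = 0) -> p = 0.
Proof.
move=> p0; set B := (mmeasure mdeg p).+2.
pose e (m : multinom n) := (\sum_(i < n) m i * B ^ i)%N.
pose P : {poly R} := \sum_(m <- msupp p) mcoeff m p *: 'X^(e m).
(* The parameter starts at 2 because the powers of 0 and of 1 are not distinct; from 2 on, the
   points of the curve have distinct coordinates. *)
have PE (k : nat) : P.[k.+2%:R] = 0.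
  pose x (i : 'I_n) : R := k.+2%:R ^+ (B ^ i).
  rewrite -(p0 x).
    rewrite /P horner_sum mevalE; apply: eq_bigr => m _.
    rewrite hornerZ hornerXn; congr (_ * _).
    rewrite /e; elim/big_rec2: _ => // i y1 y2 _ <-.
    by rewrite exprD mulnC exprM.
  have xI : injective (GRing.exp (k.+2%:R : R)).
    by apply: ieexprIn; rewrite ?ltr0n ?(eqr_nat R _ 1).
  by move=> i j; rewrite /x => /xI /expnI /val_inj; apply.
have P0 : P = 0.
  apply/eqP/negPn/negP => Pn0.
  pose s := [seq k.+2%:R : R | k <- iota 0 (size P)].
  have := max_poly_roots (rs := s) Pn0; rewrite size_map size_iota ltnn => H.
  suff: false by []; apply: H.
    by apply/allP => _ /mapP[k _ ->]; apply/rootP.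
  rewrite map_inj_uniq ?iota_uniq// => a b /eqP.
  by rewrite eqr_nat => /eqP[].
have mB m i : m \in msupp p -> (m i < B)%N.
  move=> /msize_mdeg_lt; rewrite mdegE (bigD1 i)//= /B.
  by move: (mmeasure _ _) (\sum_(_ | _) _)%N => a b; lia.
apply/mpolyP => m0; rewrite mcoeff0.
have [m0p|] := boolP (m0 \in msupp p); last exact: memN_msupp_eq0.
have : P`_(e m0) = 0 by rewrite P0 coef0.
rewrite /P coef_sum (bigD1_seq m0) ?msupp_uniq//= big_seq_cond big1 ?addr0.
  by rewrite coefZ coefXn eqxx mulr1.
move=> m /andP[mp mm0]; rewrite coefZ coefXn; case: eqP => [/esym E|_]; last by rewrite mulr0.
case/negP: mm0; apply/eqP/mnmP; apply: base_expansion_inj E => i.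
  exact: mB mp.
exact: mB m0p.
Qed.

Lemma mpoly_eq_injective n (p q : {mpoly R[n]}) :
  (forall x : 'I_n -> R, injective x -> p.@[x] = q.@[x]) -> p = q.
Proof.
move=> pq; apply/eqP; rewrite -subr_eq0; apply/eqP/mpoly_eq0_injective => x xi.
by rewrite evalB pq// subrr.
Qed.

Lemma mpoly_eq_eval n (p q : {mpoly R[n]}) :
  (forall x : 'I_n -> R, p.@[x] = q.@[x]) -> p = q.
Proof. by move=> pq; apply: mpoly_eq_injective => x _. Qed.

End EvalZero.

Lemma card_ord_gt n (i : nat) : #|[pred j : 'I_n | (i < j)%N]| = (n - i.+1)%N.
Proof.
rewrite -sum1_card -(big_mkord (fun j => i < j)%N (fun=> 1%N)).
elim: n => [|n IHn]; first by rewrite big_geq.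
by rewrite big_mkcond big_nat_recr//= -big_mkcond IHn; case: ltnP; lia.
Qed.

(** * Leading term of the eigenvalue equation, with denominators cleared *)

Section LeadingEigenvalue.
Variable R : realType.
Variable n : nat.
Implicit Types (p : {mpoly R[n]}) (i j : 'I_n) (m : multinom n).

Let X i : {mpoly R[n]} := mpolyX R (mnm1 i).
Let prs := [pred ij : 'I_n * 'I_n | (ij.1 < ij.2)%N].
(** The Vandermonde product clears the poles of [Dstar]: for i <> j, [W i j] is V / (x_i - x_j) as a
    polynomial, the sign taking care of i > j. *)
Let V : {mpoly R[n]} := \prod_(ij | prs ij) (X ij.1 - X ij.2).
Let W' i j : {mpoly R[n]} := \prod_(kl | prs kl && (kl != (i, j))) (X kl.1 - X kl.2).
Let W i j : {mpoly R[n]} := if (i < j)%N then W' i j else - W' j i.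

Let VE i j : i != j -> V = (X i - X j) * W i j.
Proof.
move=> ij; rewrite /W /V; case: ltngtP => [lij|lji|/val_inj/eqP]; last by rewrite (negbTE ij).
  by rewrite (bigD1 (i, j)).
by rewrite (bigD1 (j, i))//= mulrN -mulNr opprB.
Qed.

Lemma lt_mnm1 i j : (i < j)%N -> (mnm1 j < mnm1 i)%O.
Proof.
move=> ij; apply/ltmcP; first by rewrite !mdeg1.
exists i => [k ki|]; rewrite !mnm1E -!val_eqE /=; last by rewrite eqxx gtn_eqF.
by rewrite !gtn_eqF ?(ltn_trans ki ij).
Qed.

Lemma mlead_subX i j : (i < j)%N ->
  mlead (X i - X j) = mnm1 i /\ mcoeff (mnm1 i) (X i - X j) = 1.
Proof.
move=> /lt_mnm1 lt.
split; last by rewrite mcoefB !mcoeffX eqxx (lt_eqF lt) subr0.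
by rewrite mleadDl ?mleadN ?mleadXm.
Qed.

Lemma mlead_le p m : (forall m', m' \in msupp p -> (m' <= m)%O) -> (mlead p <= m)%O.
Proof.
move=> pm; have [->|p0] := eqVneq p 0; first by rewrite mlead0 le0m.
exact/pm/mlead_supp.
Qed.

Lemma mcoeff_euler i p m : mcoeff m (X i * p^`M(i)) = (m i)%:R * mcoeff m p.
Proof.
move: p m; apply: mpolyind => [|c m' p _ _ IHp] m.
  by rewrite mderiv0 mulr0 !mcoeff0 mulr0.
rewrite mderivD mulrDr !mcoefD mulrDr IHp; congr (_ + _).
rewrite mderivZ mderivX -!scalerAr !mcoefZ mcoeffX.
have [m'0|m'0] := eqVneq (m' i) 0%N.
  rewrite m'0 mul0r mulr0; case: eqP => [<-|_]; last by rewrite !mulr0.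
  by rewrite m'0 mul0r.
rewrite -mpolyXD addmC submK ?lep1mP// mcoeffX.
by case: eqP => [<-|_]; rewrite ?mulr0// !mulr1 mulrC.
Qed.

Lemma mlead_euler i p : (mlead (X i * p^`M(i)) <= mlead p)%O.
Proof.
apply: mlead_le => m; rewrite mcoeff_msupp mcoeff_euler mulf_eq0 negb_or => /andP[_].
by rewrite -mcoeff_msupp; apply: msupp_le_mlead.
Qed.

Lemma euler2 i p : X i ^+ 2 * p^`M(i)^`M(i)
  = X i * (X i * p^`M(i))^`M(i) - X i * p^`M(i).
Proof.
rewrite mderivM /X mderivX mnm1E eqxx scale1r.
have -> : mnm_sub (mnm1 i) (mnm1 i) = @mnm0 n by apply/mnmP => k; rewrite mnmBE mnm0E subnn.
rewrite mpolyX0; ring.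
Qed.

Let Vn0 : V != 0.
Proof.
apply/prodf_neq0 => -[i j] /= /mlead_subX[_ c1]; apply/eqP => E.
by move: c1; rewrite E mcoeff0 => /esym/eqP; rewrite oner_eq0.
Qed.

(** x_i - x_j has leading monomial x_i if i < j and x_j otherwise. Hence [W i j * X i] reaches the
    leading monomial of V in the first case, and x_i d/dx_i then contributes the exponent of x_i; in
    the second case it stays strictly below and the coefficient is 0. *)
Let coefW i j p : i != j ->
  mcoeff (mnm_add (mlead V) (mlead p)) (W i j * X i ^+ 2 * p^`M(i))
  = if (i < j)%N then mleadc V * (mlead p i)%:R * mleadc p else 0.
Proof.
move=> ij; rewrite expr2 mulrA -mulrA.
have WX m : mcoeff (mnm_add (mnm1 i) m) (W i j * X i) = mcoeff m (W i j).
  exact: mcoeffMX.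
have Wn0 : W i j != 0.
  by move: Vn0; rewrite (VE ij); apply: contraNneq => ->; rewrite mulr0.
have Xn0 : X i != 0 by rewrite -mleadc_eq0 mleadXm mcoeffX eqxx oner_eq0.
case: ltngtP => [lij|lji|/val_inj/eqP]; last by rewrite (negbTE ij).
- have [l1 c1] := mlead_subX lij.
  have s0 : X i - X j != 0.
    by apply/eqP => E; move: c1; rewrite E mcoeff0 => /esym/eqP; rewrite oner_eq0.
  have VW : mlead V = mnm_add (mnm1 i) (mlead (W i j)) by rewrite (VE ij) mleadM// l1.
  rewrite mleadcMW ?mlead_euler//; last by rewrite VW mleadM// mleadXm addmC.
  rewrite mcoeff_euler mulrA VW WX; congr (_ * _ * _).
  by rewrite (VE ij) -l1 mleadcM l1 c1 mul1r.
- have [l1 _] := mlead_subX lji.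
  have s0 : X i - X j != 0.
    by move: Vn0; rewrite (VE ij); apply: contraNneq => ->; rewrite mul0r.
  have VW : mlead V = mnm_add (mnm1 j) (mlead (W i j)).
    by rewrite (VE ij) mleadM// -opprB mleadN l1.
  have lt : (mlead (W i j * X i)%R < mlead V)%O.
    by rewrite VW mleadM// mleadXm addmC ltmc_add2l lt_mnm1.
  by rewrite mleadcMW ?mlead_euler ?ltW// mcoeff_gt_mlead// mul0r.
Qed.

(** Compare the coefficients of lead(V) + lead(p) in V (D p - E p) = 0, where D is [Dstar]. By
    [coefW] the index i keeps one term for every j > i, whence n - i - 1 with i counted from 0. *)
Lemma lead_eigenvalue beta (E : R) p : p != 0 ->
  (forall x : 'I_n -> R, injective x -> Dstar beta p x = E * p.@[x]) ->
  E = \sum_i (mlead p i)%:R * ((mlead p i)%:R - 1)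
      + beta * \sum_i (mlead p i)%:R * (n - i.+1)%:R.
Proof.
move=> pn0 eig; set m := mlead p.
pose T i : {mpoly R[n]} := \sum_(j | j != i) W i j * X i ^+ 2 * p^`M(i).
pose Q := V * (\sum_i X i ^+ 2 * p^`M(i)^`M(i) - E *: p) + beta *: \sum_i T i.
have Q0 : Q = 0.
  apply: mpoly_eq0_injective => x xi.
  have WE i j : i != j -> (W i j).@[x] = V.@[x] / (x i - x j).
    move=> ij; rewrite (VE ij) evalM evalB !evalU mulrC mulKf//.
    by rewrite subr_eq0 (inj_eq xi).
  rewrite /Q evalD evalM evalB !evalZ !eval_sum -eig // /Dstar.
  rewrite (eq_bigr (fun i => x i ^+ 2 * p^`M(i)^`M(i).@[x])); last first.
    by move=> i _; rewrite evalM evalXn evalU.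
  have -> : \sum_i (T i).@[x] = V.@[x]
      * \sum_i \sum_(j | j != i) x i ^+ 2 / (x i - x j) * p^`M(i).@[x].
    rewrite mulr_sumr; apply: eq_bigr => i _; rewrite eval_sum mulr_sumr.
    apply: eq_bigr => j ij; rewrite evalM evalM evalXn WE 1?eq_sym//.
    by rewrite evalU; ring.
  ring.
have : mcoeff (mnm_add (mlead V) m) Q = 0 by rewrite Q0 mcoeff0.
have lV : mleadc V != 0 by rewrite mleadc_eq0.
have lp : mleadc p != 0 by rewrite mleadc_eq0.
rewrite mcoefD mcoefZ mleadcMW//; last first.
  apply: mlead_le => m'; rewrite mcoeff_msupp mcoefB mcoefZ mcoef_sum.
  move=> h; apply: msupp_le_mlead; rewrite mcoeff_msupp; apply: contraNneq h => p0.
  by rewrite p0 mulr0 subr0 big1// => i _; rewrite euler2 mcoefB !mcoeff_euler p0 !mulr0 subrr.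
have -> : mcoeff (mnm_add (mlead V) m) (\sum_i T i)
    = mleadc V * mleadc p * \sum_i (m i)%:R * (n - i.+1)%:R.
  rewrite mcoef_sum mulr_sumr; apply: eq_bigr => i _ /=.
  rewrite /T mcoef_sum (eq_bigr (fun j : 'I_n =>
     if (i < j)%N then mleadc V * (m i)%:R * mleadc p else 0)); last first.
    by move=> j ij; rewrite coefW 1?eq_sym.
  rewrite -big_mkcondr /= (eq_bigl (fun j : 'I_n => (i < j)%N)); last first.
    by move=> j; case: ltnP => ij; rewrite ?andbF// andbT -val_eqE gtn_eqF.
  rewrite sumr_const -mulr_natr (_ : #|_| = (n - i.+1)%N); first by ring.
  exact: card_ord_gt.
rewrite mcoefB mcoefZ mcoef_sum.
rewrite (eq_bigr (fun i => mleadc p * ((m i)%:R * ((m i)%:R - 1)))); last first.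
  move=> i _; rewrite euler2 mcoefB !mcoeff_euler -/m; ring.
rewrite -mulr_sumr -/m.
set A := \sum_i _; set B := \sum_i _ => H.
have /eqP : mleadc V * mleadc p * (A + beta * B - E) = 0 by rewrite -H /m; ring.
rewrite !mulf_eq0 (negbTE lV) (negbTE lp)/= subr_eq0 => /eqP <-//.
Qed.

End LeadingEigenvalue.

(** * Dominance for exponents that are not sorted *)

Section Dominance.
Local Open Scope nat_scope.
Implicit Types (n k : nat) (kappa mu : seq nat).

Definition dom_mnm n kappa (m : multinom n) : Prop :=
  mdeg m = sumn kappa /\
  forall I : {set 'I_n}, \sum_(i in I) m i <= sumn (take #|I| kappa).

Lemma sumn_take_nth (s : seq nat) k : sumn (take k s) = \sum_(i < k) nth 0 s i.
Proof.
elim: s k => [|x s IHs] [|k]; rewrite ?big_ord0 //=.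
  by rewrite big1// => i _; rewrite nth_nil.
by rewrite big_ord_recl /= IHs.
Qed.

Lemma sumn_strip s : sumn (strip s) = sumn s.
Proof. by elim: s => //= x s IHs; case: eqP => [->|] /=; rewrite IHs. Qed.

Lemma sorted_geq_nth s i j : sorted geq s -> i <= j -> nth 0 s j <= nth 0 s i.
Proof.
move=> ss ij; case: (ltnP j (size s)) => js; last by rewrite [nth _ _ j]nth_default.
have T : transitive geq by move=> a b c /= ab bc; exact: leq_trans bc ab.
have := sorted_leq_nth T leqnn 0 ss; apply; rewrite ?inE//.
exact: leq_ltn_trans js.
Qed.

(** With the threshold c = nth 0 mu k the sum of the k largest entries is k c plus the excesses over
    c; truncated subtraction annihilates the entries beyond the first k. Excesses can be summed in
    any order, so the formula survives a permutation of mu. *)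
Lemma sumn_take_threshold mu k : sorted geq mu -> k <= size mu ->
  nth 0 mu k * k + sumn [seq x - nth 0 mu k | x <- mu] = sumn (take k mu).
Proof.
move=> smu kmu; set c := nth 0 mu k.
rewrite -{1}(cat_take_drop k mu) map_cat sumn_cat.
have -> : sumn [seq x - c | x <- drop k mu] = 0.
  have : all (fun x => x <= c) (drop k mu).
    apply/(all_nthP 0) => i _; rewrite nth_drop; apply: sorted_geq_nth => //.
    exact: leq_addr.
  by elim: (drop k mu) => //= x s IHs /andP[xc /IHs ->]; rewrite addn0; apply/eqP.
rewrite addn0 -{1}(size_takel kmu).
have : all (fun x => c <= x) (take k mu).
  apply/(all_nthP 0) => i; rewrite size_takel// => ik; rewrite nth_take//.
  exact: sorted_geq_nth (ltnW ik).
elim: (take k mu) => [|x s IHs] /=; first by rewrite muln0.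
move=> /andP[cx /IHs <-]; rewrite mulnS.
by move: (c * _) (sumn _) => a b; lia.
Qed.

Lemma sum_mnm_tuple n (f : nat -> nat) (m : multinom n) :
  \sum_i f (m i) = sumn (map f (val m)).
Proof.
rewrite sumnE big_map; case: m => t /=.
by rewrite [RHS]big_tuple; apply: eq_bigr => i _; rewrite multinomE.
Qed.

Lemma sum_le_take n (m : multinom n) mu (I : {set 'I_n}) :
  sorted geq mu -> perm_eq (strip (val m)) mu ->
  \sum_(i in I) m i <= sumn (take #|I| mu).
Proof.
move=> smu pm.
have sumE (f : nat -> nat) : f 0 = 0 -> \sum_i f (m i) = sumn (map f mu).
  move=> f0; rewrite sum_mnm_tuple -(perm_sumn (perm_map f pm)).
  by elim: (val (val m)) => //= x s ->; case: eqP => [->|]//=; rewrite f0.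
have [kmu|] := leqP #|I| (size mu); last first.
  move=> /ltnW kmu; rewrite take_oversize//.
  have := sumE id erefl; rewrite map_id => <-.
  by rewrite [leqRHS](bigID (mem I))/= leq_addr.
rewrite -(sumn_take_threshold smu kmu); set c := nth 0 mu #|I|.
rewrite -(sumE (subn^~ c)) ?sub0n//.
rewrite [X in _ <= _ + X](bigID (mem I))/= addnA -[leqLHS]addn0 leq_add//.
rewrite mulnC -sum_nat_const -big_split/= leq_sum// => i _.
by rewrite -leq_subLR.
Qed.

Lemma expoE n kappa i : expo n kappa i = nth 0 kappa i.
Proof. by rewrite /expo multinomE tnth_mktuple. Qed.

Lemma val_expo n kappa : size kappa <= n ->
  expo n kappa = kappa ++ nseq (n - size kappa) 0 :> seq nat.
Proof.
move=> kn; apply: (@eq_from_nth _ 0).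
  by rewrite size_tuple size_cat size_nseq subnKC.
move=> i; rewrite size_tuple => i_n.
have -> : i = Ordinal i_n by [].
rewrite -tnth_nth -multinomE -/(expo n kappa) expoE nth_cat nth_nseq if_same.
by case: ltnP => // /(nth_default 0) ->.
Qed.

Lemma dom_mnm_sumn n kappa m : @dom_mnm n kappa m -> mdeg m = sumn kappa.
Proof. by case. Qed.

Lemma dom_mnm_lead n kappa (m : multinom n) j : dom_mnm kappa m -> j <= n ->
  \sum_(i < j) nth 0 m i <= \sum_(i < j) nth 0 kappa i.
Proof.
move=> [_ +] jn; have wI : injective (widen_ord jn).
  by move=> a b /(congr1 val)/= /val_inj.
move=> /(_ [set widen_ord jn i | i : 'I_j]).
rewrite card_imset// card_ord big_imset/=; last by move=> a b _ _ /wI.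
rewrite sumn_take_nth; apply: leq_trans; apply: eq_leq.
by rewrite [RHS]big_mkcond; apply: eq_bigr => i _; rewrite (mnm_nth 0).
Qed.

Lemma dominated_trans kappa mu n m : dominated mu kappa -> sumn mu = sumn kappa ->
  @dom_mnm n mu m -> dom_mnm kappa m.
Proof.
move=> mk smk [dm dI]; split=> [|I]; first by rewrite dm.
exact: leq_trans (dI I) (mk _).
Qed.

Lemma perm_dom_mnm n (m : multinom n) mu : sorted geq mu ->
  perm_eq (strip (val m)) mu -> dom_mnm mu m.
Proof.
move=> smu pm; split=> [|I]; last exact: sum_le_take.
by rewrite -(perm_sumn pm) sumn_strip /mdeg sumnE.
Qed.

Lemma strip_expo n kappa : is_part kappa -> size kappa <= n ->
  strip (val (expo n kappa)) = kappa.
Proof.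
by move=> /andP[_ k0] kn; rewrite [X in strip X](val_expo kn) strip_cat_nseq.
Qed.

Lemma perm_is_part mu kappa : is_part mu -> is_part kappa -> perm_eq mu kappa ->
  mu = kappa.
Proof.
move=> /andP[sm _] /andP[sk _]; apply: (@sorted_eq _ geq) => //.
  by move=> a b c /= ab bc; exact: leq_trans bc ab.
by move=> a b; rewrite /= andbC => /anti_leq.
Qed.

End Dominance.

Section Abel.
Variable R : realDomainType.
Implicit Types (c d : nat -> R) (n : nat).

(** Summation by parts; the induction carries c_k (d_0 + ... + d_k) <= sum_{i <= k} c_i d_i. As the
    total of d is 0, c may have any sign. *)
Lemma abel_ge0 n c d :
  (forall i, (i.+1 < n)%N -> c i.+1 <= c i) ->
  (forall j, (j <= n)%N -> 0 <= \sum_(i < j) d i) -> \sum_(i < n) d i = 0 ->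
  0 <= \sum_(i < n) c i * d i.
Proof.
case: n => [|n] cc dd d0; first by rewrite big_ord0.
suff H k : (k < n.+1)%N -> c k * \sum_(i < k.+1) d i <= \sum_(i < k.+1) c i * d i.
  by have := H n (ltnSn n); rewrite d0 mulr0.
elim: k => [|k IHk] kn; first by rewrite !big_ord1.
rewrite big_ord_recr [leRHS]big_ord_recr /= mulrDr lerD2r.
apply: le_trans (IHk (ltnW kn)); apply: ler_wpM2r; last exact: cc.
exact/dd/ltnW.
Qed.

End Abel.

Section Uniqueness.
Variable R : realType.
Implicit Types (n k : nat) (kappa mu : seq nat) (beta : R).

Definition dom_supp n kappa (p : {mpoly R[n]}) : Prop :=
  forall m, m \in msupp p -> dom_mnm kappa m.

Definition jack_eigenvalue beta n kappa : R :=
  rho beta kappa + beta * (sumn kappa)%:R * (n%:R - 1).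

Lemma jack_eigenvalueE beta n kappa : (size kappa <= n)%N ->
  jack_eigenvalue beta n kappa
  = \sum_(i < n) (nth 0%N kappa i)%:R * ((nth 0%N kappa i)%:R - 1)
    + beta * \sum_(i < n) (nth 0%N kappa i)%:R * (n - i.+1)%:R.
Proof.
move=> kn; rewrite /jack_eigenvalue /rho.
have -> : sumn kappa = (\sum_(i < n) nth 0%N kappa i)%N.
  by rewrite -sumn_take_nth take_oversize.
rewrite big_mkord (big_ord_widen_cond _ xpredT
  (fun i => (nth 0%N kappa i)%:R * ((nth 0%N kappa i)%:R - 1 - beta * i%:R)) kn).
rewrite /= big_mkcond /= natr_sum mulr_sumr mulr_suml -big_split mulr_sumr -big_split /=.
apply: eq_bigr => i _; rewrite natrB// -natr1.
by case: ltnP => [_|/(nth_default 0%N) E]; rewrite ?E; ring.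
Qed.

(** With d = b - a the difference of the two sides is sum d_i^2 + 2 sum a_i d_i - sum d_i + beta sum
    (n - i - 1) d_i. Here sum d_i = 0, and the sums against a_i and n - i - 1 are nonnegative by
    [abel_ge0], so equality leaves sum d_i^2 = 0. *)
Lemma eigenvalue_strict n beta (a b : nat -> nat) : 0 <= beta ->
  (forall i, (i.+1 < n)%N -> (a i.+1 <= a i)%N) ->
  (forall j, (j <= n)%N -> (\sum_(i < j) a i <= \sum_(i < j) b i)%N) ->
  (\sum_(i < n) a i = \sum_(i < n) b i)%N ->
  \sum_(i < n) (a i)%:R * ((a i)%:R - 1) + beta * \sum_(i < n) (a i)%:R * (n - i.+1)%:R
  = \sum_(i < n) (b i)%:R * ((b i)%:R - 1) + beta * \sum_(i < n) (b i)%:R * (n - i.+1)%:R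
    :> R ->
  forall i : 'I_n, a i = b i.
Proof.
move=> b0 adec ab abn E.
pose d (i : nat) : R := (b i)%:R - (a i)%:R.
have dsum j : \sum_(i < j) d i = (\sum_(i < j) b i)%:R - (\sum_(i < j) a i)%:R.
  by rewrite sumrB !natr_sum.
have dn : \sum_(i < n) d i = 0 by rewrite dsum abn subrr.
have dj j : (j <= n)%N -> 0 <= \sum_(i < j) d i.
  by move=> jn; rewrite dsum subr_ge0 ler_nat ab.
have H1 : 0 <= \sum_(i < n) (a i)%:R * d i.
  by apply: (@abel_ge0 _ n (fun i => (a i)%:R)) => // i /adec; rewrite ler_nat.
have H2 : 0 <= \sum_(i < n) (n - i.+1)%:R * d i.
  apply: (@abel_ge0 _ _ (fun i => (n - i.+1)%:R)) => // i i_n.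
  by rewrite ler_nat; lia.
have : \sum_(i < n) d i ^+ 2 + 2 * \sum_(i < n) (a i)%:R * d i
    - \sum_(i < n) d i + beta * \sum_(i < n) (n - i.+1)%:R * d i = 0.
  move: E => /esym/eqP; rewrite -subr_eq0 => /eqP; apply: etrans.
  rewrite !mulr_sumr -!sumrN -!big_split /= -sumrN -big_split /=.
  by apply: eq_bigr => i _; rewrite /d; ring.
rewrite dn subr0 => H0.
have : \sum_(i < n) d i ^+ 2 == 0.
  rewrite eq_le sumr_ge0 ?andbT => [|i _]; last exact: sqr_ge0.
  have : 0 <= beta * \sum_(i < n) (n - i.+1)%:R * d i by apply: mulr_ge0.
  move: H0 H1; move: (\sum_(i < n) _) (\sum_(i < n) _) (beta * _) => x y z.
  by move=> *; lra.
rewrite psumr_eq0 => [/allP H i|i _]; last exact: sqr_ge0.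
move: (H i (mem_index_enum _)); rewrite sqrf_eq0 subr_eq0 eqr_nat.
by move=> /eqP.
Qed.

Lemma mcoeff_msym_mono n mu (m : multinom n) :
  mcoeff m (msym_mono R n mu) = (perm_eq (strip (val m)) mu)%:R.
Proof.
rewrite /msym_mono mcoef_sum.
have [pm|npm] := boolP (perm_eq (strip (val m)) mu).
  have dm : (mdeg m < (sumn mu).+1)%N.
    by rewrite ltnS -(perm_sumn pm) sumn_strip /mdeg sumnE.
  rewrite (bigD1 (BMultinom dm))//= mcoeffX eqxx big1 ?addr0// => m' /andP[_ mm'].
  by move: mm'; rewrite mcoeffX bmeqP /= => /negbTE ->.
rewrite big1// => m' pm'; rewrite mcoeffX; case: eqP => // E.
by rewrite -E pm' in npm.
Qed.

Lemma jack_dom n beta kappa (p : {mpoly R[n]}) : is_jack beta kappa p -> dom_supp kappa p.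
Proof.
case=> _ _ [a _ ->] _ m; rewrite mcoeff_msupp mcoef_sum => h.
have [mu /andP[mup /asboolP mk] amu] : exists2 mu,
    (mu \in partns n (sumn kappa)) && `[< dominated mu kappa >]
    & mcoeff m (a mu *: msym_mono R n mu) != 0.
  apply: contrapT => H; case/negP: h; apply/eqP; rewrite big_seq_cond big1// => mu hmu.
  by apply/eqP; apply: contrapT => /negP cmu; apply: H; exists mu.
move: amu; rewrite mcoefZ mcoeff_msym_mono mulf_eq0 negb_or pnatr_eq0 eqb0 negbK.
move=> /andP[_ pm]; move: mup; rewrite mem_partns => /and3P[/andP[smu _] _ /eqP smk].
by apply: (dominated_trans mk smk); apply: perm_dom_mnm.
Qed.

Lemma jack_coef_neq0 n beta kappa (p : {mpoly R[n]}) :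
  is_part kappa -> (size kappa <= n)%N ->
  is_jack beta kappa p -> mcoeff (expo n kappa) p != 0.
Proof.
move=> kp kn [_ _ [a a0 ->] _].
rewrite mcoef_sum big_mkcond (bigD1_seq kappa) ?uniq_partns ?mem_partns ?kp ?kn ?eqxx//=.
rewrite asboolT; last by move=> j.
rewrite mcoefZ mcoeff_msym_mono strip_expo// perm_refl mulr1.
rewrite big_seq_cond big1 ?addr0// => mu /andP[]; rewrite mem_partns => /and3P[mup _ _].
move=> muk; case: ifP => // _; rewrite mcoefZ mcoeff_msym_mono strip_expo//.
case: (boolP (perm_eq kappa mu)) => [pm|]; last by rewrite mulr0.
by case/eqP: muk; apply/esym/perm_is_part.
Qed.

Lemma symmetricZ n c (p : {mpoly R[n]}) :
  p \is symmetric (n := n) (R := R) -> c *: p \is symmetric (n := n) (R := R).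
Proof. exact: rpredZ. Qed.

Lemma symmetricB n (p q : {mpoly R[n]}) : p \is symmetric (n := n) (R := R) ->
  q \is symmetric (n := n) (R := R) -> p - q \is symmetric (n := n) (R := R).
Proof. exact: rpredB. Qed.

Lemma DstarB n beta (p q : {mpoly R[n]}) c x :
  Dstar beta (p - c *: q) x = Dstar beta p x - c * Dstar beta q x.
Proof.
have D i (r s : {mpoly R[n]}) : (r - c *: s)^`M(i) = r^`M(i) - c *: s^`M(i).
  by rewrite -scaleNr derD derZ scaleNr.
rewrite /Dstar [c * _]mulrDr opprD addrACA; congr (_ + _).
  rewrite mulr_sumr -sumrB; by apply: eq_bigr => i _; rewrite !D evalB evalZ; ring.
rewrite mulrCA -mulrBr; congr (_ * _); rewrite mulr_sumr -sumrB.
apply: eq_bigr => i _; rewrite mulr_sumr -sumrB.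
by apply: eq_bigr => j _; rewrite D evalB evalZ; ring.
Qed.

(** If q is not 0, symmetry makes its leading exponent decreasing and the support bound makes it
    dominated by kappa. It yields the same eigenvalue as kappa, so it is kappa by
    [eigenvalue_strict]; but that coefficient is 0. *)
Lemma dom_supp_eq0 n beta kappa (q : {mpoly R[n]}) : 0 < beta ->
  is_part kappa -> (size kappa <= n)%N ->
  q \is symmetric (n := n) (R := R) -> dom_supp kappa q ->
  (forall x : 'I_n -> R, injective x ->
    Dstar beta q x = jack_eigenvalue beta n kappa * q.@[x]) ->
  mcoeff (expo n kappa) q = 0 -> q = 0.
Proof.
move=> b0 kp kn qs qd qe q0; apply/eqP/negPn/negP => qn0.
have := lead_eigenvalue qn0 qe; rewrite jack_eigenvalueE// => /esym E.
have /qd qm := mlead_supp qn0; set m := mlead q in E qm *.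
have mE : m =1 expo n kappa.
  move=> i; rewrite expoE (mnm_nth 0%N).
  apply: (@eigenvalue_strict n beta (nth 0%N m) (nth 0%N kappa)); rewrite ?ltW//.
  - move=> k kn'.
    have := mlead_msym_sorted qs (i := Ordinal (ltnW kn')) (j := Ordinal kn').
    by rewrite !(mnm_nth 0%N) /=; apply.
  - by move=> j jn; exact: dom_mnm_lead.
  - rewrite -[RHS]sumn_take_nth take_oversize// -(dom_mnm_sumn qm) mdegE.
    by apply: eq_bigr => k _; rewrite (mnm_nth 0%N).
  - rewrite -E; congr (_ + _ * _); apply: eq_bigr => k _; by rewrite (mnm_nth 0%N).
by move: qn0; rewrite -mleadc_eq0 -/m (_ : m = expo n kappa) ?q0 ?eqxx//; apply/mnmP.
Qed.

(** [dom_supp_eq0] is applied to q minus the multiple of p with the same coefficient at kappa. Every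
    proportionality between Jack polynomials below comes from here; the factor may be 0. *)
Lemma jack_unique n beta kappa (p q : {mpoly R[n]}) : 0 < beta ->
  is_part kappa -> (size kappa <= n)%N -> is_jack beta kappa p ->
  q \is symmetric (n := n) (R := R) -> dom_supp kappa q ->
  (forall x : 'I_n -> R, injective x ->
    Dstar beta q x = jack_eigenvalue beta n kappa * q.@[x]) ->
  q = (mcoeff (expo n kappa) q / mcoeff (expo n kappa) p) *: p.
Proof.
move=> b0 kp kn jp qs qd qe; set c := _ / _.
have pk := jack_coef_neq0 kp kn jp.
apply/eqP; rewrite -subr_eq0; apply/eqP.
apply: (@dom_supp_eq0 _ beta kappa) => //.
- by apply: symmetricB => //; apply: symmetricZ; apply: jack_sym jp.
- move=> m; rewrite mcoeff_msupp mcoefB mcoefZ => h.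
  have [/qd//|mq] := boolP (m \in msupp q).
  apply: (jack_dom jp); rewrite mcoeff_msupp; apply: contraNneq h => ->.
  by rewrite (memN_msupp_eq0 mq) mulr0 subrr.
- move=> x xi; rewrite DstarB qe// (jack_eigen jp xi) evalB evalZ -/(jack_eigenvalue _ _ _).
  by rewrite /jack_eigenvalue; ring.
- by rewrite mcoefB mcoefZ /c divfK ?subrr.
Qed.

End Uniqueness.

(** * Integrals over the positive part of the sphere *)

Section GammaIntegrals.
Variable R : realType.
Local Notation mu := (@lebesgue_measure R).
Implicit Types (a b c r s u : R).

Definition affine r c (x : measurableTypeR R) : measurableTypeR R := r * x + c.

Lemma measurable_affine r c : measurable_fun setT (affine r c).
Proof. by apply: measurable_funD => //; apply: measurable_funM. Qed.

Lemma ge0_integral_affine r c (f : measurableTypeR R -> \bar R) : 0 < r ->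
  measurable_fun setT f -> (forall x, 0 <= f x)%E ->
  (\int[mu]_x f x = r%:E * \int[mu]_x f (affine r c x))%E.
Proof.
move=> r0 mf f0.
have r0' : (0 <= r) by exact: ltW.
pose k := NngNum r0'.
have -> : (\int[mu]_x f (affine r c x) = \int[pushforward mu (affine r c)]_x f x)%E.
  by rewrite (ge0_integral_pushforward (measurable_affine r c)).
rewrite -[r%:E]/(k%:num%:E) -ge0_integral_mscale//; first exact: measurable_affine.
move=> maff; apply: eq_measure_integral => A mA _.
apply: lebesgue_measure_unique mA => //= _ [[x y]] _ <-.
rewrite /mscale /=.
have -> : pushforward mu (affine r c) `]x, y] = mu `](x - c) / r, (y - c) / r].
  congr (mu _); apply/seteqP; split => z /=; rewrite !in_itv /= /affine.
    by rewrite ltr_pdivrMr// ler_pdivlMr// lerBrDr ltrBlDr ![z * r]mulrC.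
  by rewrite ltr_pdivrMr// ler_pdivlMr// lerBrDr ltrBlDr ![z * r]mulrC.
rewrite !lebesgue_measure_itv /= !lte_fin ltr_pM2r ?invr_gt0// ltrD2r.
case: ifPn => _; last by rewrite mule0.
by rewrite -!EFinB -EFinM; congr EFin; field; rewrite gt_eqF.
Qed.

(** The density u^(c - 1) of Gamma and Dirichlet integrals, extended by 0: domains such as (0, +oo),
    disks and simplices become conditions carried by the integrand. *)
Definition pospow c u : R := if 0 < u then u `^ (c - 1) else 0.

Lemma pospow_ge0 c u : 0 <= pospow c u.
Proof. by rewrite /pospow; case: ifP => // _; exact: powR_ge0. Qed.

Lemma measurable_pospow c : measurable_fun setT (pospow c : measurableTypeR R -> R).
Proof.
apply: measurable_fun_ifT => //.
  exact: measurable_fun_ltr.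
Qed.

Lemma pospowM c u v : 0 < u -> pospow c (u * v) = u `^ (c - 1) * pospow c v.
Proof.
move=> u0; rewrite /pospow pmulr_rgt0//; case: ifP => [v0|_]; last by rewrite mulr0.
by rewrite powRM ?ltW.
Qed.

Lemma powRS c u : 0 < u -> u `^ c = u * u `^ (c - 1).
Proof.
move=> u0; have E : u `^ (1 + (c - 1)) = u `^ 1 * u `^ (c - 1).
  by apply: powRD; rewrite (gt_eqF u0) implybT.
by rewrite -{2}[u]powRr1 ?ltW// -E; congr (_ `^ _); ring.
Qed.

Lemma integral_if (P : R -> bool) (D : set R) (g : R -> R) : (forall x, P x <-> D x) ->
  (\int[mu]_x (if P x then g x else 0)%:E = \int[mu]_(x in D) (g x)%:E)%E.
Proof.
move=> PD; rewrite [RHS]integral_mkcond; apply: eq_integral => x _.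
rewrite /patch; case: ifPn => [/PD Dx|nPx]; first by rewrite mem_set.
by rewrite memNset// => /PD; apply/negP.
Qed.

Lemma integral_expR_tail s :
  (\int[mu]_u (if s < u then expR (- u) else 0)%:E = (expR (- s))%:E)%E.
Proof.
have dF (x : R) : is_derive x (1 : R) (fun u : R => - expR (- u)) (expR (- x)).
  by apply: is_derive_eq; rewrite mulrN1 opprK.
have cf : continuous (fun u : R => expR (- u)).
  by move=> x; apply: continuous_comp; [exact: opp_continuous|exact: continuous_expR].
rewrite (@integral_if (fun u => s < u) `]s, +oo[%classic); last first.
  by move=> x; rewrite /= in_itv/= andbT.
rewrite integral_itv_obnd_cbnd; last first.
  apply/measurable_EFinP; apply: measurable_funTS.
  exact: continuous_measurable_fun.
rewrite (@ge0_continuous_FTC2y _ _ (fun u => - expR (- u)) s 0).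
- by rewrite sub0e EFinN oppeK.
- by move=> x _; exact: expR_ge0.
- exact: continuous_subspaceT.
- by rewrite -oppr0; apply: cvgN; exact: cvgr_expR.
- by move=> x _; apply: ex_derive; exact: dF.
- by apply: cvg_at_right_filter; apply: cvgN; exact: cf.
- by move=> x _; rewrite derive1E; apply: derive_val.
Qed.

Lemma is_derive_powR p (x : R) : 0 < x ->
  is_derive x (1 : R) (fun y => y `^ p) (p * x `^ (p - 1)).
Proof.
move=> x0; have xi : x \in `]0, +oo[ by rewrite in_itv/= x0.
apply: DeriveDef; first exact: derivable_powR.
by rewrite -derive1E powR_derive1.
Qed.

Lemma continuous_powR p (x : R) : 0 < x -> {for x, continuous (fun y => y `^ p)}.
Proof.
move=> x0; apply: differentiable_continuous; apply/derivable1_diffP.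
exact: (@ex_derive _ _ _ _ _ _ _ (is_derive_powR p x0)).
Qed.

(** For p < 1 the integrand is unbounded at 0. The fundamental theorem of calculus is applied on
    [r / (k + 2), r] and k tends to infinity, by monotone convergence for the integrals and
    continuity of the power at 0 for the values. *)
Lemma integral_pospow_lt p r : 0 < p -> 0 < r ->
  (\int[mu]_y (if y < r then pospow p y else 0)%:E = (r `^ p / p)%:E)%E.
Proof.
move=> p0 r0.
pose F k : set R := `[r * harmonic k.+1, r]%classic.
have h0 k : 0 < r * harmonic k.+1 by rewrite mulr_gt0// harmonic_gt0.
have hr k : r * harmonic k.+1 < r.
  by rewrite gtr_pMr// /harmonic invf_lt1 ?ltr0n// ltr1n.
have FE : \bigcup_k F k = `]0, r]%classic.
  apply/seteqP; split => [y [k _]|y] /=.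
    by rewrite /F /= !in_itv /= => /andP[ky ->]; rewrite (lt_le_trans (h0 k) ky).
  rewrite in_itv /= => /andP[y0 yr].
  exists (Num.truncn (r / y)) => //; rewrite /F /= in_itv /= yr andbT.
  rewrite /harmonic ler_pdivrMr ?ltr0n// mulrC -ler_pdivrMr//.
  by rewrite (le_trans (ltW (truncnS_gt _)))// ler_nat.
pose f (y : measurableTypeR R) : \bar R := (y `^ (p - 1))%:E.
have Fk k : (\int[mu]_(y in F k) f y = ((r `^ p - (r * harmonic k.+1) `^ p) / p)%:E)%E.
  have D (x : R) : 0 < x -> is_derive x (1 : R) (fun y => y `^ p / p) (x `^ (p - 1)).
    move=> x0; have := is_derive_powR p x0 => dp.
    rewrite (_ : (fun y => y `^ p / p) = p^-1 \*: (fun y : R => y `^ p)); last first.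
      by apply/funext => y; rewrite /= mulrC.
    by apply: is_derive_eq; rewrite -[RHS]mul1r -(mulVf (lt0r_neq0 p0)) -mulrA.
  have C (x : R) : 0 < x -> {for x, continuous (fun y => y `^ p / p)}.
    by move=> x0; apply: cvgM; [exact: continuous_powR|exact: cvg_cst].
  rewrite (@continuous_FTC2 _ (fun y => y `^ (p - 1)) (fun y => y `^ p / p)) => [|//|||].
  - by rewrite -EFinB mulrBl.
  - apply: continuous_in_subspaceT => x; rewrite inE/= in_itv/= => /andP[hx _].
    by apply: continuous_powR; apply: lt_le_trans (h0 k) hx.
  - split => [x||].
    + rewrite in_itv /= => /andP[hx _]; apply: (@ex_derive _ _ _ _ _ _ _ (D x _)).
      exact: lt_trans (h0 k) hx.
    + by apply: cvg_at_right_filter; apply: C; exact: h0.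
    + by apply: cvg_at_left_filter; apply: C.
  - move=> x; rewrite in_itv /= => /andP[hx _]; rewrite derive1E.
    by apply: (@derive_val _ _ _ _ _ _ _ (D x _)); exact: lt_trans (h0 k) hx.
have cF : (\int[mu]_(y in F k) f y @[k --> \oo] --> \int[mu]_(y in \bigcup_k F k) f y)%E.
  apply: ge0_nondecreasing_set_cvg_integral.
  - apply/nondecreasing_seqP => k; apply/subsetPset => x; rewrite /F /= !in_itv /=.
    move=> /andP[h ->]; rewrite andbT (le_trans _ h)//.
    by rewrite ler_pM2l// /harmonic lef_pV2 ?posrE ?ltr0n// ler_nat.
  - by move=> k; exact: measurable_itv.
  - move=> k; apply/measurable_EFinP; apply: measurable_funTS; exact: measurable_powR.
  - by move=> k x _; rewrite lee_fin powR_ge0.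
have cG : (((r `^ p - (r * harmonic k.+1) `^ p) / p)%:E @[k --> \oo] --> (r `^ p / p)%:E)%E.
  apply: cvg_EFin; first by near=> k.
  rewrite -[X in X / p]subr0; apply: cvgM; last exact: cvg_cst.
  apply: cvgB; first exact: cvg_cst.
  have /cvg_at_rightP := powR_cvg0 p0; apply; split => //.
  rewrite -[X in _ --> X](mulr0 r); apply: cvgM; first exact: cvg_cst.
  by have := @cvg_harmonic R; rewrite -(cvg_shiftS (@harmonic R)).
rewrite (@eq_integral _ _ _ mu setT (fun y => (if (0 < y) && (y < r) then y `^ (p - 1) else 0)%:E)); last first.
  by move=> y _; rewrite /pospow; case: (0 < y); case: (y < r).
rewrite (@integral_if (fun y => (0 < y) && (y < r)) `]0, r[%classic); last first.
  by move=> x; rewrite /= in_itv.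
rewrite integral_itv_bndo_bndc; last first.
  by apply/measurable_EFinP; apply: measurable_funTS; exact: measurable_powR.
rewrite -FE; rewrite (funext Fk) in cF.
exact: (cvg_unique _ cF cG).
Unshelve. all: by end_near.
Qed.

End GammaIntegrals.

(** * Gamma function and half beta integrals *)

Section GammaBeta.
Variable R : realType.
Local Notation mu := (@lebesgue_measure R).
Local Notation TR := (measurableTypeR R).
Implicit Types (a b c r s u : R).

Lemma measurable_fun_if0 d (T : measurableType d) (P : T -> bool) (g : T -> R) :
  measurable_fun setT P -> measurable_fun setT g ->
  measurable_fun setT (fun x => if P x then g x else 0).
Proof. by move=> mP mg; apply: measurable_fun_ifT. Qed.

Lemma tonelli_real (f : TR * TR -> R) : measurable_fun setT f ->
  (forall x, 0 <= f x) ->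
  (\int[mu]_x \int[mu]_y (f (x, y))%:E = \int[mu]_y \int[mu]_x (f (x, y))%:E)%E.
Proof.
move=> mf f0; apply: (@fubini_tonelli _ _ _ _ _ mu mu (EFin \o f)).
  exact/measurable_EFinP.
by move=> x /=; rewrite lee_fin.
Qed.

Lemma ge0_integralZ_real k (f : TR -> R) : 0 <= k -> measurable_fun setT f ->
  (forall x, 0 <= f x) -> (\int[mu]_x (k * f x)%:E = k%:E * \int[mu]_x (f x)%:E)%E.
Proof.
move=> k0 mf f0; under eq_integral do rewrite EFinM.
rewrite ge0_integralZl_EFin//; first by move=> x _; rewrite lee_fin.
exact/measurable_EFinP.
Qed.

(* exp (- s) is the integral of exp (- u) over u > s. *)
Lemma integral_expR_layer (g h : TR -> R) :
  measurable_fun setT g -> measurable_fun setT h -> (forall t, 0 <= g t) ->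
  (\int[mu]_t (g t * expR (- h t))%:E
   = \int[mu]_u ((expR (- u))%:E * \int[mu]_t (if h t < u then g t else 0)%:E))%E.
Proof.
move=> mg mh g0.
pose f (x : TR * TR) : R := g x.1 * (if h x.1 < x.2 then expR (- x.2) else 0).
have mE : measurable_fun setT (fun u : TR => expR (- u)).
  by apply: measurableT_comp => //; exact: measurable_expR.
have mf : measurable_fun setT f.
  apply: measurable_funM; first exact: measurableT_comp mg measurable_fst.
  apply: measurable_fun_if0.
    apply: measurable_fun_ltr; [exact: measurableT_comp mh measurable_fst|exact: measurable_snd].
  exact: measurableT_comp mE measurable_snd.
transitivity (\int[mu]_t \int[mu]_u (f (t, u))%:E)%E.
  apply: eq_integral => t _; rewrite EFinM -integral_expR_tail -ge0_integralZ_real//.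
    by apply: measurable_fun_if0 => //; exact: measurable_fun_ltr.
  by move=> u; case: ifP => // _; exact: expR_ge0.
rewrite (tonelli_real mf); last first.
  by move=> x; rewrite mulr_ge0//; case: ifP => // _; exact: expR_ge0.
apply: eq_integral => u _; rewrite -ge0_integralZ_real ?expR_ge0//.
- by apply: eq_integral => t _; rewrite /f /=; congr EFin; case: ifP; rewrite ?mulr0// mulrC.
- by apply: measurable_fun_if0 => //; exact: measurable_fun_ltr.
- by move=> t; case: ifP.
Qed.

(** With values in the extended reals, the functional equation and Tonelli apply before finiteness
    is known; finiteness is then deduced from the functional equation. *)
Definition gammaE a : \bar R := (\int[mu]_t (pospow a t * expR (- t))%:E)%E.

Lemma measurable_gamma a : measurable_fun setT (fun t : TR => pospow a t * expR (- t)).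
Proof.
apply: measurable_funM; first exact: measurable_pospow.
by apply: measurableT_comp => //; exact: measurable_expR.
Qed.

Lemma measurable_EFin_gamma a :
  measurable_fun setT (fun t : TR => (pospow a t * expR (- t))%:E).
Proof. by have /measurable_EFinP := measurable_gamma a; apply. Qed.

Lemma gammaE_ge0 a : (0 <= gammaE a)%E.
Proof.
by apply: integral_ge0 => t _; rewrite lee_fin mulr_ge0 ?pospow_ge0 ?expR_ge0.
Qed.

(** In place of integration by parts: e^(- t) is spread over its tail by [integral_expR_layer], and
    the inner integral of t^(a - 1) over 0 < t < u is u^a / a. *)
Lemma gammaES a : 0 < a -> gammaE (a + 1) = (a%:E * gammaE a)%E.
Proof.
move=> a0; suff -> : gammaE a = (a^-1%:E * gammaE (a + 1))%E.
  by rewrite muleA -EFinM divff ?mul1e// gt_eqF.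
rewrite /gammaE (@integral_expR_layer (pospow a) id)//; last 2 first.
- exact: measurable_pospow.
- by move=> t; exact: pospow_ge0.
rewrite -ge0_integralZ_real ?invr_ge0 ?ltW//; last 2 first.
- exact: measurable_gamma.
- by move=> t; rewrite mulr_ge0 ?pospow_ge0 ?expR_ge0.
apply: eq_integral => u _.
have [u0|u0] := ltP 0 u.
  rewrite integral_pospow_lt// -!EFinM; congr EFin.
  by rewrite /pospow u0 addrK; field; rewrite gt_eqF.
rewrite (_ : pospow _ u = 0) ?mul0r ?mulr0; last by rewrite /pospow ltNge u0.
rewrite integral0_eq ?mule0// => t _; rewrite /pospow; case: ifP => // tu.
by rewrite ltNge (ltW (lt_le_trans tu u0)).
Qed.

(** The substitution t = y^2 is avoided: over the layer y^2 < u the power integrates to u^a / (2 a),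
    so the value is Gamma(a + 1) / (2 a). *)
Lemma integral_gauss a : 0 < a ->
  (\int[mu]_y (pospow (2 * a) y * expR (- y ^+ 2))%:E = (2^-1)%:E * gammaE a)%E.
Proof.
move=> a0; transitivity (((2 * a)^-1)%:E * gammaE (a + 1))%E; last first.
  rewrite gammaES// muleA -EFinM; congr ((_)%:E * _)%E.
  by field; rewrite gt_eqF.
rewrite (@integral_expR_layer (pospow (2 * a)) (fun y => y ^+ 2)); last 3 first.
- exact: measurable_pospow.
- exact: exprn_measurable.
- by move=> t; exact: pospow_ge0.
rewrite -ge0_integralZ_real ?invr_ge0 ?mulr_ge0 ?(ltW a0)//; last 2 first.
- exact: measurable_gamma.
- by move=> t; rewrite mulr_ge0 ?pospow_ge0 ?expR_ge0.
apply: eq_integral => u _.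
have [u0|u0] := ltP 0 u.
  rewrite (@eq_integral _ _ _ mu setT
      (fun t => (if t < Num.sqrt u then pospow (2 * a) t else 0)%:E)); last first.
    move=> t _; congr EFin; rewrite /pospow; have [t0|t0] := ltP 0 t; last by rewrite !if_same.
    by rewrite -{1}(sqr_sqrtr (ltW u0)) ltr_pXn2r ?nnegrE ?sqrtr_ge0 ?ltW.
  rewrite integral_pospow_lt ?mulr_gt0 ?sqrtr_gt0// -!EFinM; congr EFin.
  rewrite powRrM (powR_mulrn 2) ?sqrtr_ge0// sqr_sqrtr ?ltW//.
  by rewrite /pospow u0 addrK; field; rewrite gt_eqF.
rewrite (_ : pospow (a + 1) u = 0) ?mul0r ?mulr0; last by rewrite /pospow ltNge u0.
rewrite integral0_eq ?mule0// => t _; rewrite /pospow; case: ifP => // tu.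
by move: (lt_le_trans tu u0); rewrite ltNge sqr_ge0.
Qed.

Lemma gammaE1 : gammaE 1 = 1%E.
Proof.
rewrite -[RHS]/(1%:E) -[X in X%:E]expR0 -[X in expR X]oppr0 -integral_expR_tail.
apply: eq_integral => t _; congr EFin; rewrite /pospow subrr powRr0.
by case: ifP; rewrite ?mul1r ?mul0r.
Qed.

Lemma gammaE_nat_fin n : (gammaE n.+1%:R < +oo)%E.
Proof.
elim: n => [|n IHn]; first by rewrite gammaE1 ltry.
by rewrite -natr1 gammaES// lte_mul_pinfty ?lee_fin ?ler0n.
Qed.

(** The functional equation reduces to b >= 1, where t^(b - 1) <= 1 + t^n for an integer n >= b - 1;
    at integers finiteness follows by induction. *)
Lemma gammaE_fin a : 0 < a -> (gammaE a < +oo)%E.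
Proof.
suff H b : 1 <= b -> (gammaE b < +oo)%E.
  move=> a0; have /H : 1 <= a + 1 by rewrite lerDr ltW.
  rewrite gammaES//; case: (gammaE a) (gammaE_ge0 a) => [x| |] _.
  - by move=> _; rewrite ltry.
  - by rewrite gt0_muley ?lte_fin.
  - by [].
move=> b1; pose n := Num.truncn b.
have bn : b <= n.+1%:R by rewrite ltW// truncnS_gt.
apply: (@le_lt_trans _ _ (gammaE 1 + gammaE n.+1%:R)%E); last first.
  apply: lte_add_pinfty; last exact: gammaE_nat_fin.
  by rewrite gammaE1 ltry.
rewrite /gammaE -ge0_integralD//; last 4 first.
- by move=> t _; rewrite lee_fin mulr_ge0 ?pospow_ge0 ?expR_ge0.
- exact: measurable_EFin_gamma.
- by move=> t _; rewrite lee_fin mulr_ge0 ?pospow_ge0 ?expR_ge0.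
- exact: measurable_EFin_gamma.
apply: ge0_le_integral => //.
- by move=> t _; rewrite lee_fin mulr_ge0 ?pospow_ge0 ?expR_ge0.
- exact: measurable_EFin_gamma.
- apply: emeasurable_funD; exact: measurable_EFin_gamma.
- move=> t _; rewrite -EFinD lee_fin -mulrDl ler_wpM2r ?expR_ge0// /pospow.
  case: ifP => [t0|_]; last by rewrite addr0.
  rewrite subrr powRr0; have [t1|t1] := leP 1 t.
    by rewrite -[leLHS]add0r lerD// ler_powR// lerB.
  rewrite -[leLHS]addr0 lerD ?powR_ge0//.
  rewrite -[leRHS](_ : 1 `^ (b - 1) = 1); last by rewrite powR1.
  by apply: ge0_ler_powR; rewrite ?nnegrE ?subr_ge0 ?ler01 //; exact: ltW.
Qed.

Lemma gammaE_gt0 a : 0 < a -> (0 < gammaE a)%E.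
Proof.
suff H b : 1 <= b -> (0 < gammaE b)%E.
  move=> a0; have /H : 1 <= a + 1 by rewrite lerDr ltW.
  by rewrite gammaES// pmule_rgt0 ?lte_fin.
move=> b1; apply: (@lt_le_trans _ _ (expR (- 1))%:E); first by rewrite lte_fin expR_gt0.
rewrite -integral_expR_tail; apply: ge0_le_integral => //.
- by move=> t _; rewrite lee_fin; case: ifP => // _; exact: expR_ge0.
- apply/measurable_EFinP; apply: measurable_fun_if0; first exact: measurable_fun_ltr.
  by apply: measurableT_comp => //; exact: measurable_expR.
- exact: measurable_EFin_gamma.
- move=> t _; rewrite lee_fin; case: ifP => [t1|_]; last first.
    by rewrite mulr_ge0 ?pospow_ge0 ?expR_ge0.
  rewrite -[leLHS]mul1r ler_wpM2r ?expR_ge0// /pospow (lt_trans _ t1)//.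
  by rewrite -[leLHS](powRr0 t); apply: ler_powR; rewrite ?subr_ge0 //; exact: ltW.
Qed.

Lemma gamma_fin_num a : 0 < a -> gammaE a \is a fin_num.
Proof. by move=> a0; rewrite ge0_fin_numE ?gammaE_ge0// gammaE_fin. Qed.

Lemma GammaE a : 0 < a -> (Gamma a)%:E = gammaE a.
Proof.
move=> a0; rewrite -(fineK (gamma_fin_num a0)); congr (_%:E).
rewrite /Gamma /Rintegral /gammaE; congr fine; rewrite integral_mkcond.
apply: eq_integral => t _; rewrite /patch /pospow.
have [t0|t0] := boolP (0 < t); first by rewrite mem_set//= in_itv/= t0.
by rewrite memNset ?mul0r//= in_itv/= andbT; apply/negP.
Qed.

Lemma Gamma_gt0 a : 0 < a -> 0 < Gamma a.
Proof. by move=> a0; rewrite -lte_fin GammaE// gammaE_gt0. Qed.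

Lemma GammaS a : 0 < a -> Gamma (a + 1) = a * Gamma a.
Proof.
move=> a0; have a1 : 0 < a + 1 by rewrite addr_gt0.
by apply: EFin_inj; rewrite GammaE// gammaES// EFinM GammaE.
Qed.

(** Half a beta integral in the variable y^2. The coordinates of the sphere are integrated out one
    at a time, in terms of q rather than of w = q^2. *)
Definition disk_int a c s : \bar R :=
  (\int[mu]_y (pospow (2 * a) y * pospow c (s - y ^+ 2))%:E)%E.

Lemma measurable_disk a c s :
  measurable_fun setT (fun y : TR => pospow (2 * a) y * pospow c (s - y ^+ 2)).
Proof.
apply: measurable_funM; first exact: measurable_pospow.
apply: measurableT_comp; first exact: measurable_pospow.
by apply: measurable_funB => //; exact: exprn_measurable.
Qed.

Lemma measurable_EFin_disk a c s :
  measurable_fun setT (fun y : TR => (pospow (2 * a) y * pospow c (s - y ^+ 2))%:E).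
Proof. by have /measurable_EFinP := measurable_disk a c s; apply. Qed.

Lemma disk_int_scale a c s : 0 < s ->
  disk_int a c s = (disk_int a c 1 * (pospow (a + c) s)%:E)%E.
Proof.
move=> s0; have r0 : 0 < Num.sqrt s by rewrite sqrtr_gt0.
rewrite /disk_int (@ge0_integral_affine _ (Num.sqrt s) 0)//; last 2 first.
- exact: measurable_EFin_disk.
- by move=> y; rewrite lee_fin mulr_ge0 ?pospow_ge0.
rewrite muleC (eq_integral (fun y : TR =>
   ((Num.sqrt s `^ (2 * a - 1) * s `^ (c - 1)) * (pospow (2 * a) y * pospow c (1 - y ^+ 2)))%:E)).
  rewrite ge0_integralZ_real ?mulr_ge0 ?powR_ge0//; last 2 first.
  - exact: measurable_disk.
  - by move=> y; rewrite mulr_ge0 ?pospow_ge0.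
  rewrite muleAC muleC; congr (_ * _)%E; rewrite -EFinM; congr EFin.
  rewrite mulrAC [X in X * _]mulrC -powRS// powRrM (powR_mulrn 2) ?ltW// sqr_sqrtr ?ltW//.
  rewrite /pospow s0 -powRD; last by rewrite (gt_eqF s0) implybT.
  by congr (_ `^ _); ring.
move=> y _; congr EFin; rewrite /affine addr0 pospowM// exprMn sqr_sqrtr ?ltW//.
by rewrite -[s - _](_ : s * (1 - y ^+ 2) = _); [rewrite pospowM//; ring|ring].
Qed.

Lemma disk_int_npos a c s : s <= 0 -> disk_int a c s = 0%E.
Proof.
move=> s0; apply: integral0_eq => y _.
rewrite [pospow c _]/pospow ltNge (_ : s - y ^+ 2 <= 0) ?mulr0//.
by rewrite subr_le0 (le_trans s0)// sqr_ge0.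
Qed.

Lemma disk_intE0 a c s : disk_int a c s = (disk_int a c 1 * (pospow (a + c) s)%:E)%E.
Proof.
have [/disk_int_scale//|s0] := ltP 0 s.
by rewrite disk_int_npos// /pospow ltNge s0 mule0.
Qed.

Lemma disk_int_ge0 a c s : (0 <= disk_int a c s)%E.
Proof. by apply: integral_ge0 => y _; rewrite lee_fin mulr_ge0 ?pospow_ge0. Qed.

(** Tonelli for y^(2 a - 1) (s - y^2)^(c - 1) e^(- s). Integrating y first gives the left side by
    homogeneity in s; integrating s first, after the shift s -> s + y^2, leaves Gamma(c) e^(- y^2)
    and then [integral_gauss]. *)
Lemma gamma_beta a c : 0 < a -> 0 < c ->
  (disk_int a c 1 * gammaE (a + c) = (2^-1)%:E * gammaE a * gammaE c)%E.
Proof.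
move=> a0 c0.
pose f (x : TR * TR) : R :=
  pospow (2 * a) x.2 * (pospow c (x.1 - x.2 ^+ 2) * expR (- x.1)).
have mE : measurable_fun setT (fun u : TR => expR (- u)).
  by apply: measurableT_comp => //; exact: measurable_expR.
have msq : measurable_fun setT (fun x : TR * TR => x.1 - x.2 ^+ 2).
  apply: measurable_funB; first exact: measurable_fst.
  exact: measurableT_comp (exprn_measurable 2) measurable_snd.
have mf : measurable_fun setT f.
  apply: measurable_funM.
    exact: measurableT_comp (measurable_pospow (2 * a)) measurable_snd.
  apply: measurable_funM; last exact: measurableT_comp mE measurable_fst.
  exact: measurableT_comp (measurable_pospow c) msq.
have f0 x : 0 <= f x by rewrite !mulr_ge0 ?pospow_ge0 ?expR_ge0.
have mshift y : measurable_fun setT (fun s : TR => pospow c (s - y ^+ 2) * expR (- s)).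
  apply: measurable_funM mE; apply: measurableT_comp; first exact: measurable_pospow.
  exact: measurable_funB.
transitivity (\int[mu]_s \int[mu]_y (f (s, y))%:E)%E.
  rewrite /gammaE -ge0_integralZl ?disk_int_ge0//; last 2 first.
  - exact: measurable_EFin_gamma.
  - by move=> s _; rewrite lee_fin mulr_ge0 ?pospow_ge0 ?expR_ge0.
  apply: eq_integral => s _; rewrite EFinM muleA -disk_intE0 muleC -ge0_integralZ_real ?expR_ge0//.
  - by apply: eq_integral => y _; congr EFin; rewrite /f /=; ring.
  - exact: measurable_disk.
  - by move=> y; rewrite mulr_ge0 ?pospow_ge0.
rewrite (tonelli_real mf f0) -integral_gauss// -GammaE// muleC -ge0_integralZ_real; last 3 first.
- exact/ltW/Gamma_gt0.
- apply: measurable_funM; first exact: measurable_pospow.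
  by apply: measurableT_comp; [exact: measurable_expR|apply: measurableT_comp => //; exact: exprn_measurable].
- by move=> y; rewrite mulr_ge0 ?pospow_ge0 ?expR_ge0.
apply: eq_integral => y _; rewrite mulrCA.
rewrite EFinM [X in (_ * X)%E]EFinM GammaE//.
rewrite /f /= ge0_integralZ_real ?pospow_ge0//; last by move=> s; rewrite mulr_ge0 ?pospow_ge0 ?expR_ge0.
congr (_ * _)%E; rewrite muleC (@ge0_integral_affine _ 1 (y ^+ 2))//; last 2 first.
- exact/measurable_EFinP.
- by move=> s; rewrite lee_fin mulr_ge0 ?pospow_ge0 ?expR_ge0.
rewrite mul1e /gammaE -ge0_integralZ_real ?expR_ge0//; last 2 first.
- exact: measurable_gamma.
- by move=> s; rewrite mulr_ge0 ?pospow_ge0 ?expR_ge0.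
apply: eq_integral => s _; congr EFin; rewrite /affine mul1r addrK opprD expRD; ring.
Qed.

Lemma disk_intE a c s : 0 < a -> 0 < c ->
  disk_int a c s = (Gamma a * Gamma c / (2 * Gamma (a + c)) * pospow (a + c) s)%:E.
Proof.
move=> a0 c0; rewrite disk_intE0 EFinM; congr (_ * _)%E.
have g0 := Gamma_gt0 (addr_gt0 a0 c0).
have := gamma_beta a0 c0; rewrite -!GammaE ?addr_gt0// -!EFinM.
case: (disk_int a c 1) (disk_int_ge0 a c 1) => [k| |] _.
- by move=> [] E; congr EFin; apply: (mulIf (lt0r_neq0 g0)); rewrite E; field; rewrite gt_eqF.
- by rewrite gt0_mulye ?lte_fin.
- by rewrite gt0_mulNye ?lte_fin.
Qed.

End GammaBeta.

(** * Dirichlet integrals *)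

Section Dirichlet.
Variable R : realType.
Local Notation mu := (@lebesgue_measure R).
Local Notation TR := (measurableTypeR R).

Lemma ge0_integral_lebesgue_tupleS n (f : n.+1.-tuple TR -> \bar R) :
  measurable_fun setT f -> (forall t, 0 <= f t)%E ->
  (\int[lebesgue_tuple R n.+1]_t f t
   = \int[mu]_x \int[lebesgue_tuple R n]_t f [tuple of x :: t])%E.
Proof.
move=> mf f0 /=.
have mp := @measurable_tuple_of_pair _ TR n.
transitivity (\int[(mu \x lebesgue_tuple R n)%E]_p f (tuple_of_pair p))%E.
  rewrite -[RHS](@ge0_integral_pushforward _ _ _ _ _ _ mp _ setT f)//.
rewrite (@fubini_tonelli1 _ _ _ _ _ mu (lebesgue_tuple R n) (f \o @tuple_of_pair _ TR n))//.
  exact: measurableT_comp.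
by move=> p; exact: f0.
Qed.

(** Dirichlet density in coordinates y_i with y_i^2 = w_i: n free coordinates have the parameters
    e_i, and c is the parameter of the last one, whose square is s - sum y_i^2. The size s is free
    so that coordinates can be split off. *)
Definition simplex_weight n (e : 'I_n -> R) (c s : R) (t : n.-tuple TR) : R :=
  \prod_i pospow (2 * e i) (tnth t i) * pospow c (s - \sum_i (tnth t i : R) ^+ 2).

Lemma simplex_weight_ge0 n e c s (t : n.-tuple TR) : 0 <= simplex_weight e c s t.
Proof. by rewrite mulr_ge0 ?pospow_ge0// prodr_ge0// => i _; exact: pospow_ge0. Qed.

Lemma measurable_simplex_weight n (e : 'I_n -> R) c s :
  measurable_fun setT (simplex_weight e c s).
Proof.
apply: measurable_funM.
  apply: measurable_prod => i _.
  exact: measurableT_comp (measurable_pospow _) (measurable_tnth i).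
apply: measurableT_comp; first exact: measurable_pospow.
apply: measurable_funB => //; apply: measurable_sum => i.
exact: measurableT_comp (exprn_measurable 2) (measurable_tnth i).
Qed.

Lemma measurable_EFin_simplex_weight n (e : 'I_n -> R) c s :
  measurable_fun setT (fun t => (simplex_weight e c s t)%:E).
Proof. by have /measurable_EFinP := @measurable_simplex_weight n e c s; apply. Qed.

Lemma simplex_weight_cons n (e : 'I_n.+1 -> R) c s (x : TR) (t : n.-tuple TR) :
  simplex_weight e c s [tuple of x :: t]
  = pospow (2 * e ord0) x * simplex_weight (e \o lift ord0) c (s - x ^+ 2) t.
Proof.
rewrite /simplex_weight !big_ord_recl -mulrA; congr (pospow _ _ * (_ * pospow _ _)).
  by apply: eq_bigr => i _; rewrite tnthS.
by rewrite opprD addrA; congr (_ - _); apply: eq_bigr => i _; rewrite tnthS.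
Qed.

(** Split off the first coordinate x: what remains has size s - x^2, and the outer integral is a
    [disk_int]. The Gamma factor of the remaining parameters in its numerator cancels the
    denominator of the induction hypothesis. *)
Lemma integral_simplex_weight n (e : 'I_n -> R) c s : (forall i, 0 < e i) -> 0 < c ->
  (\int[lebesgue_tuple R n]_t (simplex_weight e c s t)%:E
   = ((\prod_i Gamma (e i)) * Gamma c / (2 ^+ n * Gamma (\sum_i e i + c))
      * pospow (\sum_i e i + c) s)%:E)%E.
Proof.
elim: n e s => [|n IHn] e s e0 c0.
  rewrite /= integral_dirac//; last first.
    exact: measurable_EFin_simplex_weight.
  rewrite diracT mul1e /simplex_weight !big_ord0 subr0 !mul1r add0r.
  by rewrite divff ?mul1r// gt_eqF// Gamma_gt0.
have S0 : 0 < \sum_i (e \o lift ord0) i + c.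
  by apply: ltr_wpDl => //; apply: sumr_ge0 => i _; exact/ltW/e0.
rewrite ge0_integral_lebesgue_tupleS; last 2 first.
- exact: measurable_EFin_simplex_weight.
- by move=> t; rewrite lee_fin simplex_weight_ge0.
pose k : R := (\prod_i Gamma ((e \o lift ord0) i)) * Gamma c
  / (2 ^+ n * Gamma (\sum_i (e \o lift ord0) i + c)).
rewrite (eq_integral (fun x : TR => (k * (pospow (2 * e ord0) x
    * pospow (\sum_i (e \o lift ord0) i + c) (s - x ^+ 2)))%:E)); last first.
  move=> x _; under eq_integral do rewrite simplex_weight_cons EFinM.
  rewrite ge0_integralZl_EFin ?pospow_ge0//; last 2 first.
  - by move=> t _; rewrite lee_fin simplex_weight_ge0.
  - exact: measurable_EFin_simplex_weight.
  by rewrite IHn//= -EFinM; congr EFin; rewrite -/k; ring.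
rewrite ge0_integralZ_real; last 3 first.
- rewrite /k divr_ge0// ?mulr_ge0 ?exprn_ge0 ?(ltW (Gamma_gt0 _))//.
  by rewrite prodr_ge0// => i _; rewrite ltW// Gamma_gt0// e0.
- exact: measurable_disk.
- by move=> x; rewrite mulr_ge0 ?pospow_ge0.
have := disk_intE s (e0 ord0) S0; rewrite /disk_int => ->.
rewrite -EFinM !big_ord_recl /= addrA; congr EFin; rewrite /k /= exprS.
have g1 := Gamma_gt0 S0; rewrite /= in g1 *.
have g2 : 0 < Gamma (e ord0 + \sum_(i < n) e (lift ord0 i) + c).
  by apply: Gamma_gt0; rewrite -addrA addr_gt0.
field; rewrite !gt_eqF// exprn_gt0//.
Qed.

End Dirichlet.

Section SphereIntegral.
Variable R : realType.
Local Notation mu := (@lebesgue_measure R).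
Local Notation TR := (measurableTypeR R).
Implicit Types (n : nat) (beta : R).

Lemma lift_ord_max n (i : 'I_n) : lift ord_max i = widen_ord (leqnSn n) i.
Proof. by apply: val_inj; rewrite /= /bump leqNgt ltn_ord add0n. Qed.

Lemma prod_ord_max n (F : 'I_n.+1 -> R) :
  \prod_i F i = \prod_i F (lift ord_max i) * F ord_max.
Proof.
by rewrite big_ord_recr /=; congr (_ * _); apply: eq_bigr => i _; rewrite lift_ord_max.
Qed.

Lemma sum_ord_max n (F : 'I_n.+1 -> R) :
  \sum_i F i = \sum_i F (lift ord_max i) + F ord_max.
Proof.
by rewrite big_ord_recr /=; congr (_ + _); apply: eq_bigr => i _; rewrite lift_ord_max.
Qed.

Lemma sphere_pt_lift n (y : 'rV[R]_n) i : sphere_pt y (lift ord_max i) ord0 = y ord0 i.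
Proof. by rewrite mxE liftK. Qed.

Lemma sphere_pt_max n (y : 'rV[R]_n) : sphere_pt y ord_max ord0 = hemisphere y.
Proof. by rewrite mxE unlift_none. Qed.

Lemma hemisphere_gt0 n (y : 'rV[R]_n) : \sum_i y ord0 i ^+ 2 < 1 -> 0 < hemisphere y.
Proof. by move=> y1; rewrite sqrtr_gt0 subr_gt0. Qed.

Lemma hemisphere_sqr n (y : 'rV[R]_n) : \sum_i y ord0 i ^+ 2 < 1 ->
  hemisphere y ^+ 2 = 1 - \sum_i y ord0 i ^+ 2.
Proof. by move=> y1; rewrite sqr_sqrtr// subr_ge0 ltW. Qed.

Lemma derive_line n (f : 'rV[R]_n -> R) (y v : 'rV[R]_n) :
  'D_v f y = 'D_1 (fun t : R => f (t *: v + y)) 0.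
Proof.
rewrite /derive (_ : (fun h => h^-1 *: ((f \o shift y) (h *: v) - f y))
  = (fun h => h^-1 *: (((fun t : R => f (t *: v + y)) \o shift 0) (h *: 1)
                       - f (0 *: v + y))))//.
apply/funext => h /=; rewrite addr0 scale0r add0r.
by rewrite /GRing.scale /= mulr1.
Qed.

Lemma derive_hemisphere n (y : 'rV[R]_n) i : \sum_i y ord0 i ^+ 2 < 1 ->
  'D_(delta_mx ord0 i) (@hemisphere R n) y = - y ord0 i / hemisphere y.
Proof.
move=> y1; rewrite derive_line.
pose A : R := 1 - \sum_(j | j != i) y ord0 j ^+ 2.
have -> : (fun t : R => hemisphere (t *: delta_mx ord0 i + y))
    = (fun t : R => Num.sqrt (A - (t + y ord0 i) ^+ 2)).
  apply/funext => t; rewrite /hemisphere; congr Num.sqrt.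
  rewrite (bigD1 i)//= !mxE !eqxx mulr1 /A opprD addrA addrAC; congr (1 - _ - _).
  by apply: eq_bigr => j ji; rewrite !mxE eqxx (negbTE ji) mulr0 add0r.
have u0 : 0 < A - (0 + y ord0 i) ^+ 2.
  by move: y1; rewrite (bigD1 i)//= /A add0r -subr_gt0 opprD addrA addrAC.
have hE : hemisphere y = Num.sqrt (A - (0 + y ord0 i) ^+ 2).
  by rewrite /hemisphere (bigD1 i)//= /A add0r opprD addrA addrAC.
pose B (t : R) : R := A - (t + y ord0 i) ^+ 2.
have D1 : is_derive (0 : R) (1 : R) B (- (y ord0 i *+ 2)).
  apply: is_derive_eq; rewrite /GRing.scale /=; ring.
have D2 := is_derive1_sqrt u0.
have D3 : is_derive (0 : R) (1 : R) (Num.sqrt \o B) ((2 * Num.sqrt (B 0))^-1 * - (y ord0 i *+ 2)).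
  exact: is_derive1_comp.
rewrite (@derive_val _ _ _ _ _ _ _ D3) hE -/(B 0).
have h0 : Num.sqrt (B 0) != 0 by rewrite gt_eqF// sqrtr_gt0.
by field.
Qed.

Lemma area_elt_hemisphere n (y : 'rV[R]_n) : \sum_i y ord0 i ^+ 2 < 1 ->
  area_elt (@hemisphere R n) y = (hemisphere y)^-1.
Proof.
move=> y1; have h0 := hemisphere_gt0 y1.
rewrite /area_elt (eq_bigr (fun i => y ord0 i ^+ 2 / hemisphere y ^+ 2)); last first.
  by move=> i _; rewrite derive_hemisphere// exprMn sqrrN exprVn.
rewrite -mulr_suml hemisphere_sqr//.
have u0 : 0 < 1 - \sum_i y ord0 i ^+ 2 by rewrite subr_gt0.
rewrite (_ : 1 + _ = (hemisphere y ^+ 2)^-1); last first.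
  by rewrite hemisphere_sqr//; field; rewrite gt_eqF.
by rewrite -exprVn sqrtr_sqr ger0_norm// invr_ge0 ltW.
Qed.

Lemma eq_pos_sphere_integral n (f g : 'cV[R]_n.+1 -> R) :
  (forall q : 'cV[R]_n.+1, (forall i, 0 < q i ord0) -> \sum_i q i ord0 ^+ 2 = 1 -> f q = g q) ->
  pos_sphere_integral f = pos_sphere_integral g.
Proof.
move=> fg; apply: eq_integral => t; rewrite inE => -[t0 t1]; congr ((_ * _)%:E).
set y : 'rV[R]_n := \row_i tnth t i.
have y1 : \sum_i y ord0 i ^+ 2 < 1.
  by rewrite (eq_bigr (fun i => tnth t i ^+ 2))// => i _; rewrite mxE.
apply: fg.
  move=> i; case: (unliftP ord_max i) => [j ->|->].
    by rewrite sphere_pt_lift mxE.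
  by rewrite sphere_pt_max hemisphere_gt0.
rewrite sum_ord_max sphere_pt_max hemisphere_sqr//.
by under eq_bigr do rewrite sphere_pt_lift; rewrite addrC subrK.
Qed.

(* Unnormalized moment of the Dirichlet(a, ..., a) density, i.e. the moment of
   w_i = q_i^2 for the density prod_i q_i^(2 a - 1) on the sphere. *)
Definition dirichlet_moment n (a : R) (m : multinom n.+1) : R :=
  (\prod_i Gamma (a + (m i)%:R)) / (2 ^+ n * Gamma (\sum_i (a + (m i)%:R))).

Lemma pospow_mul_exp a k (x : R) : pospow (2 * a) x * (x ^+ 2) ^+ k = pospow (2 * (a + k%:R)) x.
Proof.
rewrite /pospow; case: ifP => [x0|_]; last by rewrite mul0r.
rewrite -exprM -powR_mulrn ?ltW// -powRD; last by rewrite (gt_eqF x0) implybT.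
by congr (_ `^ _); rewrite natrM; ring.
Qed.

Lemma integral_linear_comb d (T : measurableType d) (nu : {measure set T -> \bar R})
    (I : eqType) (s : seq I) (c : I -> R) (f : I -> T -> R) (v : I -> R) :
  (forall i, measurable_fun setT (f i)) -> (forall i x, 0 <= f i x) ->
  (forall i, \int[nu]_x (f i x)%:E = (v i)%:E)%E ->
  (\int[nu]_x (\sum_(i <- s) c i * f i x)%:E = (\sum_(i <- s) c i * v i)%:E)%E.
Proof.
move=> mf f0 fv.
have fi i : nu.-integrable setT (EFin \o f i).
  apply/integrableP; split; first exact/measurable_EFinP.
  rewrite (eq_integral (fun x => (f i x)%:E)) ?fv ?ltry// => x _ /=.
  by rewrite ger0_norm.
under eq_integral do rewrite -sumEFin.
rewrite (@integral_sum _ _ _ _ _ _ _ (fun i x => (c i * f i x)%:E))//.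
  rewrite -sumEFin; apply: eq_bigr => i _.
  transitivity ((c i)%:E * \int[nu]_x (EFin \o f i) x)%E; first by rewrite -integralZl.
  by have -> : (\int[nu]_x (EFin \o f i) x = (v i)%:E)%E by exact: fv.
by move=> i; rewrite (_ : (fun x => _) = (fun x => (c i)%:E * (EFin \o f i) x)%E)//; exact: integrableZl.
Qed.

Lemma simplex_weight_out n (e : 'I_n -> R) c (t : n.-tuple TR) :
  t \notin @pos_ball R n -> simplex_weight e c 1 t = 0.
Proof.
move=> tn; rewrite /simplex_weight; have [/forallP t0|] := boolP [forall i, 0 < (tnth t i : R)].
  rewrite [pospow c _]/pospow; case: ifP => [t1|]; last by rewrite mulr0.
  by move: tn; rewrite notin_setE; case; split => //; rewrite -subr_gt0.
rewrite negb_forall => /existsP[i ti]; rewrite (bigD1 i)//= {1}/pospow.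
by rewrite (negbTE ti) !mul0r.
Qed.

Lemma integral_sphere_poly n beta (H : {mpoly R[n.+1]}) : 0 < beta ->
  pos_sphere_integral (fun q : 'cV[R]_n.+1 =>
     (\prod_i q i ord0 `^ (beta - 1)) * H.@[fun i => q i ord0 ^+ 2])
  = (\sum_(m <- msupp H) mcoeff m H * dirichlet_moment (beta / 2) m)%:E.
Proof.
move=> b0; set a := beta / 2; have a0 : 0 < a by rewrite divr_gt0.
have am0 k : 0 < a + k%:R by rewrite ltr_pwDl.
pose e (m : multinom n.+1) (i : 'I_n) := a + (m (lift ord_max i))%:R.
pose c (m : multinom n.+1) := a + (m ord_max)%:R.
rewrite /pos_sphere_integral integral_mkcond.
transitivity (\int[lebesgue_tuple R n]_t
    (\sum_(m <- msupp H) mcoeff m H * simplex_weight (e m) (c m) 1 t)%:E)%E; last first.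
  rewrite (@integral_linear_comb _ _ _ _ _ _ _ (dirichlet_moment a))//.
  - by move=> m; exact: measurable_simplex_weight.
  - by move=> m x; exact: simplex_weight_ge0.
  - move=> m; rewrite integral_simplex_weight; [congr EFin|by move=> i; exact: am0|exact: am0].
    rewrite /dirichlet_moment prod_ord_max sum_ord_max -/(c m) /pospow ltr01 powR1 /=.
    exact: mulr1.
apply: eq_integral => t _; rewrite /patch; case: ifPn => [|tn]; last first.
  by rewrite big1// => m _; rewrite simplex_weight_out// mulr0.
rewrite inE => -[t0 t1]; congr EFin.
set y : 'rV[R]_n := \row_i tnth t i.
have yE i : y ord0 i = tnth t i by rewrite mxE.
have yS : \sum_i y ord0 i ^+ 2 = \sum_i (tnth t i : R) ^+ 2.
  by apply: eq_bigr => i _; rewrite yE.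
have y1 : \sum_i y ord0 i ^+ 2 < 1 by rewrite yS.
have h0 := hemisphere_gt0 y1; have h2 := hemisphere_sqr y1.
rewrite area_elt_hemisphere// mevalE mulr_sumr mulr_suml; apply: eq_bigr => m _.
rewrite !prod_ord_max sphere_pt_max h2 yS /simplex_weight.
set u := 1 - \sum_i (tnth t i : R) ^+ 2; set h := hemisphere y.
have u0 : 0 < u by rewrite subr_gt0.
(* The surface element 1 / h turns the exponent beta - 1 of the last coordinate h into beta - 2; as
   h = u^(1/2), this is beta / 2 - 1 in u, the exponent of a Dirichlet density. *)
have -> : pospow (c m) u = h `^ (beta - 1) * u ^+ m ord_max / h.
  have hE : h = u `^ 2^-1 by rewrite powR12_sqrt ?ltW// /u -yS.
  rewrite /pospow u0 hE -powRN -!powRrM -powR_mulrn ?(ltW u0)// -!powRD ?(gt_eqF u0) ?implybT//.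
  by congr (_ `^ _); rewrite /c /a; by field.
have -> : \prod_i pospow (2 * e m i) (tnth t i)
    = (\prod_i sphere_pt y (lift ord_max i) ord0 `^ (beta - 1))
      * \prod_(i < n) (sphere_pt y (lift ord_max i) ord0 ^+ 2) ^+ m (lift ord_max i).
  rewrite -big_split /=; apply: eq_bigr => i _; rewrite -pospow_mul_exp sphere_pt_lift yE.
  rewrite /pospow t0; congr (_ `^ _ * _); rewrite /a; by field.
by ring.
Qed.

End SphereIntegral.

(** * Identities for products of linear factors *)

Section PolyIdentities.
Variable R : realType.

Lemma poly_eq_horner (p q : {poly R}) : (forall z : R, p.[z] = q.[z]) -> p = q.
Proof.
move=> pq; apply/eqP; rewrite -subr_eq0; apply/negPn/negP => d0.
pose s : seq R := [seq k%:R | k <- iota 0 (size (p - q))].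
have := max_poly_roots (rs := s) d0; rewrite size_map size_iota ltnn => H.
suff: false by []; apply: H.
  by apply/allP => _ /mapP[k _ ->]; apply/rootP; rewrite hornerD hornerN pq subrr.
by rewrite map_inj_uniq ?iota_uniq// => a b /eqP; rewrite eqr_nat => /eqP.
Qed.

Lemma horner_sumR (T : Type) (r : seq T) (P : pred T) (F : T -> {poly R}) (z : R) :
  (\sum_(i <- r | P i) F i).[z] = \sum_(i <- r | P i) (F i).[z] :> R.
Proof. exact: horner_sum. Qed.

Lemma coef_sumR (T : Type) (r : seq T) (P : pred T) (F : T -> {poly R}) k :
  (\sum_(i <- r | P i) F i)`_k = \sum_(i <- r | P i) (F i)`_k :> R.
Proof. exact: coef_sum. Qed.

(** For fixed y the sum is a polynomial in z that vanishes after multiplication by the nonzero y -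
    z, hence vanishes; its coefficients are then polynomials in y. This extracts relations for pairs
    e_r, e_s from a generating identity in z and y. *)
Lemma bilinear_coef_eq0 (K : finType) (h g : K -> {poly R}) :
  (forall z y : R, (y - z) * \sum_k (h k).[z] * (g k).[y] = 0 :> R) ->
  forall i j, \sum_k (h k)`_i * (g k)`_j = 0 :> R.
Proof.
move=> H i j.
have H1 y : \sum_k (g k).[y] *: h k = 0.
  apply/eqP; have : (\sum_k (g k).[y] *: h k) * (y%:P - 'X) = 0.
    apply: poly_eq_horner => z; rewrite hornerM horner0 -[RHS](H z y) [LHS]mulrC.
    rewrite hornerD hornerN hornerX hornerC horner_sumR; congr (_ * _).
    by apply: eq_bigr => k _; rewrite hornerZ [LHS]mulrC.
  by move/eqP; rewrite mulf_eq0 -opprB oppr_eq0 polyXsubC_eq0 orbF.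
have : \sum_k (h k)`_i *: g k = 0.
  apply: poly_eq_horner => y; rewrite horner0 horner_sumR.
  have := congr1 (fun p : {poly R} => p`_i) (H1 y); rewrite coef0 coef_sumR => E.
  rewrite -[RHS]E.
  by apply: eq_bigr => k _; rewrite hornerZ coefZ mulrC.
move=> /(congr1 (fun p : {poly R} => p`_j)); rewrite coef0 coef_sumR => E.
by rewrite -[RHS]E; apply: eq_bigr => k _; rewrite coefZ.
Qed.

Variables (I : finType) (x : I -> R).
Implicit Types (A : {set I}) (i j : I) (z y : R).

Definition pr A z : R := \prod_(i in A) (z - x i).
Definition prp A : {poly R} := \prod_(i in A) ('X - (x i)%:P).
Definition dpr A z : R := \sum_(i in A) pr (A :\ i) z.

Lemma prD1 A i z : i \in A -> pr A z = (z - x i) * pr (A :\ i) z.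
Proof. by move=> iA; rewrite /pr (big_setD1 i). Qed.

Lemma horner_prp A z : (prp A).[z] = pr A z.
Proof. by rewrite horner_prod; apply: eq_bigr => i _; rewrite hornerXsubC. Qed.

Lemma deriv_prp A : (prp A)^`() = \sum_(i in A) prp (A :\ i).
Proof.
have [m] := ubnP #|A|; elim: m A => // m IHm A Am.
have [->|[i iA]] := set_0Vmem A; first by rewrite /prp !big_set0 derivC.
rewrite {1}/prp (big_setD1 i)//= -/(prp _) derivM derivXsubC mul1r.
rewrite IHm; last by move: Am; rewrite (cardsD1 i A) iA.
rewrite [RHS](big_setD1 i)//=; congr (_ + _); rewrite mulr_sumr.
apply: eq_bigr => j; rewrite !inE => /andP[ji jA].
rewrite {2}/prp (big_setD1 i) /=; last by rewrite !inE eq_sym ji.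
by rewrite -/(prp _) finset.setDDl finset.setUC -finset.setDDl.
Qed.

Lemma horner_deriv_prp A z : (prp A)^`().[z] = dpr A z.
Proof. by rewrite deriv_prp horner_sumR; apply: eq_bigr => i _; rewrite horner_prp. Qed.

(** Termwise, (y - z) x_i^2 = (y - z) (z - x_i) (y - x_i) + z^2 (y - x_i) - y^2 (z - x_i). *)
Lemma sum_sqr_prD1 A z y :
  (y - z) * \sum_(i in A) x i ^+ 2 * pr (A :\ i) z * pr (A :\ i) y
  = #|A|%:R * (y - z) * pr A z * pr A y + z ^+ 2 * dpr A z * pr A y
    - y ^+ 2 * pr A z * dpr A y.
Proof.
rewrite /dpr !mulr_sumr mulr_suml -sumrN.
have -> : #|A|%:R * (y - z) * pr A z * pr A y = \sum_(i in A) (y - z) * pr A z * pr A y.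
  by rewrite sumr_const -[RHS]mulr_natl; ring.
rewrite -!big_split /=; apply: eq_bigr => i iA.
rewrite !(prD1 _ iA); ring.
Qed.

(* For f = g = prp A and n = #|A| this is (y - z) sum_i x_i^2 f_i(z) f_i(y),
   where f_i = prp (A :\ i) (see sum_sqr_prD1); it is bilinear in f and g. *)
Definition carre (n : nat) (f g : {poly R}) z y : R :=
  n%:R * (y - z) * f.[z] * g.[y] + z ^+ 2 * f^`().[z] * g.[y]
  - y ^+ 2 * f.[z] * g^`().[y].

Lemma setD1C A i j : A :\ i :\ j = A :\ j :\ i.
Proof. by rewrite finset.setDDl finset.setUC -finset.setDDl. Qed.

(** With B = A minus l and m, all derivatives of [prp B] cancel and s l m is (y z (x_l - x_m) - (y -
    z) x_l x_m) pr B z pr B y. The first part is antisymmetric in l and m, so that the sum of both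
    orders has the factor y - z. *)
Lemma carre_offdiag A l m z y : l \in A -> m \in A -> l != m ->
  let s l m := (y - z) * \sum_(i in A :\ l :\ m) x i ^+ 2 * pr (A :\ l :\ i) z * pr (A :\ m :\ i) y
    - carre #|A|.-1 (prp (A :\ l)) (prp (A :\ m)) z y in
  s l m + s m l = - (2 * (y - z) * x l * x m * pr (A :\ l :\ m) z * pr (A :\ l :\ m) y).
Proof.
move=> lA mA lm s.
have mAl : m \in A :\ l by rewrite !inE eq_sym lm.
have lAm : l \in A :\ m by rewrite !inE lm.
set B := A :\ l :\ m.
have BE : A :\ m :\ l = B by rewrite setD1C.
have cA : #|A|.-1%:R = #|B|%:R + 1 :> R.
  by rewrite (cardsD1 l A) lA (cardsD1 m (A :\ l)) mAl /= add1n -natr1.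
have el z' : pr (A :\ l) z' = (z' - x m) * pr B z' by rewrite (prD1 _ mAl).
have em z' : pr (A :\ m) z' = (z' - x l) * pr B z' by rewrite (prD1 _ lAm) BE.
have dl z' : dpr (A :\ l) z' = pr B z' + (z' - x m) * dpr B z'.
  rewrite /dpr (big_setD1 m)//= -/B; congr (_ + _); rewrite mulr_sumr; apply: eq_bigr => i iB.
  have [im iA] : i != m /\ i \in A by move: iB; rewrite !inE => /and3P[].
  rewrite (@prD1 (A :\ l :\ i) m); first by rewrite setD1C.
  by rewrite !inE eq_sym im eq_sym lm.
have dm z' : dpr (A :\ m) z' = pr B z' + (z' - x l) * dpr B z'.
  rewrite /dpr (big_setD1 l)//= BE; congr (_ + _); rewrite mulr_sumr; apply: eq_bigr => i iB.
  have [il iA] : i != l /\ i \in A by move: iB; rewrite !inE => /and3P[].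
  rewrite (@prD1 (A :\ m :\ i) l); first by rewrite setD1C BE.
  by rewrite !inE eq_sym il lm.
have key : \sum_(i in B) x i ^+ 2 * pr (A :\ l :\ i) z * pr (A :\ m :\ i) y
    = (z - x m) * (y - x l) * \sum_(i in B) x i ^+ 2 * pr (B :\ i) z * pr (B :\ i) y.
  rewrite mulr_sumr; apply: eq_bigr => i iB.
  have [il im iA] : [/\ i != l, i != m & i \in A] by move: iB; rewrite !inE => /and3P[].
  rewrite (@prD1 _ m); last by rewrite !inE eq_sym im eq_sym lm.
  rewrite (@prD1 (A :\ m :\ i) l); last by rewrite !inE eq_sym il lm.
  by rewrite [A :\ l :\ i :\ m]setD1C -/B [A :\ m :\ i :\ l]setD1C BE; ring.
have key' : \sum_(i in A :\ m :\ l) x i ^+ 2 * pr (A :\ m :\ i) z * pr (A :\ l :\ i) y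
    = (z - x l) * (y - x m) * \sum_(i in B) x i ^+ 2 * pr (B :\ i) z * pr (B :\ i) y.
  rewrite BE mulr_sumr; apply: eq_bigr => i iB.
  have [il im iA] : [/\ i != l, i != m & i \in A] by move: iB; rewrite !inE => /and3P[].
  rewrite (@prD1 (A :\ m :\ i) l); last by rewrite !inE eq_sym il lm.
  rewrite (@prD1 (A :\ l :\ i) m); last by rewrite !inE eq_sym im eq_sym lm.
  by rewrite [A :\ l :\ i :\ m]setD1C -/B [A :\ m :\ i :\ l]setD1C BE; ring.
rewrite /s key key' /carre !horner_deriv_prp !horner_prp !el !em !dl !dm cA.
rewrite ![(y - z) * (_ * \sum_(_ in _) _)]mulrCA (sum_sqr_prD1 B).
ring.
Qed.

Lemma carre_suml n (J : finType) (a b : J -> R) (f g : J -> {poly R}) z y :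
  carre n (\sum_j a j *: f j) (\sum_j b j *: g j) z y
  = \sum_j \sum_k a j * b k * carre n (f j) (g k) z y.
Proof.
have hs c (h : J -> {poly R}) t : (\sum_j c j *: h j).[t] = \sum_j c j * (h j).[t].
  by rewrite horner_sumR; apply: eq_bigr => j _; rewrite hornerZ.
have ds c (h : J -> {poly R}) : (\sum_j c j *: h j)^`() = \sum_j c j *: (h j)^`().
  by rewrite linear_sum; apply: eq_bigr => j _; exact: derivZ.
rewrite /carre !ds !hs.
transitivity (\sum_j \sum_k (n%:R * (y - z) * (a j * (f j).[z]) * (b k * (g k).[y])
     + z ^+ 2 * (a j * (f j)^`().[z]) * (b k * (g k).[y])
     - y ^+ 2 * (a j * (f j).[z]) * (b k * (g k)^`().[y]))); last first.
  by apply: eq_bigr => j _; apply: eq_bigr => k _; ring.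
under [RHS]eq_bigr => j _ do rewrite sumrB big_split /= -!mulr_sumr.
by rewrite sumrB big_split /= -!mulr_suml -!mulr_sumr.
Qed.

(** Minus the derivative of [mixture] with respect to x_i; the term l = i does not contain x_i. *)
Definition rem_sum (w : I -> R) i : {poly R} := \sum_(l | l != i) w l *: prp ([set: I] :\ i :\ l).

Lemma horner_rem_sum w i z :
  (rem_sum w i).[z] = \sum_(l | l != i) w l * pr ([set: I] :\ i :\ l) z.
Proof. by rewrite horner_sumR; apply: eq_bigr => l _; rewrite hornerZ horner_prp. Qed.

(* For w_i = q_i^2 its roots are the nu_i, see nu_mixture. *)
Definition mixture (w : I -> R) : {poly R} := \sum_l w l *: prp ([set: I] :\ l).

Lemma carre_mixture w z y :
  (y - z) * \sum_i x i ^+ 2 * ((rem_sum w i).[z] * (rem_sum w i).[y])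
  - carre #|I|.-1 (mixture w) (mixture w) z y
  = - ((y - z) * \sum_l \sum_(m | m != l) w l * w m * x l * x m
        * (pr ([set: I] :\ l :\ m) z * pr ([set: I] :\ l :\ m) y)).
Proof.
rewrite /mixture carre_suml.
pose T l m := \sum_(i in [set: I] :\ l :\ m) x i ^+ 2 * pr ([set: I] :\ l :\ i) z * pr ([set: I] :\ m :\ i) y.
pose S l m := (y - z) * T l m - carre #|I|.-1 (prp ([set: I] :\ l)) (prp ([set: I] :\ m)) z y.
have -> : \sum_i x i ^+ 2 * ((rem_sum w i).[z] * (rem_sum w i).[y])
    = \sum_l \sum_m w l * w m * T l m.
  transitivity (\sum_i \sum_l \sum_m (if (l != i) && (m != i) then w l * w m
      * (x i ^+ 2 * pr ([set: I] :\ l :\ i) z * pr ([set: I] :\ m :\ i) y) else 0)).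
    apply: eq_bigr => i _; rewrite !horner_rem_sum mulr_suml mulr_sumr big_mkcond /=.
    apply: eq_bigr => l _; case: ifP => li /=; last by rewrite big1.
    rewrite mulr_sumr mulr_sumr big_mkcond /=; apply: eq_bigr => m _; case: ifP => // mi.
    by rewrite [[set: I] :\ i :\ l]setD1C [[set: I] :\ i :\ m]setD1C; ring.
  rewrite exchange_big; apply: eq_bigr => l _; rewrite exchange_big; apply: eq_bigr => m _ /=.
  rewrite -big_mkcond /= /T mulr_sumr; apply: eq_bigl => i.
  by rewrite !inE andbT [m == i]eq_sym [l == i]eq_sym andbC.
rewrite mulr_sumr -sumrB; under eq_bigr => l _ do rewrite mulr_sumr -sumrB.
transitivity (\sum_l \sum_m w l * w m * S l m).
  by apply: eq_bigr => l _; apply: eq_bigr => m _; rewrite /S; ring.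
have Sd l : S l l = 0.
  rewrite /S /T; have -> : [set: I] :\ l :\ l = [set: I] :\ l.
    by apply/setP => i; rewrite !inE; case: eqP.
  rewrite sum_sqr_prD1 /carre !horner_deriv_prp !horner_prp.
  have -> : #|[set: I] :\ l| = #|I|.-1 by rewrite -cardsT (cardsD1 l [set: I]) inE.
  by rewrite subrr.
have Sm l m : l != m -> S l m + S m l
    = - (2 * (y - z) * x l * x m * pr ([set: I] :\ l :\ m) z * pr ([set: I] :\ l :\ m) y).
  move=> lm; have := @carre_offdiag [set: I] l m z y; rewrite !inE /= cardsT => -> //.
have E : \sum_l \sum_m w l * w m * S l m = \sum_l \sum_m w l * w m * S m l.
  by rewrite exchange_big; apply: eq_bigr => l _; apply: eq_bigr => m _; rewrite [w m * w l]mulrC.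
have E2 : 2 * \sum_l \sum_m w l * w m * S l m
   = \sum_l \sum_m w l * w m * (S l m + S m l).
  rewrite mulr_natl mulr2n {2}E -big_split /=; apply: eq_bigr => l _; rewrite -big_split /=.
  by apply: eq_bigr => m _; rewrite -mulrDr.
apply: (mulfI (_ : 2 != 0 :> R)); first by rewrite pnatr_eq0.
rewrite E2 mulrN mulrCA !mulr_sumr -sumrN; apply: eq_bigr => l _.
rewrite !mulr_sumr -sumrN [RHS]big_mkcond /=; apply: eq_bigr => m _.
rewrite [m == l]eq_sym; case: eqVneq => [<-|lm] /=; first by rewrite Sd addr0 mulr0.
by rewrite Sm//; ring.
Qed.

End PolyIdentities.

(** * First order parts *)

Section FirstOrder.
Variable R : realType.

(** Diagonal on the powers of X. On the generating polynomial of the e_k it is the first order part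
    of D, divided by beta, plus the Euler operator; see [first_order]. *)
Definition theta (n : nat) (p : {poly R}) : {poly R} :=
  (n%:R * (n%:R + 1) / 2) *: p - 'X * p^`() - 2^-1 *: ('X ^+ 2 * p^`()^`()).

Lemma coef_theta n p k :
  (theta n p)`_k = (n%:R * (n%:R + 1) / 2 - k%:R * (k%:R + 1) / 2) * p`_k.
Proof.
rewrite /theta !coefB !coefZ coefXM coefXnM !coef_deriv.
case: k => [|[|k]] /=.
- by rewrite !mulr0 mul0r; ring.
- by rewrite mulr0 subr0 -[_ *+ 1]mulr_natr; field.
- by rewrite subn2 /=; field.
Qed.

Lemma theta_sum n (J : finType) (a : J -> R) (f : J -> {poly R}) :
  theta n (\sum_j a j *: f j) = \sum_j a j *: theta n (f j).
Proof.
apply/polyP => k; rewrite coef_theta !coef_sumR mulr_sumr; apply: eq_bigr => j _.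
by rewrite !coefZ coef_theta mulrCA.
Qed.

Variables (I : finType) (x : I -> R).
Implicit Types (A : {set I}) (i j : I) (z y : R).
Local Notation pr := (pr x).
Local Notation prp := (prp x).

Lemma horner_deriv2_prp A z :
  (prp A)^`()^`().[z] = \sum_(i in A) \sum_(j in A :\ i) pr (A :\ i :\ j) z.
Proof.
by rewrite deriv_prp linear_sum horner_sumR; apply: eq_bigr => i _; rewrite horner_deriv_prp.
Qed.

Lemma horner_theta n p z : (theta n p).[z]
  = n%:R * (n%:R + 1) / 2 * p.[z] - z * p^`().[z] - 2^-1 * (z ^+ 2 * p^`()^`().[z]).
Proof. by rewrite /theta !(hornerD, hornerN, hornerZ, hornerM, hornerX, hornerXn). Qed.

Lemma sum_offdiag_swap A (F : I -> I -> R) :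
  \sum_(i in A) \sum_(j in A :\ i) F i j = \sum_(i in A) \sum_(j in A :\ i) F j i.
Proof.
rewrite (exchange_big_dep (mem A)) /=; last by move=> i j _; rewrite !inE => /andP[].
apply: eq_bigr => j jA; apply: eq_bigl => i.
by rewrite !inE eq_sym jA andbT andbC.
Qed.

(** Pairing (i, j) with (j, i) removes the poles: (x_i^2 (z - x_j) - x_j^2 (z - x_i)) / (x_i - x_j)
    = z^2 - (z - x_i) (z - x_j). *)
Lemma first_order A z : injective x ->
  \sum_(i in A) (\sum_(j in A :\ i) x i ^+ 2 / (x i - x j) + x i) * - pr (A :\ i) z
  = (theta #|A| (prp A)).[z].
Proof.
move=> xi; rewrite horner_theta horner_deriv_prp horner_deriv2_prp horner_prp.
pose F i j := x i ^+ 2 / (x i - x j) * pr (A :\ i) z.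
have E1 : 2 * \sum_(i in A) \sum_(j in A :\ i) F i j
    = z ^+ 2 * (\sum_(i in A) \sum_(j in A :\ i) pr (A :\ i :\ j) z)
      - #|A|%:R * (#|A|%:R - 1) * pr A z.
  rewrite mulr_natl mulr2n {2}(sum_offdiag_swap A F) -big_split /=.
  have -> : #|A|%:R * (#|A|%:R - 1) * pr A z = \sum_(i in A) \sum_(j in A :\ i) pr A z.
    transitivity (\sum_(i in A) (#|A|%:R - 1) * pr A z).
      by rewrite sumr_const -[RHS]mulr_natl mulrA.
    apply: eq_bigr => i iA; rewrite sumr_const -[RHS]mulr_natl (cardsD1 i A) iA /= add1n -natr1.
    by rewrite addrK.
  rewrite mulr_sumr -sumrB; apply: eq_bigr => i iA.
  rewrite mulr_sumr -sumrB -big_split /=; apply: eq_bigr => j jA.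
  have [ji jA'] : j != i /\ j \in A by move: jA; rewrite !inE => /andP[].
  have iAj : i \in A :\ j by rewrite !inE eq_sym ji.
  rewrite /F (prD1 _ _ iA) (prD1 _ _ jA) (prD1 _ _ iAj) [A :\ j :\ i]setD1C.
  field; rewrite !subr_eq0 !(inj_eq xi) ji eq_sym ji //.
have E2 : \sum_(i in A) x i * pr (A :\ i) z = z * dpr x A z - #|A|%:R * pr A z.
  have -> : #|A|%:R * pr A z = \sum_(i in A) pr A z by rewrite sumr_const -[RHS]mulr_natl.
  rewrite /dpr mulr_sumr -sumrB; apply: eq_bigr => i iA; rewrite (prD1 _ _ iA); ring.
have -> : \sum_(i in A) (\sum_(j in A :\ i) x i ^+ 2 / (x i - x j) + x i) * - pr (A :\ i) z
    = - \sum_(i in A) \sum_(j in A :\ i) F i j - \sum_(i in A) x i * pr (A :\ i) z.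
  rewrite -!sumrN -big_split /=; apply: eq_bigr => i _.
  by rewrite mulrN mulrDl opprD; congr (- _ + _); rewrite mulr_suml.
rewrite E2; move: E1; set s1 := \sum_(i in A) _; set s2 := \sum_(i in A) _ => E1.
have -> : s1 = 2^-1 * (2 * s1) by rewrite mulKf ?pnatr_eq0.
by rewrite E1; field.
Qed.

(** For each l apply [first_order] to the variables other than x_l. The left side has in addition
    the pole at x_l but lacks the Euler term x_i, and x_i^2 / (x_i - x_l) - x_i = x_i x_l / (x_i -
    x_l). *)
Lemma first_order_mixture (w : I -> R) z : injective x ->
  \sum_i (\sum_(j | j != i) x i ^+ 2 / (x i - x j)) * - (rem_sum x w i).[z]
  = (theta #|I|.-1 (mixture x w)).[z]
    + \sum_l \sum_(m | m != l) w l * (x l * x m / (x l - x m)) * pr ([set: I] :\ l :\ m) z.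
Proof.
move=> xi; rewrite /mixture theta_sum horner_sumR -big_split /=.
transitivity (\sum_l w l * \sum_(i | i != l)
    (\sum_(j | j != i) x i ^+ 2 / (x i - x j)) * - pr ([set: I] :\ l :\ i) z).
  transitivity (\sum_i \sum_(l | l != i) w l *
      ((\sum_(j | j != i) x i ^+ 2 / (x i - x j)) * - pr ([set: I] :\ l :\ i) z)).
    apply: eq_bigr => i _; rewrite horner_rem_sum -sumrN mulr_sumr; apply: eq_bigr => l _.
    by rewrite [[set: I] :\ i :\ l]setD1C; ring.
  rewrite (exchange_big_dep xpredT) //=; apply: eq_bigr => l _.
  by rewrite mulr_sumr; apply: eq_bigl => i; rewrite eq_sym.
apply: eq_bigr => l _; rewrite hornerZ.
have cl : #|[set: I] :\ l| = #|I|.-1 by rewrite -cardsT (cardsD1 l [set: I]) inE.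
rewrite -cl -(first_order _ _ xi).
under [X in _ = _ + X]eq_bigr => m _ do rewrite -mulrA.
rewrite -mulr_sumr -mulrDr; congr (_ * _).
have inl i : (i \in [set: I] :\ l) = (i != l) by rewrite !inE andbT.
rewrite (eq_bigl _ _ inl) -big_split /=; apply: eq_bigr => i il.
rewrite (bigD1 l) 1?eq_sym//=.
have -> : \sum_(j in [set: I] :\ l :\ i) x i ^+ 2 / (x i - x j)
    = \sum_(j | (j != i) && (j != l)) x i ^+ 2 / (x i - x j).
  by apply: eq_bigl => j; rewrite !inE andbT.
by field; rewrite !subr_eq0 !(inj_eq xi) il eq_sym il.
Qed.

End FirstOrder.

Section Derivations.
Variables (R : realType) (M : nat).
Implicit Types (p q : {mpoly R[M]}) (i : 'I_M).

Lemma der1 i : (1 : {mpoly R[M]})^`M(i) = 0.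
Proof. by rewrite -mpolyC1 mderivC. Qed.

Lemma derC i c : (mpolyC M c : {mpoly R[M]})^`M(i) = 0.
Proof. exact: mderivC. Qed.

Lemma derU i j : (mpolyX R (mnm1 j) : {mpoly R[M]})^`M(i) = (j == i)%:R.
Proof.
rewrite mderivX mnm1E; case: eqVneq => [->|_]; last by rewrite scale0r.
rewrite scale1r (_ : mnm_sub (mnm1 i) (mnm1 i) = @mnm0 M) ?mpolyX0//.
by apply/mnmP => k; rewrite mnmBE mnm0E subnn.
Qed.

Lemma der_prod i (J : finType) (A : {set J}) (F : J -> {mpoly R[M]}) :
  (\prod_(j in A) F j)^`M(i)
  = \sum_(j in A) (F j)^`M(i) * \prod_(k in A :\ j) F k.
Proof.
have [m] := ubnP #|A|; elim: m A => // m IHm A Am.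
have [->|[j jA]] := set_0Vmem A; first by rewrite !big_set0 der1.
rewrite (big_setD1 j)//= derM [RHS](big_setD1 j)//=; congr (_ + _).
rewrite IHm; last by move: Am; rewrite (cardsD1 j A) jA.
rewrite mulr_sumr; apply: eq_bigr => k; rewrite !inE => /andP[kj kA].
rewrite [in RHS](big_setD1 j) /=; last by rewrite !inE eq_sym kj.
by rewrite setD1C mulrCA.
Qed.

Lemma chain_rule n (F : {mpoly R[n]}) (lq : n.-tuple {mpoly R[M]}) i :
  (comp_mpoly lq F)^`M(i)
  = \sum_r comp_mpoly lq (F^`M(r)) * (tnth lq r)^`M(i).
Proof.
pose P (F : {mpoly R[n]}) := (comp_mpoly lq F)^`M(i)
  = \sum_r comp_mpoly lq (F^`M(r)) * (tnth lq r)^`M(i).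
have P1 : P 1.
  rewrite /P comp_mpoly1 der1 big1// => r _.
  by rewrite -mpolyC1 mderivC comp_mpoly0 mul0r.
have PM G H : P G -> P H -> P (G * H).
  move=> PG PH; rewrite /P rmorphM derM PG PH mulr_suml mulr_sumr -big_split /=.
  by apply: eq_bigr => r _; rewrite mderivM raddfD /= !rmorphM /=; ring.
have PU j : P (mpolyX R (mnm1 j)).
  rewrite /P (bigD1 j)//= big1 ?addr0; last first.
    move=> r rj; rewrite mderivX mnm1E eq_sym (negbTE rj) scale0r comp_mpoly0 mul0r//.
  rewrite mderivX mnm1E eqxx scale1r (_ : mnm_sub _ _ = @mnm0 n); last first.
    by apply/mnmP => k; rewrite mnmBE mnm0E subnn.
  by rewrite mpolyX0 comp_mpoly1 mul1r comp_mpolyXU -tnth_nth.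
have PX m : P (mpolyX R m).
  rewrite mpolyXE_id; elim/big_ind: _ => // j _.
  by elim: (m j) => [|k IHk]; rewrite ?expr0// exprS; apply: PM.
elim/mpolyind: F => [|c m p _ _ IHp].
  by rewrite comp_mpoly0 mderiv0 big1// => r _; rewrite mderiv0 comp_mpoly0 mul0r.
rewrite -/(P _) /P comp_mpolyD comp_mpolyZ derD derZ PX IHp scaler_sumr -big_split /=.
by apply: eq_bigr => r _; rewrite mderivD mderivZ comp_mpolyD comp_mpolyZ mulrDl scalerAl.
Qed.

Lemma der_lin_comb i k (u : 'I_k -> R) (g : 'I_k -> {mpoly R[M]}) :
  (\sum_j u j *: g j)^`M(i) = \sum_j u j *: (g j)^`M(i).
Proof. by rewrite der_sum; apply: eq_bigr => j _; rewrite derZ. Qed.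

Lemma eval_lin_comb x k (u : 'I_k -> R) (g : 'I_k -> {mpoly R[M]}) :
  (\sum_j u j *: g j).@[x] = \sum_j u j * (g j).@[x].
Proof. by rewrite eval_sum; apply: eq_bigr => j _; rewrite evalZ. Qed.

End Derivations.

(** * Elementary symmetric polynomials through their generating polynomial *)

Section GeneratingCoefficients.
Variable R : realType.

Lemma gen_coef n (u : nat -> R) (h : {poly R}) :
  (forall c, h.[c] = \sum_(k < n.+1) (-1) ^+ k * c ^+ (n - k) * u k) ->
  forall k, (k <= n)%N -> u k = (-1) ^+ k * h`_(n - k).
Proof.
move=> H k kn.
have -> : h = \sum_(k < n.+1) ((-1) ^+ k * u k) *: 'X^(n - k).
  apply: poly_eq_horner => c; rewrite H horner_sumR; apply: eq_bigr => i _.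
  by rewrite hornerZ hornerXn mulrAC.
rewrite coef_sumR (bigD1 (inord k))//= inordK// big1 => [|i ik].
  by rewrite coefZ coefXn eqxx addr0 mulr1 signrMK.
rewrite coefZ coefXn; case: eqP => [E|_]; last by rewrite mulr0.
case/eqP: ik; apply: val_inj; rewrite /= inordK//.
by have := ltn_ord i; move: E; lia.
Qed.

Lemma mesym_gen n (nu : 'I_n -> R) c :
  pr nu [set: 'I_n] c = \sum_(k < n.+1) (-1) ^+ k * c ^+ (n - k) * (mesym n R k).@[nu].
Proof.
pose cs := [tuple nu i | i < n].
have csE : \prod_(i <- cs) ('X - i%:P) = prp nu [set: 'I_n].
  by rewrite big_tuple /prp; apply: eq_big => i; rewrite ?inE// tnth_mktuple.
rewrite -horner_prp -csE horner_coef (_ : size _ = n.+1); last first.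
  by rewrite size_prod_XsubC size_tuple.
rewrite (reindex_inj rev_ord_inj) /=; apply: eq_bigr => k _.
rewrite subSS (mroots_coeff cs k) mulrAC; congr (_ * _).
by apply: meval_eq => i; rewrite tnth_mktuple.
Qed.

Lemma mesym_gen_mpoly n c : \prod_(i < n) (mpolyC n c - mpolyX R (mnm1 i))
  = \sum_(k < n.+1) ((-1) ^+ k * c ^+ (n - k)) *: mesym n R k.
Proof.
apply: mpoly_eq_eval => nu; rewrite eval_prod eval_sum.
under [RHS]eq_bigr => k _ do rewrite evalZ.
rewrite -mesym_gen /pr; apply: eq_big => i; first by rewrite inE.
by rewrite evalB evalC evalU.
Qed.

Lemma mesym_coef n (nu : 'I_n -> R) k : (k <= n)%N ->
  (mesym n R k).@[nu] = (-1) ^+ k * (prp nu [set: 'I_n])`_(n - k).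
Proof.
move=> kn; apply: (@gen_coef n (fun k => (mesym n R k).@[nu])) => // c.
by rewrite horner_prp mesym_gen.
Qed.

Lemma prod_setT n (F : 'I_n -> {mpoly R[n]}) : \prod_i F i = \prod_(i in [set: 'I_n]%SET) F i.
Proof. by apply: eq_bigl => i; rewrite inE. Qed.

Lemma der_gen_mpoly n (A : {set 'I_n}) i c :
  (\prod_(j in A) (mpolyC n c - mpolyX R (mnm1 j)))^`M(i)
  = - (if i \in A then \prod_(j in A :\ i) (mpolyC n c - mpolyX R (mnm1 j)) else 0).
Proof.
have D j : (mpolyC n c - mpolyX R (mnm1 j))^`M(i) = - (j == i)%:R :> {mpoly R[n]}.
  by rewrite mderivB derC derU sub0r.
rewrite der_prod; case: ifPn => iA.
  rewrite (big_setD1 i)//= D eqxx mulN1r [X in _ + X]big1 ?addr0// => j; rewrite !inE => /andP[ji _].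
  by rewrite D (negbTE ji) oppr0 mul0r.
rewrite oppr0 big1// => j jA; rewrite D (_ : j == i = false) ?oppr0 ?mul0r//.
by apply: contraNF iA => /eqP <-.
Qed.

Lemma der_mesym_coef n (nu : 'I_n -> R) i k : (k <= n)%N ->
  (mesym n R k)^`M(i).@[nu] = (-1) ^+ k * (- prp nu ([set: 'I_n] :\ i))`_(n - k).
Proof.
move=> kn; apply: (@gen_coef n (fun k => (mesym n R k)^`M(i).@[nu])) => // c.
rewrite hornerN horner_prp.
have := congr1 (fun p => p^`M(i).@[nu]) (mesym_gen_mpoly n c).
rewrite prod_setT der_gen_mpoly inE evalN eval_prod der_lin_comb eval_lin_comb.
rewrite /pr => E; rewrite (eq_bigr (fun j => (mpolyC n c - mpolyX R (mnm1 j)).@[nu])) ?E//.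
by move=> j _; rewrite evalB evalC evalU.
Qed.

(** e_k is affine in each variable; this removes the second derivatives of the inner functions from
    the chain rule. *)
Lemma der2_mesym n (nu : 'I_n -> R) i k : (k <= n)%N ->
  (mesym n R k)^`M(i)^`M(i).@[nu] = 0.
Proof.
move=> kn.
have -> : 0 = (-1) ^+ k * (0 : {poly R})`_(n - k) :> R by rewrite coef0 mulr0.
apply: (@gen_coef n (fun k => (mesym n R k)^`M(i)^`M(i).@[nu])) => // c.
rewrite horner0.
have := congr1 (fun p => p^`M(i)^`M(i).@[nu]) (mesym_gen_mpoly n c).
rewrite prod_setT der_gen_mpoly inE mderivN der_gen_mpoly !inE eqxx /= !oppr0 meval0.
by rewrite !der_lin_comb eval_lin_comb.
Qed.

End GeneratingCoefficients.

(** * Averaging over the Dirichlet distribution *)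

Section LinearExtension.
Variables (R : realType) (k : nat) (V : lmodType R) (phi : multinom k -> V).
Implicit Types p q : {mpoly R[k]}.

Definition mlin p : V := \sum_(m <- msupp p) mcoeff m p *: phi m.

Lemma mlinE p (s : seq (multinom k)) : uniq s -> {subset msupp p <= s} ->
  mlin p = \sum_(m <- s) mcoeff m p *: phi m.
Proof.
move=> us ps; rewrite (bigID [pred m | m \in msupp p]) /= [X in _ + X]big1 ?addr0; last first.
  by move=> m mp; rewrite memN_msupp_eq0// scale0r.
rewrite -big_filter; apply: perm_big; apply: uniq_perm.
- exact: msupp_uniq.
- exact: filter_uniq.
- by move=> m; rewrite mem_filter; case: (boolP (m \in msupp p)) => //= /ps.
Qed.

Lemma mlinD p q : mlin (p + q) = mlin p + mlin q.
Proof.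
pose s := undup (msupp p ++ msupp q).
have us : uniq s by exact: undup_uniq.
rewrite (@mlinE p s us); last by move=> m mp; rewrite mem_undup mem_cat mp.
rewrite (@mlinE q s us); last by move=> m mp; rewrite mem_undup mem_cat mp orbT.
rewrite (@mlinE (p + q) s us); last by move=> m /msuppD_le; rewrite mem_undup.
by rewrite -big_split /=; apply: eq_bigr => m _; rewrite mcoefD scalerDl.
Qed.

Lemma mlinZ c p : mlin (c *: p) = c *: mlin p.
Proof.
rewrite (@mlinE (c *: p) (msupp p)) ?msupp_uniq//; last exact: msuppZ_le.
by rewrite /mlin scaler_sumr; apply: eq_bigr => m _; rewrite mcoefZ scalerA.
Qed.

Lemma mlin0 : mlin 0 = 0.
Proof. by rewrite -(scale0r 0) mlinZ scale0r. Qed.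

Lemma mlin_sum (I : Type) (r : seq I) (P : pred I) (F : I -> {mpoly R[k]}) :
  mlin (\sum_(i <- r | P i) F i) = \sum_(i <- r | P i) mlin (F i).
Proof.
by elim/big_rec2: _ => [|i x y _ <-]; [exact: mlin0|exact: mlinD].
Qed.

Lemma mlinX m : mlin (mpolyX R m) = phi m.
Proof. by rewrite /mlin msuppX big_seq1 mcoeffX eqxx scale1r. Qed.

End LinearExtension.

Lemma mpoly_lin_ind (R : realType) k (P : {mpoly R[k]} -> Prop) :
  P 0 -> (forall c p q, P p -> P q -> P (c *: p + q)) ->
  (forall m, P (mpolyX R m)) -> forall p, P p.
Proof.
move=> P0 PL PX; elim/mpolyind => // c m p _ _ IHp.
exact: PL.
Qed.

Section Averaging.
Variables (R : realType) (N : nat) (a : R).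
Local Notation T := {mpoly R[(N.+1 + N.+1)]}.
Implicit Types (H : T) (x w : 'I_N.+1 -> R) (i j : 'I_N.+1).

Definition lpart (m : multinom (N.+1 + N.+1)) : multinom N.+1 :=
  Multinom [tuple m (lshift N.+1 i) | i < N.+1].
Definition rpart (m : multinom (N.+1 + N.+1)) : multinom N.+1 :=
  Multinom [tuple m (rshift N.+1 i) | i < N.+1].

Lemma lpartE m i : lpart m i = m (lshift N.+1 i).
Proof. by rewrite multinomE tnth_mktuple. Qed.

Lemma rpartE m i : rpart m i = m (rshift N.+1 i).
Proof. by rewrite multinomE tnth_mktuple. Qed.

(* The variables of H are x_i (at lshift i) and w_i (at rshift i); avg integrates
   w out. *)
Definition avg H : {mpoly R[N.+1]} :=
  mlin (fun m => dirichlet_moment a (rpart m) *: mpolyX R (lpart m)) H.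

(** Given by moments rather than by an integral, so that linearity and integration by parts are
    computations on monomials. *)
Definition Exp (K : {mpoly R[N.+1]}) : R :=
  mlin (V := R^o) (fun m => dirichlet_moment a m) K.

Definition join x w (i : 'I_(N.+1 + N.+1)) : R :=
  match fintype.split i with inl i => x i | inr i => w i end.

Lemma join_lshift x w i : join x w (lshift N.+1 i) = x i.
Proof. by rewrite /join; case: splitP => j; [move=> /= /val_inj -> //|case: i => /= i + /= E; lia]. Qed.

Lemma join_rshift x w i : join x w (rshift N.+1 i) = w i.
Proof. by rewrite /join; case: splitP => j /= E; [case: j E => j /= jN; lia|congr w; apply: val_inj => /=; lia]. Qed.

Definition specialize x H : {mpoly R[N.+1]} :=
  comp_mpoly [tuple match fintype.split i with
    | inl i => mpolyC N.+1 (x i) | inr i => mpolyX R (mnm1 i) end | i < N.+1 + N.+1] H.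

Lemma eval_specialize x w H : (specialize x H).@[w] = H.@[join x w].
Proof.
rewrite comp_mpoly_meval; apply: meval_eq => i; rewrite tnth_mktuple /join.
by case: fintype.split => j; rewrite ?evalC ?evalU.
Qed.

Lemma specializeD x H K : specialize x (H + K) = specialize x H + specialize x K.
Proof. exact: raddfD. Qed.

Lemma specializeZ x c H : specialize x (c *: H) = c *: specialize x H.
Proof. exact: comp_mpolyZ. Qed.

Lemma specialize_der x H i : (specialize x H)^`M(i) = specialize x (H^`M(rshift N.+1 i)).
Proof.
rewrite /specialize chain_rule (bigD1 (rshift N.+1 i))//= big1 ?addr0.
  by rewrite tnth_mktuple; case: splitP => j /= E; [case: j E => j /= jN; lia|];
     rewrite (_ : j = i) ?derU ?eqxx ?mulr1//; apply: val_inj => /=; lia.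
move=> r ri; rewrite tnth_mktuple; case: splitP => j /= E; first by rewrite derC mulr0.
rewrite derU; case: eqP => [ji|_]; last by rewrite mulr0.
by case/eqP: ri; apply: val_inj; rewrite /= E ji.
Qed.

Lemma specializeX x m :
  specialize x (mpolyX R m) = (\prod_i x i ^+ lpart m i) *: mpolyX R (rpart m).
Proof.
apply: mpoly_eq_eval => w; rewrite eval_specialize evalZ !evalX big_split_ord /=.
by congr (_ * _); apply: eq_bigr => i _; rewrite ?join_lshift ?join_rshift ?lpartE ?rpartE.
Qed.

Lemma avgX m : avg (mpolyX R m) = dirichlet_moment a (rpart m) *: mpolyX R (lpart m).
Proof. exact: mlinX. Qed.

Lemma avg_comb c H K : avg (c *: H + K) = c *: avg H + avg K.
Proof. by rewrite /avg mlinD mlinZ. Qed.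

Lemma eval_avg x H : (avg H).@[x] = Exp (specialize x H).
Proof.
elim/mpoly_lin_ind: H => [|c p q IHp IHq|m].
- by rewrite /avg mlin0 (_ : specialize x 0 = 0) ?meval0 /Exp ?mlin0//; exact: raddf0.
- by rewrite avg_comb evalD evalZ IHp IHq specializeD specializeZ /Exp mlinD mlinZ.
- by rewrite avgX evalZ evalX specializeX /Exp mlinZ mlinX mulrC.
Qed.

Lemma der_avg H i : (avg H)^`M(i) = avg (H^`M(lshift N.+1 i)).
Proof.
elim/mpoly_lin_ind: H => [|c p q IHp IHq|m].
- by rewrite mderiv0 /avg mlin0 mderiv0.
- by rewrite avg_comb derD derZ IHp IHq -avg_comb -derZ -derD.
- rewrite avgX derZ !mderivX /avg mlinZ mlinX lpartE.
  rewrite (_ : lpart (mnm_sub _ _) = mnm_sub (lpart m) (mnm1 i)); last first.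
    by apply/mnmP => j; rewrite lpartE !mnmBE lpartE !mnm1E (inj_eq (@lshift_inj _ _)).
  rewrite (_ : rpart (mnm_sub _ _) = rpart m) ?scalerA 1?mulrC//.
  apply/mnmP => j; rewrite !rpartE mnmBE mnm1E; case: eqP => [/(congr1 val)/=|_].
    by have := ltn_ord i; lia.
  by rewrite subn0.
Qed.

Lemma msupp_avg H m' : m' \in msupp (avg H) -> exists2 m, m \in msupp H & lpart m = m'.
Proof.
rewrite mcoeff_msupp /avg /mlin mcoef_sum => h.
apply: contrapT => hN; case/negP: h; apply/eqP; rewrite big_seq_cond big1// => m.
rewrite andbT => mH; rewrite !mcoefZ mcoeffX; case: eqP => [E|_]; last by rewrite !mulr0.
by case: hN; exists m.
Qed.

End Averaging.

Section DirichletExpectation.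
Variables (R : realType) (N : nat) (a : R).
Hypothesis a0 : 0 < a.
Implicit Types (K : {mpoly R[N.+1]}) (w : 'I_N.+1 -> R) (i j : 'I_N.+1).
Local Notation Exp := (@Exp R N a).
Local Notation X i := (mpolyX R (mnm1 i)).

Lemma ExpD K L : Exp (K + L) = Exp K + Exp L.
Proof. exact: mlinD. Qed.

Lemma ExpZ c K : Exp (c *: K) = c * Exp K.
Proof. exact: mlinZ. Qed.

Lemma Exp_sum (I : Type) (r : seq I) (P : pred I) (F : I -> {mpoly R[N.+1]}) :
  Exp (\sum_(i <- r | P i) F i) = \sum_(i <- r | P i) Exp (F i).
Proof. exact: mlin_sum. Qed.

Let am0 k : 0 < a + k%:R.
Proof. by rewrite ltr_pwDl. Qed.

(** Apart from the factor a + m_j the right side does not depend on j: this is what makes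
    integration by parts between two coordinates exact. *)
Lemma dirichlet_momentS (m : multinom N.+1) j :
  dirichlet_moment a (mnm_add m (mnm1 j))
  = (a + (m j)%:R) * (\prod_i Gamma (a + (m i)%:R)
      / (2 ^+ N * Gamma (\sum_i (a + (m i)%:R) + 1))).
Proof.
rewrite /dirichlet_moment mulrA; congr (_ / (_ * Gamma _)).
  rewrite (bigD1 j)//= [in RHS](bigD1 j)//= mulrA; congr (_ * _).
    by rewrite mnmDE mnm1E eqxx natrD addrA GammaS.
  by apply: eq_bigr => i ij; rewrite mnmDE mnm1E eq_sym (negbTE ij) addn0.
rewrite (bigD1 j)//= [in RHS](bigD1 j)//= mnmDE mnm1E eqxx natrD addrA addrAC; congr (_ + _ + _).
by apply: eq_bigr => i ij; rewrite mnmDE mnm1E eq_sym (negbTE ij) addn0.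
Qed.

(* Integration by parts along the field w_i w_j (d/dw_i - d/dw_j), which is
   tangent to the simplex. *)
Lemma Exp_by_parts K i j :
  Exp (X i * X j * (K^`M(i) - K^`M(j))) = a * Exp ((X i - X j) * K).
Proof.
elim/mpoly_lin_ind: K => [|c p q IHp IHq|m].
- by rewrite !mderiv0 subr0 !mulr0 -(scale0r 0) ExpZ mul0r mulr0.
- have -> : X i * X j * ((c *: p + q)^`M(i) - (c *: p + q)^`M(j))
      = c *: (X i * X j * (p^`M(i) - p^`M(j))) + X i * X j * (q^`M(i) - q^`M(j)) :> {mpoly R[N.+1]}.
    by rewrite !derD !derZ -!mul_mpolyC; ring.
  have -> : (X i - X j) * (c *: p + q) = c *: ((X i - X j) * p) + (X i - X j) * q :> {mpoly R[N.+1]}.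
    by rewrite -!mul_mpolyC; ring.
  by rewrite !ExpD !ExpZ IHp IHq; ring.
- have E k l : X k * X l * (mpolyX R m)^`M(k) = (m k)%:R *: mpolyX R (mnm_add m (mnm1 l)) :> {mpoly R[N.+1]}.
    have -> : X k * X l * (mpolyX R m)^`M(k) = X l * (X k * (mpolyX R m)^`M(k)) :> {mpoly R[N.+1]} by ring.
    rewrite mpolyXD mulrC scalerAl; congr (_ * _); apply/mpolyP => m'.
    by rewrite mcoeff_euler mcoefZ mcoeffX; case: eqP => [->//|_]; rewrite !mulr0.
  have -> : X i * X j * ((mpolyX R m)^`M(i) - (mpolyX R m)^`M(j))
      = (m i)%:R *: mpolyX R (mnm_add m (mnm1 j)) - (m j)%:R *: mpolyX R (mnm_add m (mnm1 i)) :> {mpoly R[N.+1]}.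
    by rewrite -!E; ring.
  have -> : (X i - X j) * mpolyX R m
      = mpolyX R (mnm_add m (mnm1 i)) - mpolyX R (mnm_add m (mnm1 j)) :> {mpoly R[N.+1]}.
    by rewrite !mpolyXD; ring.
  rewrite -scaleNr -[- mpolyX R (mnm_add m (mnm1 j))]scaleN1r !ExpD !ExpZ /Exp !mlinX !dirichlet_momentS.
  ring.
Qed.

(** Read on the sphere with w_i = q_i^2, [Exp] integrates over the open simplex. Through this lemma,
    identities that rely on w_i > 0 and sum w_i = 1 enter the algebra. *)
Lemma Exp_simplex K L :
  (forall w, (forall i, 0 < w i) -> \sum_i w i = 1 -> K.@[w] = L.@[w]) -> Exp K = Exp L.
Proof.
move=> KL; apply: EFin_inj.
have b0 : 0 < 2 * a by rewrite mulr_gt0.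
have aE : a = 2 * a / 2 by rewrite mulrAC divff ?mul1r ?pnatr_eq0.
have P H : pos_sphere_integral (fun q : 'cV[R]_N.+1 =>
     (\prod_i q i ord0 `^ (2 * a - 1)) * H.@[fun i => q i ord0 ^+ 2]) = (Exp H)%:E.
  by rewrite (integral_sphere_poly H b0) -aE.
rewrite -!P; apply: eq_pos_sphere_integral => q q0 q1; congr (_ * _); apply: KL => //.
by move=> i; rewrite exprn_gt0.
Qed.

End DirichletExpectation.

Section Mixtures.
Variables (R : realType) (n : nat).
Local Notation N := n.+1.
Local Notation T := {mpoly R[(N + N)]}.
Implicit Types (x w : 'I_N -> R) (i j l : 'I_N) (k : nat) (c : R).
Local Notation Xl i := (mpolyX R (mnm1 (lshift N i)) : T).
Local Notation Xw i := (mpolyX R (mnm1 (rshift N i)) : T).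

(* Evaluated at (x, w) it is sum_i w_i e_k(x without x_i). *)
Definition mix_mesym k : T :=
  \sum_i Xw i * comp_mpoly [tuple Xl (lift i j) | j < n] (mesym n R k).

Lemma prod_lift (S : comNzRingType) (F : 'I_N -> S) i :
  \prod_(j < n) F (lift i j) = \prod_(j in [set: 'I_N] :\ i) F j.
Proof.
rewrite [RHS](reindex_omap (lift i) (unlift i)) /=.
  by apply: eq_bigl => j; rewrite !inE andbT liftK eqxx andbT eq_sym neq_lift.
by move=> j; rewrite !inE andbT eq_sym => /unlift_some[k -> ->].
Qed.

Definition gen_prod (A : {set 'I_N}) c : T := \prod_(j in A) (mpolyC (N + N) c - Xl j).

Lemma comp_prod k (lq : n.-tuple {mpoly R[k]}) (J : Type) (r : seq J) (P : pred J) F :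
  comp_mpoly lq (\prod_(j <- r | P j) F j) = \prod_(j <- r | P j) comp_mpoly lq (F j).
Proof. by elim/big_rec2: _ => [|j p q _ <-]; rewrite ?comp_mpoly1 ?rmorphM. Qed.

Lemma mix_mesym_gen c :
  \sum_(k < n.+1) ((-1) ^+ k * c ^+ (n - k)) *: mix_mesym k
  = \sum_i Xw i * gen_prod ([set: 'I_N] :\ i) c.
Proof.
under eq_bigr => k _ do rewrite /mix_mesym scaler_sumr.
rewrite exchange_big; apply: eq_bigr => i _ /=.
under eq_bigr => k _ do rewrite scalerAr -comp_mpolyZ.
rewrite -mulr_sumr -raddf_sum -mesym_gen_mpoly /= comp_prod /gen_prod -prod_lift; congr (_ * _).
apply: eq_bigr => j _.
by rewrite raddfB /= comp_mpolyC comp_mpolyXU -tnth_nth tnth_mktuple.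
Qed.

Lemma eval_gen_prod x w A c : (gen_prod A c).@[join x w] = pr x A c.
Proof.
by rewrite eval_prod; apply: eq_bigr => j _; rewrite evalB evalC evalU join_lshift.
Qed.

Lemma der_gen_prod_l A c i :
  (gen_prod A c)^`M(lshift N i) = - (if i \in A then gen_prod (A :\ i) c else 0).
Proof.
have D j : (mpolyC (N + N) c - Xl j)^`M(lshift N i) = - (j == i)%:R :> T.
  by rewrite mderivB derC derU sub0r (inj_eq (@lshift_inj _ _)).
rewrite der_prod; case: ifPn => iA.
  rewrite (big_setD1 i)//= D eqxx mulN1r [X in _ + X]big1 ?addr0// => j; rewrite !inE => /andP[ji _].
  by rewrite D (negbTE ji) oppr0 mul0r.
rewrite oppr0 big1// => j jA; rewrite D (_ : j == i = false) ?oppr0 ?mul0r//.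
by apply: contraNF iA => /eqP <-.
Qed.

Lemma lrshift_neq i j : (lshift N i == rshift N j) = false.
Proof. by apply/eqP => /(congr1 val)/=; have := ltn_ord i; lia. Qed.

Lemma der_gen_prod_r A c i : (gen_prod A c)^`M(rshift N i) = 0.
Proof.
rewrite der_prod big1// => j _.
by rewrite mderivB derC derU lrshift_neq subr0 mul0r.
Qed.

Lemma der_mix_gen_l c i :
  (\sum_(k < n.+1) ((-1) ^+ k * c ^+ (n - k)) *: mix_mesym k)^`M(lshift N i)
  = - \sum_(l | l != i) Xw l * gen_prod ([set: 'I_N] :\ i :\ l) c.
Proof.
rewrite mix_mesym_gen der_sum (bigID [pred l | l != i]) /= [X in _ + X]big1 ?addr0.
  rewrite -sumrN; apply: eq_bigr => l li.
  rewrite derM derU eq_sym lrshift_neq mul0r add0r der_gen_prod_l !inE eq_sym li /= mulrN.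
  by rewrite setD1C.
move=> l; rewrite negbK => /eqP ->.
by rewrite derM derU eq_sym lrshift_neq mul0r add0r der_gen_prod_l !inE eqxx oppr0 mulr0.
Qed.

Lemma der_mix_gen_ll c i :
  (\sum_(k < n.+1) ((-1) ^+ k * c ^+ (n - k)) *: mix_mesym k)^`M(lshift N i)^`M(lshift N i) = 0.
Proof.
rewrite der_mix_gen_l mderivN der_sum big1 ?oppr0// => l li.
by rewrite derM derU eq_sym lrshift_neq mul0r add0r der_gen_prod_l !inE eqxx andbF oppr0 mulr0.
Qed.

Lemma der_mix_gen_r c i :
  (\sum_(k < n.+1) ((-1) ^+ k * c ^+ (n - k)) *: mix_mesym k)^`M(rshift N i)
  = gen_prod ([set: 'I_N] :\ i) c.
Proof.
rewrite mix_mesym_gen der_sum (bigD1 i)//= derM derU eqxx mul1r der_gen_prod_r mulr0 addr0.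
rewrite big1 ?addr0// => l li; rewrite derM derU der_gen_prod_r mulr0 addr0.
by rewrite (inj_eq (@rshift_inj _ _)) (negbTE li) mul0r.
Qed.

Lemma eval_mix_mesym x w k : (k <= n)%N ->
  (mix_mesym k).@[join x w] = (-1) ^+ k * (mixture x w)`_(n - k).
Proof.
move=> kn; apply: (@gen_coef R n (fun k => (mix_mesym k).@[join x w])) => // c.
rewrite -(eval_lin_comb _ (fun k : 'I_n.+1 => (-1) ^+ k * c ^+ (n - k)) (fun k : 'I_n.+1 => mix_mesym k)).
rewrite mix_mesym_gen eval_sum horner_sumR; apply: eq_bigr => l _.
by rewrite hornerZ horner_prp evalM evalU join_rshift eval_gen_prod.
Qed.

Lemma der_l_mix_mesym x w i k : (k <= n)%N ->
  (mix_mesym k)^`M(lshift N i).@[join x w] = (-1) ^+ k * (- rem_sum x w i)`_(n - k).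
Proof.
move=> kn; apply: (@gen_coef R n (fun k => (mix_mesym k)^`M(lshift N i).@[join x w])) => // c.
rewrite -(eval_lin_comb _ (fun k : 'I_n.+1 => (-1) ^+ k * c ^+ (n - k)) (fun k : 'I_n.+1 => (mix_mesym k)^`M(lshift N i))).
rewrite -der_lin_comb der_mix_gen_l evalN hornerN horner_rem_sum; congr (- _).
rewrite eval_sum; apply: eq_bigr => l _; by rewrite evalM evalU join_rshift eval_gen_prod.
Qed.

Lemma der_ll_mix_mesym x w i k : (k <= n)%N ->
  (mix_mesym k)^`M(lshift N i)^`M(lshift N i).@[join x w] = 0.
Proof.
move=> kn; have -> : 0 = (-1) ^+ k * (0 : {poly R})`_(n - k) :> R by rewrite coef0 mulr0.
apply: (@gen_coef R n (fun k => (mix_mesym k)^`M(lshift N i)^`M(lshift N i).@[join x w])) => // c.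
rewrite -(eval_lin_comb _ (fun k : 'I_n.+1 => (-1) ^+ k * c ^+ (n - k)) (fun k : 'I_n.+1 => (mix_mesym k)^`M(lshift N i)^`M(lshift N i))).
by rewrite -!der_lin_comb der_mix_gen_ll meval0 horner0.
Qed.

Lemma der_r_mix_mesym x w i k : (k <= n)%N ->
  (mix_mesym k)^`M(rshift N i).@[join x w] = (-1) ^+ k * (prp x ([set: 'I_N] :\ i))`_(n - k).
Proof.
move=> kn; apply: (@gen_coef R n (fun k => (mix_mesym k)^`M(rshift N i).@[join x w])) => // c.
rewrite -(eval_lin_comb _ (fun k : 'I_n.+1 => (-1) ^+ k * c ^+ (n - k)) (fun k : 'I_n.+1 => (mix_mesym k)^`M(rshift N i))).
by rewrite -der_lin_comb der_mix_gen_r eval_gen_prod horner_prp.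
Qed.

End Mixtures.

(** * The intertwining relation *)

Section SecondOrderChainRule.
Variables (R : realType) (M n : nat) (lq : n.-tuple {mpoly R[M]}) (F : {mpoly R[n]}).
Variables (v : 'I_M -> R).
Let q r := (tnth lq r).@[v].

Lemma eval_comp G : (comp_mpoly lq G).@[v] = G.@[q].
Proof. exact: comp_mpoly_meval. Qed.

Lemma chain_rule_eval i :
  (comp_mpoly lq F)^`M(i).@[v] = \sum_r (F^`M(r)).@[q] * (tnth lq r)^`M(i).@[v].
Proof.
rewrite chain_rule eval_sum; apply: eq_bigr => r _; by rewrite evalM eval_comp.
Qed.

Lemma chain_rule2_eval i : (forall r, (tnth lq r)^`M(i)^`M(i).@[v] = 0) ->
  (comp_mpoly lq F)^`M(i)^`M(i).@[v]
  = \sum_r \sum_s (F^`M(r)^`M(s)).@[q]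
      * ((tnth lq r)^`M(i).@[v] * (tnth lq s)^`M(i).@[v]).
Proof.
move=> lq0; rewrite chain_rule der_sum eval_sum; apply: eq_bigr => r _.
rewrite derM evalD !evalM lq0 mulr0 addr0 chain_rule eval_sum mulr_suml.
apply: eq_bigr => s _; rewrite evalM eval_comp; ring.
Qed.

End SecondOrderChainRule.

(** * The operator in elementary symmetric coordinates *)

Section SymmetricEigenfunctions.
Variables (R : realType) (n : nat).
Implicit Types (F : {mpoly R[n]}) (v : 'I_n -> R) (r s : 'I_n).
Local Notation X i := (mpolyX R (mnm1 i) : {mpoly R[n]}).

Definition esyms : n.-tuple {mpoly R[n]} := [tuple mesym n R r.+1 | r < n].

Definition esym_values v (r : 'I_n) : R := (mesym n R r.+1).@[v].
Local Notation ev := esym_values.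

Definition theta_coef (r : 'I_n) : R :=
  n%:R * (n%:R + 1) / 2 - (n - r.+1)%:R * ((n - r.+1)%:R + 1) / 2.

Definition esym_carre v (r s : 'I_n) : R :=
  \sum_i v i ^+ 2 * ((mesym n R r.+1)^`M(i).@[v] * (mesym n R s.+1)^`M(i).@[v]).

Lemma first_order_mesym v r : injective v ->
  \sum_i (\sum_(j | j != i) v i ^+ 2 / (v i - v j) + v i) * (mesym n R r.+1)^`M(i).@[v]
  = theta_coef r * (mesym n R r.+1).@[v].
Proof.
move=> vi; have rn := ltn_ord r.
have P : \sum_i (\sum_(j | j != i) v i ^+ 2 / (v i - v j) + v i) *: - prp v ([set: 'I_n] :\ i)
    = theta n (prp v [set: 'I_n]).
  apply: poly_eq_horner => z; rewrite horner_sumR.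
  have := first_order [set: 'I_n]%SET z vi; rewrite cardsT card_ord => <-.
  apply: eq_big => [i|i _]; first by rewrite inE.
  rewrite hornerZ hornerN horner_prp; congr ((_ + _) * _).
  by apply: eq_bigl => j; rewrite !inE andbT.
rewrite mesym_coef// mulrCA -coef_theta -P coef_sumR mulr_sumr; apply: eq_bigr => i _.
by rewrite coefZ der_mesym_coef// mulrCA.
Qed.

Lemma eigen_esyms_inj F (beta e : R) v : injective v ->
  let p := comp_mpoly esyms F in
  Dstar beta p v + beta * \sum_i v i * p^`M(i).@[v] = e * p.@[v] ->
  \sum_r \sum_s (F^`M(r)^`M(s)).@[ev v] * esym_carre v r s
  + beta * \sum_r (F^`M(r)).@[ev v]
      * (theta_coef r * (mesym n R r.+1).@[v])
  = e * F.@[ev v].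
Proof.
move=> vi p.
have qE G : G.@[ev v] = G.@[fun r => (tnth esyms r).@[v]].
  by apply: meval_eq => r; rewrite tnth_mktuple.
rewrite [p.@[v]]eval_comp -qE => <-.
rewrite /Dstar -addrA; congr (_ + _).
  under [RHS]eq_bigr => i _.
    rewrite chain_rule2_eval; last by move=> r; rewrite tnth_mktuple der2_mesym.
    rewrite mulr_sumr; under eq_bigr => r _ do rewrite mulr_sumr.
    over.
  rewrite [RHS]exchange_big; apply: eq_bigr => r _; rewrite [RHS]exchange_big; apply: eq_bigr => s _ /=.
  by rewrite qE /esym_carre mulr_sumr; apply: eq_bigr => i _; rewrite !tnth_mktuple mulrCA.
rewrite -mulrDr -big_split /=; congr (_ * _).
under [RHS]eq_bigr => i _ do rewrite -mulr_suml -mulrDl chain_rule_eval mulr_sumr.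
rewrite [RHS]exchange_big; apply: eq_bigr => r _ /=.
rewrite -first_order_mesym// mulr_sumr; apply: eq_bigr => i _.
by rewrite qE tnth_mktuple mulrCA.
Qed.

(** In the coordinates e_r both sides are polynomials in v, so [mpoly_eq_injective] extends the
    equation from distinct v_i to all v. It will be used at the roots of a mixture, which are not
    shown to be distinct. *)
Lemma eigen_esyms F (beta e : R) :
  let p := comp_mpoly esyms F in
  (forall v, injective v ->
    Dstar beta p v + beta * \sum_i v i * p^`M(i).@[v] = e * p.@[v]) ->
  forall v,
  \sum_r \sum_s (F^`M(r)^`M(s)).@[ev v] * esym_carre v r s
  + beta * \sum_r (F^`M(r)).@[ev v]
      * (theta_coef r * (mesym n R r.+1).@[v])
  = e * F.@[ev v].
Proof.
move=> p pe v.
have qE u G : G.@[ev u] = (comp_mpoly esyms G).@[u].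
  by rewrite eval_comp; apply: meval_eq => r; rewrite tnth_mktuple.
pose gam r s : {mpoly R[n]} := \sum_i X i ^+ 2 * ((mesym n R r.+1)^`M(i) * (mesym n R s.+1)^`M(i)).
have gamE u (r s : 'I_n) : esym_carre u r s = (gam r s).@[u].
  by rewrite eval_sum; apply: eq_bigr => i _; rewrite evalM evalXn evalU evalM.
pose L : {mpoly R[n]} := \sum_r \sum_s comp_mpoly esyms (F^`M(r)^`M(s)) * gam r s
  + beta *: \sum_r comp_mpoly esyms (F^`M(r)) * (theta_coef r *: mesym n R r.+1).
have LE u : L.@[u] = \sum_r \sum_s (F^`M(r)^`M(s)).@[ev u] * esym_carre u r s
  + beta * \sum_r (F^`M(r)).@[ev u]
      * (theta_coef r * (mesym n R r.+1).@[u]).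
  rewrite evalD evalZ !eval_sum; congr (_ + _ * _); apply: eq_bigr => r _.
    by rewrite eval_sum; apply: eq_bigr => s _; rewrite evalM gamE qE.
  by rewrite evalM evalZ qE.
rewrite -LE qE -evalZ; congr (_.@[_]); apply: mpoly_eq_injective => u ui.
by rewrite LE evalZ -qE; apply: eigen_esyms_inj => //; apply: pe.
Qed.

End SymmetricEigenfunctions.

Lemma sum_pair (R : realType) (I J : finType) (f : I * J -> R) :
  \sum_p f p = \sum_i \sum_j f (i, j).
Proof. by rewrite pair_bigA; apply: eq_bigr => -[]. Qed.

Section Intertwining.
Variables (R : realType) (n : nat) (a : R) (F : {mpoly R[n]}) (e : R).
Local Notation N := n.+1.
Variable x : 'I_N -> R.
Implicit Types (w : 'I_N -> R) (v : 'I_n -> R) (l m i : 'I_N) (r s : 'I_n).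
Hypotheses (a0 : 0 < a) (xi : injective x).
Local Notation Xv i := (mpolyX R (mnm1 i) : {mpoly R[N]}).

Definition mixes : n.-tuple {mpoly R[N + N]} := [tuple mix_mesym R n r.+1 | r < n].

Local Notation ev := (@esym_values R n).

(** For l <> m this is - e_r of the n - 1 variables other than x_l and x_m; (x_l - x_m) t l m r is
    the derivative of the mixed e_(r + 1) along d/dw_l - d/dw_m, see [diff_mixes]. *)
Let t l m r : R := (-1) ^+ r.+1 * (prp x ([set: 'I_N] :\ l :\ m))`_(n - r.+1).
Let kap l m : R := x l * x m / (x l - x m).
Let G := comp_mpoly mixes F.

Let eval_mixes w v H : prp v [set: 'I_n] = mixture x w ->
  (comp_mpoly mixes H).@[join x w] = H.@[ev v].
Proof.
move=> vw; rewrite eval_comp; apply: meval_eq => r.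
by rewrite tnth_mktuple /esym_values mesym_coef// vw eval_mix_mesym.
Qed.

(** As the v_j are the roots of the mixture, the [carre] terms of [carre_mixture] and of
    [sum_sqr_prD1] for v coincide and cancel. What is left is a bilinear sum with factor y - z, to
    which [bilinear_coef_eq0] applies. *)
Let carre_mixes w v r s : prp v [set: 'I_n] = mixture x w ->
  \sum_i x i ^+ 2 * ((mix_mesym R n r.+1)^`M(lshift N i).@[join x w]
                     * (mix_mesym R n s.+1)^`M(lshift N i).@[join x w])
  = esym_carre v r s
    - \sum_l \sum_(m | m != l) w l * w m * x l * x m * (t l m r * t l m s).
Proof.
move=> vw.
pose K := ('I_N + 'I_n + 'I_N * 'I_N)%type.
pose h (k : K) : {poly R} := match k with
  | inl (inl i) => x i ^+ 2 *: rem_sum x w i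
  | inl (inr j) => - (v j ^+ 2) *: prp v ([set: 'I_n] :\ j)
  | inr (l, m) => (if m != l then w l * w m * x l * x m else 0) *: prp x ([set: 'I_N] :\ l :\ m)
  end.
pose g (k : K) : {poly R} := match k with
  | inl (inl i) => rem_sum x w i
  | inl (inr j) => prp v ([set: 'I_n] :\ j)
  | inr (l, m) => prp x ([set: 'I_N] :\ l :\ m)
  end.
have H0 z y : (y - z) * \sum_k (h k).[z] * (g k).[y] = 0.
  rewrite !big_sumType sum_pair /=.
  have := carre_mixture x w z y; rewrite card_ord -vw /=.
  have := sum_sqr_prD1 v [set: 'I_n]%SET z y; rewrite cardsT card_ord.
  rewrite /carre !horner_deriv_prp !horner_prp => <- E.
  rewrite 2!mulrDr.
  have -> : \sum_i (x i ^+ 2 *: rem_sum x w i).[z] * (rem_sum x w i).[y]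
     = \sum_i x i ^+ 2 * ((rem_sum x w i).[z] * (rem_sum x w i).[y]).
    by apply: eq_bigr => i _; rewrite hornerZ mulrA.
  have -> : \sum_j (- v j ^+ 2 *: prp v ([set: 'I_n] :\ j)).[z] * (prp v ([set: 'I_n] :\ j)).[y]
     = - \sum_(j in [set: 'I_n]%SET) v j ^+ 2 * pr v ([set: 'I_n] :\ j) z * pr v ([set: 'I_n] :\ j) y.
    rewrite -sumrN; apply: eq_big => [j|j _]; first by rewrite inE.
    by rewrite hornerZ !horner_prp !mulNr.
  have -> : \sum_l \sum_m ((if m != l then w l * w m * x l * x m else 0) *: prp x ([set: 'I_N] :\ l :\ m)).[z]
        * (prp x ([set: 'I_N] :\ l :\ m)).[y]
     = \sum_l \sum_(m | m != l) w l * w m * x l * x m *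
       (pr x ([set: 'I_N] :\ l :\ m) z * pr x ([set: 'I_N] :\ l :\ m) y).
    apply: eq_bigr => l _; rewrite [RHS]big_mkcond; apply: eq_bigr => m _.
    rewrite hornerZ !horner_prp; case: ifP => _; first by rewrite mulrA.
    by rewrite !mul0r.
  by rewrite mulrN E addNr.
have := bilinear_coef_eq0 H0 (n - r.+1) (n - s.+1).
rewrite !big_sumType sum_pair /=.
move=> /(congr1 ( *%R ((-1) ^+ r.+1 * (-1) ^+ s.+1))); rewrite mulr0 !mulrDr.
have -> : (-1) ^+ r.+1 * (-1) ^+ s.+1 * \sum_i (x i ^+ 2 *: rem_sum x w i)`_(n - r.+1) * (rem_sum x w i)`_(n - s.+1)
  = \sum_i x i ^+ 2 * ((mix_mesym R n r.+1)^`M(lshift N i).@[join x w]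
                     * (mix_mesym R n s.+1)^`M(lshift N i).@[join x w]).
  rewrite mulr_sumr; apply: eq_bigr => i _.
  rewrite !der_l_mix_mesym ?coefZ ?coefN//; ring.
have -> : (-1) ^+ r.+1 * (-1) ^+ s.+1 * \sum_j (- v j ^+ 2 *: prp v ([set: 'I_n] :\ j))`_(n - r.+1)
      * (prp v ([set: 'I_n] :\ j))`_(n - s.+1) = - esym_carre v r s.
  rewrite mulr_sumr -sumrN; apply: eq_bigr => i _.
  rewrite !der_mesym_coef ?coefZ ?coefN//; ring.
have -> : (-1) ^+ r.+1 * (-1) ^+ s.+1 * \sum_l \sum_m
    ((if m != l then w l * w m * x l * x m else 0) *: prp x ([set: 'I_N] :\ l :\ m))`_(n - r.+1)
       * (prp x ([set: 'I_N] :\ l :\ m))`_(n - s.+1)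
   = \sum_l \sum_(m | m != l) w l * w m * x l * x m * (t l m r * t l m s).
  rewrite mulr_sumr; apply: eq_bigr => l _; rewrite mulr_sumr [RHS]big_mkcond; apply: eq_bigr => m _.
  rewrite coefZ /t; case: ifP => _; ring.
by move=> E; apply/eqP; rewrite -subr_eq0; apply/eqP; rewrite -[RHS]E; ring.
Qed.

Let first_order_mixes w v r : prp v [set: 'I_n] = mixture x w ->
  \sum_i (\sum_(j | j != i) x i ^+ 2 / (x i - x j)) * (mix_mesym R n r.+1)^`M(lshift N i).@[join x w]
  = theta_coef R r * (mesym n R r.+1).@[v] + \sum_l \sum_(m | m != l) w l * kap l m * t l m r.
Proof.
move=> vw.
have P : \sum_i (\sum_(j | j != i) x i ^+ 2 / (x i - x j)) *: - rem_sum x w i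
    = theta n (mixture x w)
      + \sum_l (\sum_(m | m != l) (w l * kap l m) *: prp x ([set: 'I_N] :\ l :\ m)).
  apply: poly_eq_horner => z; rewrite hornerD !horner_sumR.
  have := first_order_mixture w z xi; rewrite card_ord /= => E.
  apply: etrans; last apply: etrans E _.
    by apply: eq_bigr => i _; rewrite hornerZ hornerN.
  congr (_ + _); apply: eq_bigr => l _; rewrite horner_sumR; apply: eq_bigr => m _.
  by rewrite hornerZ horner_prp.
rewrite mesym_coef// mulrCA vw -coef_theta.
have -> : \sum_l \sum_(m | m != l) w l * kap l m * t l m r
   = (-1) ^+ r.+1 * (\sum_l (\sum_(m | m != l) (w l * kap l m) *: prp x ([set: 'I_N] :\ l :\ m)))`_(n - r.+1).
  rewrite coef_sumR mulr_sumr; apply: eq_bigr => l _; rewrite coef_sumR mulr_sumr.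
  by apply: eq_bigr => m _; rewrite coefZ /t mulrCA.
rewrite -mulrDr -coefD -P coef_sumR mulr_sumr; apply: eq_bigr => i _.
by rewrite der_l_mix_mesym// coefZ mulrCA.
Qed.

Let diff_mixes w l m s : l != m ->
  (mix_mesym R n s.+1)^`M(rshift N l).@[join x w] - (mix_mesym R n s.+1)^`M(rshift N m).@[join x w]
  = (x l - x m) * t l m s.
Proof.
move=> lm; rewrite !der_r_mix_mesym// -mulrBr -coefB /t mulrCA; congr (_ * _).
rewrite -coefZ; congr (polyseq _)`_ _; apply: poly_eq_horner => z.
rewrite hornerZ hornerD hornerN !horner_prp.
rewrite (@prD1 _ _ x ([set: 'I_N] :\ l) m); last by rewrite !inE eq_sym lm.
rewrite (@prD1 _ _ x ([set: 'I_N] :\ m) l); last by rewrite !inE lm.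
by rewrite [_ :\ m :\ l]setD1C; ring.
Qed.

Hypothesis split_mixture : forall w, (forall i, 0 < w i) -> \sum_i w i = 1 ->
  exists v, prp v [set: 'I_n] = mixture x w.
Hypothesis eigenF : forall v,
  \sum_r \sum_s (F^`M(r)^`M(s)).@[ev v] * esym_carre v r s
  + 2 * a * \sum_r (F^`M(r)).@[ev v]
      * (theta_coef R r * (mesym n R r.+1).@[v])
  = e * F.@[ev v].

Let Kr r := specialize x (comp_mpoly mixes (F^`M(r))).

Let eval_diff_K w l m r : l != m ->
  (Xv l * Xv m * ((Kr r)^`M(l) - (Kr r)^`M(m))).@[w]
  = (x l - x m) * (w l * w m * \sum_s (F^`M(r)^`M(s)).@[fun s => (tnth mixes s).@[join x w]] * t l m s).
Proof.
move=> lm; rewrite /Kr !specialize_der !evalM evalB !evalU !eval_specialize !chain_rule_eval.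
rewrite mulrCA; congr (_ * _); rewrite -sumrB mulr_sumr; apply: eq_bigr => s _.
by rewrite -mulrBr tnth_mktuple diff_mixes// mulrCA.
Qed.

(** On the simplex the operator under the average equals e G minus corrections indexed by (l, m, r).
    With K_r the r-th partial derivative of F at the mixtures, these are w_l w_m (d/dw_l - d/dw_m)
    K_r from the second order and - 2 a w_l K_r from the first order, both with the coefficient kap
    l m t l m r. By [Exp_by_parts] their sum averages to - a times the average of (w_l + w_m) K_r.
    This is symmetric in l and m, as is t, while kap is antisymmetric. *)
Lemma avg_eigen : Dstar (2 * a) (avg a G) x = e * (avg a G).@[x].
Proof.
pose c i : R := \sum_(j | j != i) x i ^+ 2 / (x i - x j).
pose K := \sum_i (x i ^+ 2) *: specialize x (G^`M(lshift N i)^`M(lshift N i))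
  + (2 * a) *: \sum_i c i *: specialize x (G^`M(lshift N i)).
pose L := e *: specialize x G - \sum_l \sum_(m | m != l) \sum_r
   (kap l m * t l m r) *: (Xv l * Xv m * ((Kr r)^`M(l) - (Kr r)^`M(m)) - (2 * a) *: (Xv l * Kr r)).
have DK : Dstar (2 * a) (avg a G) x = Exp a K.
  rewrite ExpD ExpZ !Exp_sum /Dstar; congr (_ + _ * _); apply: eq_bigr => i _.
    by rewrite ExpZ !der_avg eval_avg.
  by rewrite -mulr_suml ExpZ !der_avg eval_avg.
have KL : Exp a K = Exp a L.
  apply: Exp_simplex => // w w0 w1; have [v vw] := split_mixture w0 w1.
  have qE H : H.@[fun r => (tnth mixes r).@[join x w]] = H.@[ev v].
    by rewrite -eval_comp; apply: eval_mixes.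
  rewrite evalD evalZ !eval_sum evalB evalZ eval_specialize (eval_mixes _ vw) -eigenF.
  have -> : \sum_i (x i ^+ 2 *: specialize x (G^`M(lshift N i)^`M(lshift N i))).@[w]
      = \sum_r \sum_s (F^`M(r)^`M(s)).@[ev v]
          * (esym_carre v r s
             - \sum_l \sum_(m | m != l) w l * w m * x l * x m * (t l m r * t l m s)).
    under eq_bigr => i _.
      rewrite evalZ eval_specialize chain_rule2_eval; last first.
        by move=> r; rewrite tnth_mktuple der_ll_mix_mesym.
      rewrite mulr_sumr; under eq_bigr => r _ do rewrite mulr_sumr.
      over.
    rewrite exchange_big; apply: eq_bigr => r _; rewrite exchange_big; apply: eq_bigr => s _ /=.
    by rewrite qE -(carre_mixes _ _ vw) mulr_sumr; apply: eq_bigr => i _; rewrite !tnth_mktuple mulrCA.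
  have -> : \sum_i (c i *: specialize x (G^`M(lshift N i))).@[w]
      = \sum_r (F^`M(r)).@[ev v]
          * (theta_coef R r * (mesym n R r.+1).@[v]
             + \sum_l \sum_(m | m != l) w l * kap l m * t l m r).
    under eq_bigr => i _ do rewrite evalZ eval_specialize chain_rule_eval mulr_sumr.
    rewrite exchange_big; apply: eq_bigr => r _ /=.
    rewrite qE -(first_order_mixes _ vw) mulr_sumr; apply: eq_bigr => i _.
    by rewrite tnth_mktuple mulrCA.
  under eq_bigr => r _ do under eq_bigr => s _ do rewrite mulrBr.
  under eq_bigr => r _ do rewrite sumrB.
  rewrite sumrB; under [X in _ + _ * X]eq_bigr => r _ do rewrite mulrDr.
  rewrite big_split /= mulrDr addrACA; congr (_ + _).
  rewrite -[in LHS](opprK (_ * _)) -opprD; congr (- _).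
  have exch (I J : finType) (P : pred J) (f : I -> R) (g : J -> I -> R) :
      \sum_i f i * (\sum_(j | P j) g j i) = \sum_(j | P j) \sum_i f i * g j i.
    by rewrite exchange_big; apply: eq_bigr => i _; rewrite mulr_sumr.
  have -> : \sum_r \sum_s (F^`M(r)^`M(s)).@[ev v] *
         (\sum_l \sum_(m | m != l) w l * w m * x l * x m * (t l m r * t l m s))
     = \sum_l \sum_(m | m != l) \sum_r \sum_s (F^`M(r)^`M(s)).@[ev v] *
         (w l * w m * x l * x m * (t l m r * t l m s)).
    under eq_bigr => r _ do rewrite exch.
    rewrite exchange_big; apply: eq_bigr => l _ /=.
    under eq_bigr => r _ do rewrite exch.
    by rewrite exchange_big.
  rewrite exch; under [X in _ * X]eq_bigr => l _ do rewrite exch.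
  rewrite mulr_sumr -sumrB eval_sum; apply: eq_bigr => l _.
  rewrite mulr_sumr -sumrB eval_sum; apply: eq_bigr => m ml.
  rewrite mulr_sumr -sumrB eval_sum; apply: eq_bigr => r _.
  have lm : l != m by rewrite eq_sym.
  rewrite evalZ evalB eval_diff_K// evalZ evalM evalU eval_specialize (eval_mixes _ vw).
  under eq_bigr => s _ do rewrite -qE.
  rewrite -qE.
  rewrite [RHS]mulrBr; congr (_ - _); last by ring.
  rewrite 3!mulr_sumr /kap.
  apply: eq_bigr => s _; have xlm : x l - x m != 0 by rewrite subr_eq0 (inj_eq xi).
  by field.
rewrite DK KL /L eval_avg ExpD -scaleN1r !ExpZ -[RHS]addr0; congr (_ + _).
rewrite Exp_sum.
pose S := \sum_l \sum_(m | m != l) \sum_r kap l m * t l m r * (a * Exp a ((Xv l + Xv m) * Kr r)).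
have -> : \sum_l Exp a (\sum_(m | m != l) \sum_r
      (kap l m * t l m r) *: (Xv l * Xv m * ((Kr r)^`M(l) - (Kr r)^`M(m)) - (2 * a) *: (Xv l * Kr r)))
   = - S.
  rewrite -sumrN; apply: eq_bigr => l _; rewrite Exp_sum -sumrN; apply: eq_bigr => m _.
  rewrite Exp_sum -sumrN; apply: eq_bigr => r _; rewrite -mulrN ExpZ; congr (_ * _).
  rewrite -scaleNr ExpD ExpZ Exp_by_parts//.
  rewrite mulrBl -[- (Xv m * _)]scaleN1r ExpD ExpZ [(Xv l + _) * _]mulrDl ExpD; ring.
have : S = - S.
  rewrite /S -sumrN.
  transitivity (\sum_l \sum_(m | l != m) \sum_r kap m l * t m l r * (a * Exp a ((Xv m + Xv l) * Kr r))).
    by rewrite (exchange_big_dep xpredT).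
  apply: eq_bigr => l _; rewrite -sumrN; apply: eq_big => [m|m _]; first by rewrite eq_sym.
  rewrite -sumrN; apply: eq_bigr => r _; rewrite /kap /t [_ :\ m :\ l]setD1C [Xv m + _]addrC.
  by rewrite -[x m - x l]opprB invrN; ring.
move=> SS; have : 2 * S = 0 by rewrite mulr_natl mulr2n {2}SS subrr.
by move=> /eqP; rewrite mulf_eq0 pnatr_eq0 /= => /eqP ->; rewrite oppr0 mulr0.
Qed.

End Intertwining.

(** * The eigenvalues nu *)

Section RealRoots.
Variable R : realType.
Local Notation C := (complex R).
Local Notation toC := (@real_complex_def R (Phant R)).

Lemma real_rooted_split (p : {poly R}) : p \is monic ->
  (forall z : C, root (map_poly toC p) z -> complex.Im z = 0) ->
  exists s : seq R, p = \prod_(x <- s) ('X - x%:P).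
Proof.
move=> pm pr; have [s sE] := closed_field_poly_normal (map_poly toC p).
have lc : lead_coef (map_poly toC p) = 1.
  by rewrite lead_coef_map (monicP pm) rmorph1.
exists [seq complex.Re z | z <- s]; apply: (@map_poly_inj _ _ toC).
rewrite sE lc scale1r big_map rmorph_prod /=; apply: eq_big_seq => z zs.
rewrite rmorphB /= map_polyX map_polyC /=; congr ('X - _%:P).
have : complex.Im z = 0 by apply: pr; rewrite sE lc scale1r root_prod_XsubC.
by case: z {zs} => u b /= ->.
Qed.

Variables (I : finType) (x w : I -> R).
Hypotheses (w0 : forall i, 0 < w i).

(** Divided by prod_i (z - x_i) the polynomial is sum_i w_i / (z - x_i); if z has imaginary part b
    <> 0, the imaginary part of this sum is - b sum_i w_i / |z - x_i|^2, which is nonzero. The index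
    [i0] makes the sum nonempty. *)
Lemma mixture_root_real (i0 : I) (z : C) :
  root (map_poly toC (mixture x w)) z -> complex.Im z = 0.
Proof.
move=> /rootP z0; apply/eqP/negPn/negP => b0.
have dz i : z - toC (x i) != 0.
  apply: contraNneq b0 => /eqP; rewrite subr_eq0 => /eqP ->; exact: eqxx.
have E : \sum_i toC (w i) / (z - toC (x i)) = 0.
  pose P : C := \prod_i (z - toC (x i)).
  have P0 : P != 0 by apply/prodf_neq0 => i _.
  apply: (mulfI P0); rewrite mulr0 -[RHS]z0 rmorph_sum horner_sum mulr_sumr.
  apply: eq_bigr => i _.
  rewrite /= map_polyZ hornerZ rmorph_prod horner_prod /= /P (bigD1 i)//=.
  have aK (e f g : C) : e != 0 -> e * f * (g / e) = g * f by move=> e0; field.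
  rewrite aK//; congr (_ * _).
  apply: eq_big => [j|j _]; first by rewrite !inE andbT.
  by rewrite rmorphB /= map_polyX map_polyC /= hornerXsubC.
case: z {z0} b0 dz E => u b /= b0 dz E.
have d0 i : 0 < (u - x i) ^+ 2 + b ^+ 2.
  by rewrite ltr_wpDl ?sqr_ge0// lt0r sqrf_eq0 b0 sqr_ge0.
have vE i : toC (w i) / (Complex u b - toC (x i))
    = Complex (w i * (u - x i) / ((u - x i) ^+ 2 + b ^+ 2)) (- b * (w i / ((u - x i) ^+ 2 + b ^+ 2))).
  apply: (canLR (mulfK (dz i))); have := d0 i; rewrite lt0r => /andP[d0' _].
  by apply/eqP; rewrite eq_complex /=; apply/andP; split; apply/eqP; field.
have ImD : {morph @complex.Im R : y z / y + z} by case=> ? ? [].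
have := congr1 (@complex.Im R) E.
rewrite (big_morph _ ImD (erefl : complex.Im (0 : C) = 0)) (eq_bigr (fun i => - b * (w i / ((u - x i) ^+ 2 + b ^+ 2)))); last first.
  by move=> i _; rewrite vE.
rewrite -mulr_sumr => /eqP; rewrite /= mulf_eq0 oppr_eq0 (negbTE b0) /= gt_eqF//.
rewrite (bigD1 i0)//= ltr_pwDl ?divr_gt0// sumr_ge0// => i _.
by rewrite ltW ?divr_gt0.
Qed.

End RealRoots.

Section EigenvaluesNu.
Variables (R : realType) (n : nat).
Local Notation N := n.+1.
Implicit Types (x w : 'I_N -> R) (lam : 'rV[R]_N) (q : 'cV[R]_N).

Lemma prp_tuple (v : n.-tuple R) :
  prp (tnth v) [set: 'I_n] = \prod_(u <- v) ('X - u%:P).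
Proof. by rewrite big_tuple; apply: eq_bigl => i; rewrite inE. Qed.

Lemma size_prp (I : finType) (x : I -> R) A : size (prp x A) = #|A|.+1.
Proof. by rewrite /prp -big_enum size_prod_XsubC -cardE. Qed.

Lemma mixture_monic x w : \sum_i w i = 1 -> mixture x w \is monic /\ size (mixture x w) = N.
Proof.
move=> w1.
have cE i : #|[set: 'I_N] :\ i| = n.
  by have := cardsD1 i [set: 'I_N]%SET; rewrite inE cardsT card_ord add1n => -[].
have c1 : (mixture x w)`_n = 1.
  rewrite coef_sumR -w1; apply: eq_bigr => i _; rewrite coefZ.
  have := monicP (monic_prod_XsubC (index_enum 'I_N) (mem ([set: 'I_N] :\ i)%SET) x).
  rewrite -/(prp _ _) /lead_coef.
  have -> : (size (prp x ([set: 'I_N] :\ i))).-1 = n by rewrite size_prp cE.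
  by move=> ->; rewrite mulr1.
have sz : size (mixture x w) = N.
  apply/eqP; rewrite eqn_leq; apply/andP; split; last first.
    by rewrite ltnNge; apply/negP => /leq_sizeP /(_ n (leqnn _)); rewrite c1 => /eqP; rewrite oner_eq0.
  apply: (leq_trans (size_sum _ _ _)); apply/bigmax_leqP => i _.
  by rewrite (leq_trans (size_scale_leq _ _))// size_prp cE.
by split => //; rewrite monicE lead_coefE sz c1.
Qed.

Lemma mixture_split x w : (forall i, 0 < w i) -> \sum_i w i = 1 ->
  exists v : n.-tuple R, prp (tnth v) [set: 'I_n] = mixture x w.
Proof.
move=> w0 w1; have [mm ms] := mixture_monic x w1.
have [s sE] := real_rooted_split mm (mixture_root_real w0 ord0).
have ss : size s == n.
  by move: ms; rewrite sE size_prod_XsubC => -[->].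
by exists (Tuple ss); rewrite prp_tuple sE.
Qed.

Lemma det_rank1 (u : 'cV[R]_N) (v : 'rV[R]_N) : \det (1%:M + u *m v) = 1 + (v *m u) ord0 ord0.
Proof.
pose A := block_mx 1%:M (- v) u 1%:M : 'M[R]_(1 + N).
have E1 : A = block_mx 1%:M 0 u 1%:M *m block_mx 1%:M (- v) 0 (1%:M + u *m v).
  rewrite mulmx_block ?mul1mx ?mul0mx ?mulmx1 ?mulmx0 ?addr0 mulmxN.
  by rewrite addrCA addNr addr0.
have E2 : A = block_mx (1%:M + v *m u) (- v) 0 1%:M *m block_mx 1%:M 0 u 1%:M.
  rewrite mulmx_block ?mul1mx ?mul0mx ?mulmx1 ?mulmx0 ?add0r ?addr0 mulNmx.
  by rewrite addrK.
have := congr1 determinant E1; rewrite {1}E2 !det_mulmx !det_ublock !det_lblock !det1 !mulr1 !mul1r.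
by move=> <-; rewrite det_mx11 !mxE eqxx.
Qed.

(** For z different from all lambda_i, z - (1 - q q^T) Lambda is (1 + q v) (z - Lambda) with v_i =
    q_i lambda_i / (z - lambda_i), and the rank one determinant equals z sum_i q_i^2 / (z -
    lambda_i) because 1 = sum_i q_i^2. *)
Lemma char_poly_nu lam q : \sum_i q i ord0 ^+ 2 = 1 ->
  char_poly ((1%:M - q *m q^T) *m diag_mx lam)
  = 'X * mixture (lam ord0) (fun i => q i ord0 ^+ 2).
Proof.
move=> q1; pose x := lam ord0.
(* Multiplication by prod_i (X - lambda_i) disposes of the z equal to some lambda_i: both sides
   vanish there. *)
have P0 : prp x [set: 'I_N] != 0 by rewrite -size_poly_eq0 size_prp.
apply: (mulfI P0); apply: poly_eq_horner => z; rewrite !hornerM hornerX horner_prp.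
have [->|pz] := eqVneq (pr x [set: 'I_N] z) 0; first by rewrite !mul0r.
congr (_ * _).
have zx i : z - x i != 0.
  by move/prodf_neq0 : pz; apply; rewrite inE.
rewrite /char_poly -horner_evalE -det_map_mx map_mxB map_mx_comp map_scalar_mx /= horner_evalE hornerX.
rewrite (_ : map_mx _ (map_mx _ _) = (1%:M - q *m q^T) *m diag_mx lam); last first.
  by apply/matrixP => i j; rewrite !mxE /horner_eval hornerC.
pose v : 'rV[R]_N := \row_i (q i ord0 * x i / (z - x i)).
have -> : z%:M - (1%:M - q *m q^T) *m diag_mx lam
    = (1%:M + q *m v) *m diag_mx (\row_i (z - x i)).
  apply/matrixP => i j; rewrite !mul_mx_diag !mxE !big_ord1 !mxE.
  have -> : lam ord0 j = x j by [].
  case: eqVneq => [->|_]; field; exact: zx.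
rewrite det_mulmx det_rank1 det_diag.
have -> : \prod_i (\row_i (z - x i)) ord0 i = pr x [set: 'I_N] z.
  by apply: eq_big => [i|i _]; rewrite ?inE// mxE.
have -> : 1 + (v *m q) ord0 ord0 = z * \sum_i q i ord0 ^+ 2 / (z - x i).
  rewrite mxE -q1 -big_split mulr_sumr; apply: eq_bigr => i _; rewrite mxE /=.
  by field; exact: zx.
rewrite -mulrA; congr (_ * _); rewrite horner_sumR mulr_suml; apply: eq_bigr => i _.
rewrite hornerZ horner_prp (@prD1 _ _ x [set: 'I_N] i) ?inE//.
by field; exact: zx.
Qed.

Lemma nu_mixture lam q : (forall i, 0 < q i ord0) -> \sum_i q i ord0 ^+ 2 = 1 ->
  prp (tnth (nu lam q)) [set: 'I_n] = mixture (lam ord0) (fun i => q i ord0 ^+ 2).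
Proof.
move=> q0 q1; have [v vE] : exists v : n.-tuple R, prp (tnth v) [set: 'I_n]
      = mixture (lam ord0) (fun i => q i ord0 ^+ 2).
  by apply: mixture_split => // i; rewrite exprn_gt0.
have X0 : 'X != 0 :> {poly R} by rewrite polyX_eq0.
apply: (mulfI X0); rewrite -char_poly_nu//.
have E (u : n.-tuple R) : \prod_(x <- rcons u 0) ('X - x%:P) = 'X * prp (tnth u) [set: 'I_n] :> {poly R}.
  by rewrite big_rcons /= subr0 mulrC prp_tuple.
rewrite -E; have : [set v : n.-tuple R |
    has_eigenvalues ((1%:M - q *m q^T) *m diag_mx lam) (rcons v 0)] v.
  by rewrite /= /has_eigenvalues char_poly_nu// E vE.
by move=> h; apply: esym; exact: (xgetPex [tuple of nseq n 0] (ex_intro _ v h)).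
Qed.

End EigenvaluesNu.

(** * Averages of Jack polynomials *)

Section SupportBounds.
Variables (R : realType) (M k : nat) (h : 'I_k -> 'I_M).
Local Open Scope nat_scope.
Implicit Types (p q : {mpoly R[M]}) (m : multinom M).

(** [h] selects the variables that count: all of them for symmetric polynomials, the x_i among the
    x_i and w_i for [avg]. Only the degree and bounds on sums of j exponents are recorded, since
    both add up in products. *)
Definition bounded_mnm d (b : nat -> nat) m : Prop :=
  \sum_i m (h i) = d /\ forall I : {set 'I_k}, \sum_(i in I) m (h i) <= b #|I|.

Definition bounded_supp d (b : nat -> nat) p : Prop :=
  forall m, m \in msupp p -> bounded_mnm d b m.

Lemma bounded_supp1 : bounded_supp 0 (fun=> 0) 1%R.
Proof.
move=> m; rewrite msupp1 inE => /eqP ->; split => [|I].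
  by rewrite big1// => i _; rewrite mnm0E.
by rewrite big1// => i _; rewrite mnm0E.
Qed.

Lemma bounded_suppM d1 b1 d2 b2 p q : bounded_supp d1 b1 p -> bounded_supp d2 b2 q ->
  bounded_supp (d1 + d2) (fun j => b1 j + b2 j) (p * q)%R.
Proof.
move=> pb qb m /msuppM_le/allpairsP[[m1 m2]/= [/pb[e1 l1] /qb[e2 l2] ->]]; split => [|I].
  by under eq_bigr => i _ do rewrite mnmDE; rewrite big_split /= e1 e2.
by under eq_bigr => i _ do rewrite mnmDE; rewrite big_split /= leq_add.
Qed.

Lemma bounded_suppXn d b p c : bounded_supp d b p ->
  bounded_supp (c * d) (fun j => c * b j) (p ^+ c)%R.
Proof.
move=> pb; elim: c => [|c IHc]; first exact: bounded_supp1.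
by rewrite exprS mulSn; apply: bounded_suppM.
Qed.

Lemma bounded_supp_prod n (d : 'I_n -> nat) b (F : 'I_n -> {mpoly R[M]}) (r : seq 'I_n) :
  (forall i, bounded_supp (d i) (b i) (F i)) ->
  bounded_supp (\sum_(i <- r) d i) (fun j => \sum_(i <- r) b i j) (\prod_(i <- r) F i)%R.
Proof.
move=> Fb; elim: r => [|i r IHr].
  rewrite !big_nil => m /bounded_supp1[e l]; split => [|I]; first by rewrite e.
  by rewrite big_nil.
rewrite !big_cons => m /(bounded_suppM (Fb i) IHr)[e l]; split => [|I]; first by rewrite e.
by rewrite big_cons.
Qed.

Lemma bounded_supp_compX n (lq : n.-tuple {mpoly R[M]}) (a : multinom n) :
  (forall r : 'I_n, bounded_supp r.+1 (minn r.+1) (tnth lq r)) ->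
  bounded_supp (\sum_r a r * r.+1) (fun j => \sum_r a r * minn r.+1 j)
    (comp_mpoly lq (mpolyX R a)).
Proof.
move=> lqb; rewrite comp_mpolyX; apply: bounded_supp_prod => r.
exact: bounded_suppXn.
Qed.

Lemma bounded_supp_sumn d b m : (forall i, m (h i) <= 1) -> \sum_i m (h i) = d ->
  (forall j, b j = minn d j) -> bounded_mnm d b m.
Proof.
move=> m1 md bE; split => // I; rewrite bE leq_min; apply/andP; split.
  by rewrite -md [X in _ <= X](bigID (mem I)) /= leq_addr.
by rewrite -sum1_card; apply: leq_sum => i _.
Qed.

End SupportBounds.

(** * Expansion in elementary symmetric polynomials and dominance *)

Section ElementaryBasis.
Variables (R : realType) (n : nat).
Local Open Scope nat_scope.
Implicit Types (kappa : seq nat) (a : multinom n) (f F : {mpoly R[n]}).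

(* The weights of the monomials e^a: its leading monomial has partial sums
   sum_r a_r min(r, j). *)
Definition dom_weight kappa a : Prop :=
  \sum_r a r * r.+1 = sumn kappa /\
  forall j, \sum_r a r * minn r.+1 j <= sumn (take j kappa).

Lemma bounded_supp_esyms (r : 'I_n) : bounded_supp id r.+1 (minn r.+1) (tnth (esyms R n) r).
Proof.
move=> m; rewrite tnth_mktuple mem_msupp_mesym => /andP[/eqP dm /forallP m1].
apply: bounded_supp_sumn => //.
by rewrite -dm mdegE.
Qed.

Lemma sum_diff_tail (c : nat -> nat) j k : (forall i, c i.+1 <= c i) -> j <= k ->
  \sum_(r < k) (c r - c r.+1) * (j <= r) + c k = c j.
Proof.
move=> dc; elim: k => [|k IHk].
  by rewrite leqn0 => /eqP ->; rewrite big_ord0.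
rewrite leq_eqVlt => /predU1P[->|]; last first.
  rewrite ltnS => jk; rewrite big_ord_recr /= jk muln1 -addnA subnK//; exact: IHk.
by rewrite big1// => r _; rewrite leqNgt ltn_ord muln0.
Qed.

(** c_r - c_(r + 1) is the number of columns of length r + 1 in the diagram with rows c; such a
    column meets the first j rows in min(r + 1, j) cells. *)
Lemma sum_diff_minn (c : nat -> nat) j : (forall i, c i.+1 <= c i) -> c n = 0 -> j <= n ->
  \sum_(r < n) (c r - c r.+1) * minn r.+1 j = \sum_(i < j) c i.
Proof.
move=> dc cn; elim: j => [_|j IHj jn].
  by rewrite big_ord0 big1// => r _; rewrite minn0 muln0.
rewrite big_ord_recr /= -IHj ?(ltnW jn)// -(sum_diff_tail dc (ltnW jn)) cn addn0 -big_split /=.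
apply: eq_bigr => r _; rewrite -mulnDr; congr (_ * _); lia.
Qed.

(** The algorithm of the fundamental theorem: the leading monomial m of f is removed by a multiple
    of e^a, a_r = m_r - m_(r + 1). By [sum_diff_minn] the weights of e^a are the partial sums of m,
    so e^a and hence the remainder stay dominated by kappa. *)
Lemma esym_decomposition kappa f : f \is symmetric (n := n) (R := R) ->
  dom_supp kappa f ->
  exists2 F, f = comp_mpoly (esyms R n) F
    & forall a, a \in msupp F -> dom_weight kappa a.
Proof.
elim/mleadrect: f => f IHf fs fd.
have [->|f0] := eqVneq f 0%R.
  by exists 0%R; rewrite ?comp_mpoly0// => a; rewrite msupp0.
have [] := and3P (symf1P fs).
set F1 := (symf1 f).1; set f2 := (symf1 f).2 => f2lead f2s /eqP fE.
pose m := mlead f; pose c := nth 0 m; pose a := Multinom [tuple c i - c i.+1 | i < n].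
have F1E : F1 = (mcoeff m f *: mpolyX R a)%R.
  by rewrite /F1 /symf1 (negbTE f0).
have aE i : a i = c i - c i.+1 by rewrite multinomE tnth_mktuple.
have cE (i : 'I_n) : c i = m i by rewrite /c -mnm_nth.
have cn i : n <= i -> c i = 0 by move=> ni; rewrite /c nth_default// size_tuple.
have dc i : c i.+1 <= c i.
  have [ni|i_n] := ltnP i.+1 n; last by rewrite cn.
  rewrite (cE (Ordinal ni)) (cE (Ordinal (ltnW ni))).
  exact: (mlead_msym_sorted fs (leqnSn i : Ordinal (ltnW ni) <= Ordinal ni)).
have md : dom_mnm kappa m by apply: fd; apply: mlead_supp.
have wa : dom_weight kappa a.
  split.
    transitivity (\sum_(r < n) (c r - c r.+1) * minn r.+1 n).
      by apply: eq_bigr => r _; rewrite aE (minn_idPl _).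
    rewrite sum_diff_minn ?cn// -(dom_mnm_sumn md) mdegE; apply: eq_bigr => i _; exact: cE.
  move=> j.
  have H i : i <= n -> \sum_(r < n) a r * minn r.+1 i <= sumn (take i kappa).
    move=> i_n; rewrite sumn_take_nth (leq_trans _ (dom_mnm_lead md i_n))//.
    by rewrite -/c -sum_diff_minn ?cn//; apply: leq_sum => r _; rewrite aE.
  have [/H//|nj] := leqP j n.
  apply: (@leq_trans (sumn (take n kappa))); last first.
    by rewrite !sumn_take_nth -!(big_mkord xpredT) (big_cat_nat (leq0n n) (ltnW nj)) /= leq_addr.
  apply: (leq_trans _ (H n (leqnn n))); apply: leq_sum => r _.
  by rewrite leq_mul2l !(minn_idPl _)// ?leqnn ?orbT// (leq_trans (ltn_ord r) (ltnW nj)).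
have f2d : dom_supp kappa f2.
  move=> m2; have -> : f2 = (f - comp_mpoly (esyms R n) F1)%R by rewrite [X in (X - _)%R]fE addrAC subrr add0r.
  move=> /msuppB_le; rewrite mem_cat => /orP[/fd//|].
  rewrite F1E comp_mpolyZ => /msuppZ_le/(bounded_supp_compX bounded_supp_esyms)[e l].
  have [wa1 wa2] := wa; split; first by rewrite mdegE e.
  by move=> I; apply: leq_trans (l I) (wa2 _).
have [F2 f2E F2w] : exists2 F, f2 = comp_mpoly (esyms R n) F
    & forall a, a \in msupp F -> dom_weight kappa a.
  have [f20|f20] := eqVneq f2 0%R.
    by exists 0%R; rewrite ?comp_mpoly0// => b; rewrite msupp0.
  apply: IHf => //; move: f2lead; rewrite (negbTE f20)//.
exists (F1 + F2)%R; first by rewrite {1}fE f2E raddfD.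
move=> b /msuppD_le; rewrite mem_cat => /orP[|/F2w//].
by rewrite F1E => /msuppZ_le; rewrite msuppX inE => /eqP ->.
Qed.

End ElementaryBasis.

Section AverageSupport.
Variables (R : realType) (n : nat) (a : R).
Local Open Scope nat_scope.
Local Notation N := n.+1.

(** The monomials of [mix_mesym] are squarefree in the x_i, with the degree of the elementary
    symmetric polynomial they replace, so e^a keeps its bounds when the e_r become mixtures. This is
    how averaging respects dominance. *)
Lemma bounded_supp_mixes (r : 'I_n) :
  bounded_supp (@lshift N N) r.+1 (minn r.+1) (tnth (mixes R n) r).
Proof.
move=> m; rewrite tnth_mktuple /mix_mesym => /msupp_sum_le/flattenP[s /mapP[i _ ->]].
move=> /msuppM_le/allpairsP[[m1 m2]/= [m1i m2i ->]].
move: m1i; rewrite msuppX inE => /eqP ->.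
move: m2i; rewrite comp_mpolyEX => /msupp_sum_le/flattenP[s' /mapP[m0 m0s ->]].
rewrite filter_predT mem_msupp_mesym in m0s; have /andP[/eqP dm /forallP m1'] := m0s.
move=> /msuppZ_le.
pose e l := oapp m0 0 (unlift i l).
pose mm : multinom (N + N) :=
  Multinom [tuple match fintype.split t with inl l => e l | inr _ => 0 end | t < N + N].
have mmE l : mm (lshift N l) = e l.
  by rewrite multinomE tnth_mktuple; rewrite (unsplitK (inl l : 'I_N + 'I_N)%type).
have mmE' l : mm (rshift N l) = 0.
  by rewrite multinomE tnth_mktuple (unsplitK (inr l : 'I_N + 'I_N)%type).
have -> : comp_mpoly [tuple mpolyX R (mnm1 (lshift N (lift i j))) | j < n] (mpolyX R m0)
    = mpolyX R mm.
  apply: mpoly_eq_eval => v; rewrite eval_comp !evalX big_split_ord /= [X in (_ * X)%R]big1 ?mulr1; last first.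
    by move=> l _; rewrite mmE' expr0.
  rewrite (bigD1_ord i) //= mmE /e unlift_none expr0 mul1r; apply: eq_bigr => j _.
  by rewrite mmE /e liftK tnth_mktuple evalU.
rewrite msuppX inE => /eqP ->.
have lE l : (mnm_add (mnm1 (rshift N i)) mm) (lshift N l) = e l.
  by rewrite mnmDE mnm1E eq_sym lrshift_neq mmE.
apply: bounded_supp_sumn => //.
  by move=> l; rewrite lE /e; case: unlift.
under eq_bigr => l _ do rewrite lE.
rewrite (bigD1_ord i) //= /e unlift_none /= add0n -dm mdegE; apply: eq_bigr => j _.
by rewrite liftK.
Qed.

Lemma avg_dom_supp kappa F : (forall b, b \in msupp F -> dom_weight kappa b) ->
  dom_supp kappa (avg a (comp_mpoly (mixes R n) F)).
Proof.
move=> Fw m' /msupp_avg[m + <-].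
rewrite comp_mpolyEX => /msupp_sum_le/flattenP[s /mapP[b +] ->].
rewrite filter_predT => /Fw[w1 w2].
move=> /msuppZ_le/(bounded_supp_compX bounded_supp_mixes)[e l].
split; first by rewrite mdegE -w1 -e; apply: eq_bigr => i _; rewrite lpartE.
move=> I; apply: leq_trans (w2 _); apply: leq_trans (l I).
by apply: leq_sum => i _; rewrite lpartE.
Qed.

End AverageSupport.

Section SymmetricEvaluation.
Variables (R : realType) (n : nat).
Implicit Types (p : {mpoly R[n]}) (x : 'I_n -> R) (s : {perm 'I_n}).

Lemma eval_msym s p x : (msym s p).@[x] = p.@[fun i => x (s i)].
Proof.
elim/mpoly_lin_ind: p => [|c p q IHp IHq|m].
- by rewrite raddf0 !meval0.
- by rewrite raddfD /= msymZ !evalD !evalZ IHp IHq.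
- rewrite msymX !evalX (reindex_inj (@perm_inj _ s)) /=; apply: eq_bigr => i _.
  by rewrite multinomE tnth_mktuple permK.
Qed.

Lemma symmetricP p : (forall s x, p.@[fun i => x (s i)] = p.@[x]) <->
  p \is symmetric (n := n) (R := R).
Proof.
split=> [ps|/issymP ps s x]; last by rewrite -eval_msym ps.
by apply/issymP => s; apply: mpoly_eq_eval => x; rewrite eval_msym ps.
Qed.

Lemma euler_dom_supp kappa p x : dom_supp kappa p ->
  \sum_i x i * p^`M(i).@[x] = (sumn kappa)%:R * p.@[x].
Proof.
move=> pd; have : \sum_i mpolyX R (mnm1 i) * p^`M(i) = (sumn kappa)%:R *: p.
  apply/mpolyP => m; rewrite mcoef_sum mcoefZ.
  under eq_bigr => i _ do rewrite mcoeff_euler.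
  rewrite -mulr_suml -natr_sum -mdegE.
  have [/pd/dom_mnm_sumn ->//|mp] := boolP (m \in msupp p).
  by rewrite (memN_msupp_eq0 mp) !mulr0.
move=> /(congr1 (meval x)); rewrite evalZ eval_sum => <-.
by apply: eq_bigr => i _; rewrite evalM evalU.
Qed.

End SymmetricEvaluation.

Section AverageSymmetric.
Variables (R : realType) (n : nat) (a : R).
Local Notation N := n.+1.
Implicit Types (x w : 'I_N -> R) (s : {perm 'I_N}).

Lemma Exp_msym s (K : {mpoly R[N]}) : Exp a (msym s K) = Exp a K.
Proof.
elim/mpoly_lin_ind: K => [|c p q IHp IHq|m].
- by rewrite raddf0.
- by rewrite raddfD /= msymZ !ExpD !ExpZ IHp IHq.
rewrite msymX /Exp !mlinX /dirichlet_moment.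
congr (_ / (_ * Gamma _)); rewrite [LHS](reindex_inj (@perm_inj _ s)) /=; apply: eq_bigr => i _;
  by rewrite multinomE tnth_mktuple permK.
Qed.

Lemma avg_symmetric (H : {mpoly R[(N + N)]}) :
  (forall s x w, H.@[join (fun i => x (s i)) (fun i => w (s i))] = H.@[join x w]) ->
  avg a H \is symmetric (n := N) (R := R).
Proof.
move=> Hs; apply/symmetricP => s x; rewrite !eval_avg -[RHS](Exp_msym s^-1%g).
congr (Exp a _); apply: mpoly_eq_eval => w.
rewrite eval_msym !eval_specialize -(Hs s x); congr (meval _ H).
by apply: funext => t; rewrite /join; case: fintype.split => i //; rewrite permK.
Qed.

Lemma mixture_perm s x w :
  mixture (fun i => x (s i)) (fun i => w (s i)) = mixture x w.
Proof.
rewrite /mixture [RHS](reindex_inj (@perm_inj _ s)) /=; apply: eq_bigr => l _.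
congr (_ *: _); rewrite /prp [RHS](reindex_inj (@perm_inj _ s)) /=; apply: eq_bigl => j.
by rewrite !inE (inj_eq (@perm_inj _ s)).
Qed.

Lemma avg_mixes_symmetric F :
  avg a (comp_mpoly (mixes R n) F) \is symmetric (n := N) (R := R).
Proof.
apply: avg_symmetric => s x w; rewrite !eval_comp; apply: meval_eq => r.
by rewrite tnth_mktuple !eval_mix_mesym// mixture_perm.
Qed.

End AverageSymmetric.

Section AverageJack.
Variables (R : realType) (n : nat) (beta : R).
Hypothesis beta0 : 0 < beta.

(** In n variables [Dstar] plus beta times the Euler operator has the eigenvalue rho + beta k (n -
    1) + beta k, which is the one of kappa in n + 1 variables. F is part of the conclusion because
    the average is formed from it. *)
Lemma jack_average kappa (f : {mpoly R[n]}) (g : {mpoly R[n.+1]}) :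
  is_part kappa -> (size kappa <= n)%N ->
  is_jack beta kappa f -> is_jack beta kappa g ->
  exists2 F, f = comp_mpoly (esyms R n) F &
    exists c, avg (beta / 2) (comp_mpoly (mixes R n) F) = c *: g.
Proof.
move=> kp kn jf jg.
have [F fE Fw] := esym_decomposition (jack_sym jf) (jack_dom jf).
exists F => //; eexists; apply: (jack_unique beta0 kp (leqW kn) jg).
- exact: avg_mixes_symmetric.
- exact: avg_dom_supp.
move=> x xi; have b2 : beta = 2 * (beta / 2) by field.
rewrite {1}b2; apply: avg_eigen => //; first by rewrite divr_gt0.
  by move=> w w0 w1; have [v vE] := mixture_split x w0 w1; exists (tnth v).
rewrite -b2; apply: eigen_esyms => v vi; rewrite -fE.
rewrite (jack_eigen jf vi) (euler_dom_supp _ (jack_dom jf)) /jack_eigenvalue mulrA -mulrDl.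
congr (_ * _); rewrite -addrA; congr (_ + _); rewrite -natr1; ring.
Qed.

Lemma eval_mixes_nu (F : {mpoly R[n]}) (lam : 'rV[R]_n.+1) (q : 'cV[R]_n.+1) :
  (forall i, 0 < q i ord0) -> \sum_i q i ord0 ^+ 2 = 1 ->
  (comp_mpoly (esyms R n) F).@[tnth (nu lam q)]
  = (specialize (lam ord0) (comp_mpoly (mixes R n) F)).@[fun i => q i ord0 ^+ 2].
Proof.
move=> q0 q1; rewrite eval_specialize !eval_comp; apply: meval_eq => r.
by rewrite !tnth_mktuple mesym_coef// eval_mix_mesym// nu_mixture.
Qed.

Lemma sphere_integral_symmetric (F : {mpoly R[n]}) (lam : 'rV[R]_n.+1) :
  pos_sphere_integral (fun q => (\prod_i q i ord0 `^ (beta - 1))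
     * (comp_mpoly (esyms R n) F).@[tnth (nu lam q)])
  = ((avg (beta / 2) (comp_mpoly (mixes R n) F)).@[lam ord0])%:E.
Proof.
rewrite eval_avg -(integral_sphere_poly _ beta0).
apply: eq_pos_sphere_integral => q q0 q1; congr (_ * _).
exact: eval_mixes_nu.
Qed.

End AverageJack.

(** * Column removal and normalization *)

Section StrippedParts.
Local Open Scope nat_scope.
Implicit Types (kappa s : seq nat).

Definition remove_column kappa := strip (map predn kappa).

Lemma nth_strip s i : sorted geq s -> nth 0 (strip s) i = nth 0 s i.
Proof.
move=> ss; rewrite [in RHS](sorted_strip ss) nth_cat nth_nseq.
by case: ltnP => [//|si]; rewrite nth_default//; case: ifP.
Qed.

Lemma sorted_predn kappa : sorted geq kappa -> sorted geq (map predn kappa).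
Proof. by apply: homo_sorted => a b /=; lia. Qed.

Lemma nth_remove_column kappa i : is_part kappa ->
  nth 0 (remove_column kappa) i = (nth 0 kappa i).-1.
Proof.
move=> /andP[ks _]; rewrite nth_strip ?sorted_predn//.
have [ik|ki] := ltnP i (size kappa); first by rewrite (nth_map 0).
by rewrite !nth_default ?size_map.
Qed.

Lemma is_part_remove_column kappa : is_part kappa -> is_part (remove_column kappa).
Proof.
move=> /andP[ks _]; rewrite /is_part mem_filter eqxx andbT.
by apply: sorted_filter (sorted_predn ks) => a b c /= ab bc; exact: leq_trans bc ab.
Qed.

Lemma size_remove_column kappa : size (remove_column kappa) <= size kappa.
Proof. by rewrite size_filter (leq_trans (count_size _ _))// size_map. Qed.

Lemma part_gt0 kappa i : is_part kappa -> i < size kappa -> 0 < nth 0 kappa i.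
Proof.
move=> /andP[_ k0] ik; rewrite lt0n; apply: contra k0 => /eqP <-.
exact: mem_nth.
Qed.

Lemma sumn_remove_column kappa : is_part kappa ->
  sumn kappa = sumn (remove_column kappa) + size kappa.
Proof.
move=> /andP[_ k0]; rewrite sumn_strip.
elim: kappa k0 => //= x s IHs; rewrite inE negb_or => /andP[x0 /IHs ->]; lia.
Qed.

Lemma count_remove_column kappa j :
  conj_part (remove_column kappa) j.+1 = conj_part kappa j.+2.
Proof.
rewrite /conj_part; elim: kappa => //= x s IHs.
rewrite /remove_column /= -/(remove_column s); case: eqP => [x0|x0] /=; rewrite IHs; lia.
Qed.

End StrippedParts.

Section Hooks.
Variables (R : realType) (beta : R).

Lemma hooks_widen kappa n : (size kappa <= n)%N ->
  hooks beta kappa = \prod_(0 <= i < n) \prod_(0 <= j < nth 0%N kappa i)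
    (2 / beta * (nth 0%N kappa i - j.+1)%N%:R
       + (conj_part kappa j.+1 - i.+1)%N%:R + 1).
Proof.
move=> kn; rewrite (@big_cat_nat _ _ _ (size kappa))//= [X in _ = _ * X](_ : _ = 1) ?mulr1//.
by rewrite big_nat big1// => i /andP[ki _]; rewrite nth_default// big_geq.
Qed.

(** Arms and legs of the cells outside the first column are those of the diagram without that
    column. The first cell of row i has arm kappa_i - 1 and leg size kappa - i - 1, with i counted
    from 0, which yields the extra product. *)
Lemma hooks_remove_column kappa : is_part kappa ->
  hooks beta kappa = hooks beta (remove_column kappa)
    * \prod_(i < size kappa) ((size kappa - i)%N%:R + 2 / beta * ((nth 0%N kappa i)%:R - 1)).
Proof.
move=> kp; rewrite (hooks_widen (size_remove_column kappa)) {1}/hooks !big_mkord -big_split /=.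
apply: eq_bigr => i _; have ki := part_gt0 kp (ltn_ord i).
rewrite nth_remove_column//; case E: (nth 0%N kappa i) ki => [//|k] _ /=.
rewrite big_nat_recl//= mulrC; congr (_ * _).
  by apply: eq_bigr => j _; rewrite count_remove_column subSS.
have -> : conj_part kappa 1 = size kappa.
  have /andP[_ k0] := kp; apply/eqP; rewrite -all_count; apply/allP => x xk.
  by rewrite lt0n; apply: contraNneq k0 => <-.
rewrite subn1 /= -(natr1 k) addrK -addrA addrC; congr (_ + _).
by rewrite natr1 subnSK.
Qed.

Lemma hooks_nil : hooks beta [::] = 1.
Proof. by rewrite /hooks big_geq. Qed.

Lemma hooks1 k : hooks beta [:: k] = \prod_(1 <= j < k) (1 + j%:R * (2 / beta)).
Proof.
rewrite /hooks big_nat1 /=; case: k => [|k]; first by rewrite !big_geq.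
rewrite big_nat_recr//= big_add1 /= big_nat_rev /= subnn mulr0 add0r.
rewrite [X in _ * X](_ : _ = 1) ?mulr1; last by rewrite /conj_part /= leqnn subnn add0r.
rewrite !big_nat; apply: eq_bigr => j /andP[_ jk].
rewrite /conj_part /= (_ : (_ <= k.+1)%N = true); last by lia.
by rewrite subnn addr0 addrC mulrC; congr (_ + _%:R * _); lia.
Qed.

End Hooks.

Section ColumnRemoval.
Variables (R : realType) (n : nat) (beta : R).
Hypothesis beta0 : 0 < beta.
Implicit Types (kappa : seq nat) (x : 'I_n -> R).

Definition all_ones : multinom n := Multinom [tuple 1%N | _ < n].

Lemma all_onesE i : all_ones i = 1%N.
Proof. by rewrite multinomE tnth_mktuple. Qed.

Local Notation E := (mpolyX R all_ones).

Lemma eval_all_ones x : E.@[x] = \prod_i x i.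
Proof. by rewrite evalX; apply: eq_bigr => i _; rewrite all_onesE expr1. Qed.

Lemma euler_all_ones i : mpolyX R (mnm1 i) * E^`M(i) = E.
Proof.
apply/mpolyP => m; rewrite mcoeff_euler mcoeffX; case: eqP => [<-|_]; last by rewrite mulr0.
by rewrite all_onesE mulr1.
Qed.

Lemma sum_pairs x : injective x ->
  \sum_i \sum_(j | j != i) x i / (x i - x j) = n%:R * (n%:R - 1) / 2.
Proof.
move=> xi; set S := LHS.
have : S + S = n%:R * (n%:R - 1).
  rewrite {2}/S (exchange_big_dep xpredT) //= -big_split /=.
  transitivity (\sum_(i < n) (n%:R - 1 : R)); last by rewrite sumr_const card_ord -[LHS]mulr_natl.
  apply: eq_bigr => i _.
  transitivity (\sum_(j | j != i) (1 : R)).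
    rewrite [X in _ + X](eq_bigl (fun j => j != i)); last by move=> j; rewrite eq_sym.
    rewrite -big_split /=; apply: eq_bigr => j ji.
    by field; rewrite !subr_eq0 !(inj_eq xi) ji eq_sym ji.
  rewrite sumr_const -[LHS]mulr_natl mulr1.
  have := cardC1 i; rewrite card_ord => ->.
  by rewrite -subn1 natrB// (leq_ltn_trans _ (ltn_ord i)).
by move=> SE; rewrite -SE; field.
Qed.

(** x_i d/dx_i fixes the product E of the variables, and E is affine in each of them; the cross
    terms give the Euler operator twice, the first order terms the constant of [sum_pairs]. *)
Lemma Dstar_all_ones g x : injective x ->
  Dstar beta (E * g) x
  = E.@[x] * (Dstar beta g x + 2 * \sum_i x i * g^`M(i).@[x]
              + beta * (n%:R * (n%:R - 1) / 2) * g.@[x]).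
Proof.
move=> xi; have e1 i : x i * E^`M(i).@[x] = E.@[x].
  by rewrite -[in RHS](euler_all_ones i) evalM evalU.
have e2 i : x i ^+ 2 * E^`M(i)^`M(i).@[x] = 0.
  have := congr1 (meval x) (euler2 i E); rewrite !euler_all_ones subrr meval0.
  by rewrite evalM evalXn evalU.
rewrite -(sum_pairs xi) /Dstar.
have -> : \sum_i x i ^+ 2 * (E * g)^`M(i)^`M(i).@[x]
    = E.@[x] * (\sum_i x i ^+ 2 * g^`M(i)^`M(i).@[x] + 2 * \sum_i x i * g^`M(i).@[x]).
  rewrite mulr_sumr -big_split mulr_sumr; apply: eq_bigr => i _ /=.
  rewrite derM derD !derM !evalD !evalM.
  transitivity (x i ^+ 2 * E^`M(i)^`M(i).@[x] * g.@[x]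
     + 2 * (x i * E^`M(i).@[x]) * x i * g^`M(i).@[x] + E.@[x] * (x i ^+ 2 * g^`M(i)^`M(i).@[x])).
    by ring.
  by rewrite e2 e1; ring.
have -> : \sum_i \sum_(j | j != i) x i ^+ 2 / (x i - x j) * (E * g)^`M(i).@[x]
    = E.@[x] * (\sum_i \sum_(j | j != i) x i ^+ 2 / (x i - x j) * g^`M(i).@[x]
       + \sum_i \sum_(j | j != i) x i / (x i - x j) * g.@[x]).
  rewrite -big_split mulr_sumr; apply: eq_bigr => i _ /=.
  rewrite -big_split mulr_sumr; apply: eq_bigr => j _ /=.
  rewrite derM evalD !evalM.
  transitivity (x i / (x i - x j) * (x i * E^`M(i).@[x]) * g.@[x]
     + E.@[x] * (x i ^+ 2 / (x i - x j) * g^`M(i).@[x])); first by ring.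
  by rewrite e1; ring.
have -> : \sum_i \sum_(j | j != i) x i / (x i - x j) * g.@[x]
    = (\sum_i \sum_(j | j != i) x i / (x i - x j)) * g.@[x].
  by rewrite mulr_suml; apply: eq_bigr => i _; rewrite mulr_suml.
by ring.
Qed.

(** Adding 1 to all n exponents raises the bound for j of them by j, which gives dominance by kappa.
    The coefficient of kappa in E g is that of the shortened partition in g. *)
Lemma column_removal kappa (p g : {mpoly R[n]}) :
  is_part kappa -> size kappa = n -> is_jack beta kappa p -> is_jack beta (remove_column kappa) g ->
  E * g = (mcoeff (expo n (remove_column kappa)) g / mcoeff (expo n kappa) p) *: p.
Proof.
move=> kp kn jp jg.
have expoE' : expo n kappa = mnm_add all_ones (expo n (remove_column kappa)).
  apply/mnmP => i; rewrite mnmDE all_onesE !expoE nth_remove_column// add1n prednK//.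
  by rewrite part_gt0// kn.
have -> : mcoeff (expo n (remove_column kappa)) g = mcoeff (expo n kappa) (E * g).
  by rewrite expoE' mulrC mcoeffMX.
apply: (jack_unique beta0) => //; first by rewrite kn.
- have /symmetricP gs := jack_sym jg.
  apply/symmetricP => s x; rewrite !evalM gs !eval_all_ones; congr (_ * _).
  by rewrite [RHS](reindex_inj (@perm_inj _ s)).
- move=> m /msuppM_le/allpairsP[[m1 m2]/= []].
  rewrite msuppX inE => /eqP -> /(jack_dom jg)[d l] ->; split.
    rewrite mdegD d (sumn_remove_column kp) kn addnC; congr (_ + _)%N.
    by rewrite mdegE (eq_bigr (fun=> 1%N)) ?sum1_card ?card_ord// => i _; rewrite all_onesE.
  move=> I; under eq_bigr => i _ do rewrite mnmDE all_onesE add1n -addn1.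
  rewrite big_split /= sum1_card.
  have In : (#|I| <= n)%N by rewrite -[X in (_ <= X)%N](card_ord n) max_card.
  apply: leq_trans (_ : sumn (take #|I| (remove_column kappa)) + #|I| <= _)%N.
    by rewrite leq_add2r; apply: l.
  have cI : #|I| = (\sum_(i < #|I|) 1)%N by rewrite sum1_card card_ord.
  rewrite !sumn_take_nth [X in (_ + X <= _)%N]cI -big_split /=.
  apply: leq_sum => i _; rewrite nth_remove_column// addn1 prednK// part_gt0// kn.
  by rewrite (leq_trans (ltn_ord i)).
- move=> x xi; rewrite Dstar_all_ones// (jack_eigen jg xi) (euler_dom_supp _ (jack_dom jg)) evalM.
  rewrite -/(jack_eigenvalue beta n _).
  rewrite mulrA -!mulrDl [RHS]mulrCA; congr (_ * (_ * _)).
  have kn' : (size (remove_column kappa) <= n)%N by rewrite -kn size_remove_column.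
  rewrite !jack_eigenvalueE ?kn// (_ : sumn (remove_column kappa) = \sum_(i < n) nth 0%N (remove_column kappa) i)%N; last first.
    by rewrite -sumn_take_nth take_oversize.
  have sE : n%:R * (n%:R - 1) / 2 = \sum_(i < n) (n - i.+1)%:R :> R.
    rewrite (reindex_inj rev_ord_inj) /= (eq_bigr (fun i : 'I_n => i%:R)); last first.
      by move=> i _; rewrite subnSK ?subKn// ltnW.
    elim: n {kn kp jp jg p g expoE' x xi kn'} => [|m IHm]; first by rewrite big_ord0; ring.
    by rewrite big_ord_recr /= -IHm -natr1; field.
  rewrite sE natr_sum !mulr_sumr -!big_split; apply: eq_bigr => i _ /=.
  have -> : nth 0%N kappa i = (nth 0%N (remove_column kappa) i).+1.
    by rewrite nth_remove_column// prednK// part_gt0// kn.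
  by rewrite -(natr1 (nth 0%N (remove_column kappa) i)); ring.
Qed.

End ColumnRemoval.

Section LineEvaluation.
Variables (R : realType) (n : nat) (x : 'I_n -> R).
Implicit Types p : {mpoly R[n]}.

Definition line p : {poly R} :=
  \sum_(m <- msupp p) mcoeff m p *: \prod_i ('X + (x i)%:P) ^+ m i.

Lemma horner_line p t : (line p).[t] = p.@[fun i => x i + t].
Proof.
rewrite /line horner_sumR mevalE; apply: eq_bigr => m _.
rewrite hornerZ horner_prod; congr (_ * _); apply: eq_bigr => i _.
by rewrite horner_exp hornerD hornerX hornerC addrC.
Qed.

End LineEvaluation.

(* Along the direction (1, ..., 1) the differences x_i - x_j are constant, so
   that the eigenvalue equation becomes polynomial. *)
Lemma Dstar_eigen_nonzero (R : realType) n (beta e : R) (p : {mpoly R[n]}) :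
  (forall x : 'I_n -> R, injective x -> (forall i, x i != 0) -> Dstar beta p x = e * p.@[x]) ->
  forall x : 'I_n -> R, injective x -> Dstar beta p x = e * p.@[x].
Proof.
move=> pe x xi.
pose s i : {poly R} := 'X + (x i)%:P.
have sE i t : (s i).[t] = x i + t by rewrite hornerD hornerX hornerC addrC.
pose P : {poly R} := \sum_i s i ^+ 2 * line x p^`M(i)^`M(i)
  + beta *: \sum_i \sum_(j | j != i) (x i - x j)^-1 *: (s i ^+ 2 * line x p^`M(i)) - e *: line x p.
have PE t : P.[t] = Dstar beta p (fun i => x i + t) - e * p.@[fun i => x i + t].
  rewrite !(hornerD, hornerN, hornerZ) horner_line; congr (_ + _ - _).
    by rewrite horner_sumR; apply: eq_bigr => i _; rewrite hornerM horner_exp sE horner_line.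
  rewrite horner_sumR; congr (_ * _); apply: eq_bigr => i _.
  rewrite horner_sumR; apply: eq_bigr => j _; rewrite hornerZ hornerM horner_exp sE horner_line.
  by rewrite mulrA [_^-1 * _]mulrC; congr (_ / _ * _); ring.
(* The factor vanishes exactly at those t for which some coordinate x_i + t is 0; elsewhere the
   hypothesis applies. *)
have P0 : P * \prod_i s i = 0.
  apply: poly_eq_horner => t; rewrite hornerM horner0.
  have [/eqP->|tn0] := boolP ((\prod_i s i).[t] == 0); first by rewrite mulr0.
  rewrite PE pe ?subrr ?mul0r//; first by move=> i j /addIr/xi.
  move: tn0; rewrite horner_prod => /prodf_neq0 tn0 i.
  by rewrite -sE; apply: tn0.
have {}P0 : P = 0.
  move/eqP: P0; rewrite mulf_eq0 => /orP[/eqP//|/prodf_eq0[i _ /eqP si]].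
  by have := congr1 (fun q : {poly R} => q.[1 - x i]) si; rewrite sE horner0 addrC subrK => /eqP; rewrite oner_eq0.
have := PE 0; rewrite P0 horner0 => /eqP; rewrite eq_sym subr_eq0 => /eqP.
by rewrite (_ : (fun i => x i + 0) = x)//; apply: funext => i; rewrite addr0.
Qed.

(** * Setting the last variable to 0 *)

Section Restriction.
Variables (R : realType) (n : nat).
Implicit Types (p : {mpoly R[n.+1]}) (x : 'I_n -> R) (j : 'I_n) (i : 'I_n.+1) (m : multinom n).

Definition extend x i : R := oapp x 0 (unlift ord_max i).

Definition extend_mnm m : multinom n.+1 :=
  Multinom [tuple oapp m 0%N (unlift ord_max i) | i < n.+1].

Definition restriction p : {mpoly R[n]} :=
  comp_mpoly [tuple oapp (fun j => mpolyX R (mnm1 j)) 0 (unlift ord_max i) | i < n.+1] p.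

Lemma extend_lift x j : extend x (lift ord_max j) = x j.
Proof. by rewrite /extend liftK. Qed.

Lemma extend_max x : extend x ord_max = 0.
Proof. by rewrite /extend unlift_none. Qed.

Lemma extend_mnm_lift m j : extend_mnm m (lift ord_max j) = m j.
Proof. by rewrite multinomE tnth_mktuple liftK. Qed.

Lemma extend_mnm_max m : extend_mnm m ord_max = 0%N.
Proof. by rewrite multinomE tnth_mktuple unlift_none. Qed.

Lemma extend_mnm_expo kappa : (size kappa <= n)%N ->
  extend_mnm (expo n kappa) = expo n.+1 kappa.
Proof.
move=> kn; apply/mnmP => i; rewrite expoE; case: (unliftP ord_max i) => [j|] ->.
  by rewrite extend_mnm_lift expoE lift_max.
by rewrite extend_mnm_max nth_default.
Qed.

Lemma eval_restriction p x : (restriction p).@[x] = p.@[extend x].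
Proof.
rewrite eval_comp; apply: meval_eq => i; rewrite tnth_mktuple /extend.
by case: unlift => [j|] /=; rewrite ?evalU ?meval0.
Qed.

Lemma restriction_comb c p q : restriction (c *: p + q) = c *: restriction p + restriction q.
Proof. by apply: mpoly_eq_eval => x; rewrite evalD evalZ !eval_restriction evalD evalZ. Qed.

Lemma restriction_der p j : (restriction p)^`M(j) = restriction (p^`M(lift ord_max j)).
Proof.
apply: mpoly_eq_eval => x; rewrite chain_rule_eval (bigD1_ord ord_max)//=.
rewrite tnth_mktuple unlift_none /= mderiv0 meval0 mulr0 add0r (bigD1 j)//=.
rewrite tnth_mktuple liftK /= derU eqxx meval1 mulr1 big1 ?addr0.
  by rewrite -eval_comp.
by move=> k kj; rewrite tnth_mktuple liftK /= derU (negbTE kj) meval0 mulr0.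
Qed.

Lemma mcoeff_restriction p m : mcoeff m (restriction p) = mcoeff (extend_mnm m) p.
Proof.
elim/mpoly_lin_ind: p m => [|c p q IHp IHq|m'] m.
- by rewrite /restriction comp_mpoly0 !mcoeff0.
- by rewrite restriction_comb !mcoefD !mcoefZ IHp IHq.
pose low := Multinom [tuple m' (lift ord_max j) | j < n].
have lowE j : low j = m' (lift ord_max j) by rewrite multinomE tnth_mktuple.
have -> : restriction (mpolyX R m') = (m' ord_max == 0%N)%:R *: mpolyX R low.
  apply: mpoly_eq_eval => x; rewrite eval_restriction evalZ !evalX (bigD1_ord ord_max)//= extend_max.
  rewrite expr0n; congr (_ * _); apply: eq_bigr => j _.
  by rewrite extend_lift lowE.
rewrite mcoefZ !mcoeffX -natrM mulnb; congr (_%:R); congr (nat_of_bool _).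
apply/andP/eqP => [[/eqP m0 /eqP lm]|m'E]; last first.
  by rewrite m'E extend_mnm_max; split=> //; apply/eqP/mnmP => j; rewrite lowE m'E extend_mnm_lift.
apply/mnmP => i; case: (unliftP ord_max i) => [j|] ->; last by rewrite extend_mnm_max.
by rewrite extend_mnm_lift -lm lowE.
Qed.

Lemma restriction_symmetric p : p \is symmetric (n := n.+1) (R := R) ->
  restriction p \is symmetric (n := n) (R := R).
Proof.
move=> /symmetricP ps; apply/symmetricP => s x.
rewrite !eval_restriction -[RHS](ps (lift_perm ord_max ord_max s)); apply: meval_eq => i.
case: (unliftP ord_max i) => [j|] ->.
  by rewrite lift_perm_lift !extend_lift.
by rewrite lift_perm_id !extend_max.
Qed.

Lemma mdeg_extend m : mdeg (extend_mnm m) = mdeg m.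
Proof.
rewrite !mdegE (bigD1_ord ord_max)//= extend_mnm_max add0n.
by apply: eq_bigr => j _; rewrite extend_mnm_lift.
Qed.

Lemma restriction_dom_supp kappa p : dom_supp kappa p -> dom_supp kappa (restriction p).
Proof.
move=> pd m; rewrite mcoeff_msupp mcoeff_restriction -mcoeff_msupp => /pd[d l].
split=> [|I]; first by rewrite -mdeg_extend.
have := l [set lift ord_max j | j in I]%SET; rewrite card_imset; last exact: lift_inj.
rewrite big_imset /=; last by move=> a b _ _ /lift_inj.
by under eq_bigr => j _ do rewrite extend_mnm_lift.
Qed.

(** An exponent in n variables would put the whole degree |kappa| on n positions, while kappa_1 +
    ... + kappa_n < |kappa|. *)
Lemma restriction_dom_supp0 kappa p : is_part kappa -> size kappa = n.+1 -> dom_supp kappa p ->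
  restriction p = 0.
Proof.
move=> kp kn pd; apply/mpolyP => m; rewrite mcoeff0 mcoeff_restriction; apply/eqP/negPn/negP.
rewrite -mcoeff_msupp => /pd[d l].
have := l [set lift ord_max j | j in [set: 'I_n]]%SET; rewrite card_imset; last exact: lift_inj.
rewrite big_imset /=; last by move=> a b _ _ /lift_inj.
have -> : (\sum_(j in [set: 'I_n]%SET) extend_mnm m (lift ord_max j))%N = sumn kappa.
  rewrite -d mdeg_extend mdegE; apply: eq_big => [j|j _]; first by rewrite inE.
  by rewrite extend_mnm_lift.
rewrite cardsT card_ord -[X in sumn X](cat_take_drop n) sumn_cat -[X in (_ <= X)%N]addn0 leq_add2l.
rewrite leqn0 => /eqP E.
have nk : (n < size kappa)%N by rewrite kn.
have := part_gt0 kp nk; rewrite (drop_nth 0%N nk) /= in E.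
by move: E; lia.
Qed.

(** Pairing x_j with the new variable 0 contributes x_j^2 / (x_j - 0) = x_j, hence the Euler
    operator, which accounts for the change of eigenvalue from n + 1 to n variables. Derivatives in
    the new variable carry the factor 0. *)
Lemma restriction_Dstar beta p x : injective x -> (forall j, x j != 0) ->
  Dstar beta p (extend x)
  = Dstar beta (restriction p) x + beta * \sum_j x j * (restriction p)^`M(j).@[x].
Proof.
move=> xi x0.
rewrite /Dstar (bigD1_ord ord_max)//= extend_max expr0n mul0r add0r -addrA; congr (_ + _).
  by apply: eq_bigr => j _; rewrite extend_lift !restriction_der eval_restriction.
rewrite -mulrDr; congr (_ * _); rewrite (bigD1_ord ord_max)//= [X in X + _]big1 ?add0r; last first.
  by move=> j _; rewrite extend_max expr0n /= !mul0r.
rewrite -big_split; apply: eq_bigr => j _ /=.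
rewrite (bigD1_ord ord_max)//= ?neq_lift// addrC extend_max !extend_lift subr0; congr (_ + _).
  apply: eq_big => [k|k _]; first by rewrite (inj_eq (@lift_inj _ _)).
  by rewrite extend_lift restriction_der eval_restriction.
by rewrite restriction_der eval_restriction expr2 mulfK.
Qed.

End Restriction.

Section Independence.
Variables (R : realType) (n k : nat).
Implicit Types (kappa : seq nat).

Lemma expo_inj kappa mu : is_part kappa -> is_part mu -> (size kappa <= n)%N -> (size mu <= n)%N ->
  expo n kappa = expo n mu -> kappa = mu.
Proof.
by move=> kp mp kn mn E; rewrite -(strip_expo kp kn) E strip_expo.
Qed.

(** An integer that increases strictly along dominance, on which to run an induction. *)
Definition partial_sums kappa : nat := (\sum_(j < n.+1) \sum_(i < j) nth 0 kappa i)%N.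

Lemma dom_partial_sums kappa mu : is_part kappa -> is_part mu ->
  (size kappa <= n)%N -> (size mu <= n)%N -> mu != kappa -> dom_mnm mu (expo n kappa) ->
  (partial_sums kappa < partial_sums mu)%N.
Proof.
move=> kp mp kn mn mk dm.
have le j : (j <= n)%N -> (\sum_(i < j) nth 0 kappa i <= \sum_(i < j) nth 0 mu i)%N.
  move=> jn; have := dom_mnm_lead dm jn; apply: leq_trans; apply: leq_sum => i _.
  have i_n : (i < n)%N := leq_trans (ltn_ord i) jn.
  have <- : expo n kappa (Ordinal i_n) = nth 0%N (expo n kappa) i by exact: mnm_nth.
  by rewrite expoE.
have [j jlt] : exists j : 'I_n.+1, (\sum_(i < j) nth 0 kappa i < \sum_(i < j) nth 0 mu i)%N.
  apply: contrapT => /forallNP H; case/eqP: mk; apply: expo_inj => //.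
  have E j : (j <= n)%N -> (\sum_(i < j) nth 0 kappa i = \sum_(i < j) nth 0 mu i)%N.
    move=> jn; apply/eqP; rewrite eqn_leq le//= leqNgt; apply/negP.
    exact: (H (Ordinal (jn : j < n.+1)%N)).
  apply/mnmP => i; rewrite !expoE; have := E i.+1 (ltn_ord i).
  by rewrite !big_ord_recr /= E ?(ltnW (ltn_ord i))// => /addnI.
rewrite /partial_sums (bigD1 j)//= [X in (_ < X)%N](bigD1 j)//= -addSn leq_add// leq_sum// => i _.
by apply: le; rewrite -ltnS.
Qed.

(** Triangularity: if the monomial of kappa occurs in g mu with mu <> kappa, then mu has larger
    [partial_sums]. Going down from the largest value, the coefficient of that monomial isolates d
    kappa. *)
Lemma dominated_independent (g : seq nat -> {mpoly R[n]}) (d : seq nat -> R) :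
  (forall kappa, kappa \in partns n k -> dom_supp kappa (g kappa)) ->
  (forall kappa, kappa \in partns n k -> mcoeff (expo n kappa) (g kappa) != 0) ->
  \sum_(kappa <- partns n k) d kappa *: g kappa = 0 ->
  forall kappa, kappa \in partns n k -> d kappa = 0.
Proof.
move=> gd g0 S0; set B := (n.+1 * k)%N.
have WB kappa : kappa \in partns n k -> (partial_sums kappa <= B)%N.
  rewrite mem_partns => /and3P[_ _ /eqP kk].
  rewrite /partial_sums /B -[X in (X * _)%N]card_ord -sum_nat_const; apply: leq_sum => j _.
  by rewrite -sumn_take_nth -kk -[X in (_ <= sumn X)%N](cat_take_drop j) sumn_cat leq_addr.
suff H b kappa : kappa \in partns n k -> (B - partial_sums kappa < b)%N -> d kappa = 0.
  by move=> kappa kk; apply: H kk (ltnSn _).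
elim: b kappa => // b IHb kappa kk kb.
have := congr1 (mcoeff (expo n kappa)) S0; rewrite mcoeff0 mcoef_sum.
rewrite (bigD1_seq kappa) ?uniq_partns//= big_seq_cond big1 ?addr0.
  by rewrite mcoefZ => /eqP; rewrite mulf_eq0 (negbTE (g0 _ kk)) orbF => /eqP.
move=> mu /andP[mk muk]; rewrite mcoefZ.
have [/(gd _ mk) dm|mn] := boolP (expo n kappa \in msupp (g mu)); last first.
  by rewrite (memN_msupp_eq0 mn) mulr0.
rewrite IHb ?mul0r//.
have := kk; have := mk; rewrite !mem_partns => /and3P[mp mn' _] /and3P[kp kn' _].
have lt := dom_partial_sums kp mp kn' mn' muk dm.
by have := WB _ mk; move: kb lt; lia.
Qed.

End Independence.

Section Stability.
Variables (R : realType) (beta : R) (C : poly_family R).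
Hypotheses (beta0 : 0 < beta) (jC : is_jackC beta C).
Implicit Types (n k : nat) (kappa : seq nat).

Let CJ n kappa : (0 < n)%N -> is_part kappa -> (size kappa <= n)%N -> is_jack beta kappa (C n kappa).
Proof. exact: (jackC_jack jC). Qed.

Lemma restriction_jack n kappa : (0 < n)%N -> is_part kappa -> (size kappa <= n)%N ->
  exists c, restriction (C n.+1 kappa) = c *: C n kappa.
Proof.
move=> n0 kp kn; have J := CJ (ltn0Sn n) kp (leqW kn).
eexists; apply: (jack_unique beta0 kp kn (CJ n0 kp kn)).
- exact/restriction_symmetric/(jack_sym J).
- exact/restriction_dom_supp/(jack_dom J).
apply: Dstar_eigen_nonzero => x xi x0.
have exi : injective (extend x).
  move=> i j; case: (unliftP ord_max i) => [i'|] ->; case: (unliftP ord_max j) => [j'|] ->;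
    rewrite ?extend_lift ?extend_max //.
  - by move=> /xi ->.
  - by move=> /eqP; rewrite (negbTE (x0 _)).
  - by move=> /esym/eqP; rewrite (negbTE (x0 _)).
have := jack_eigen J exi; rewrite restriction_Dstar// -eval_restriction.
rewrite (euler_dom_supp _ (restriction_dom_supp (jack_dom J))) /jack_eigenvalue -natr1 => E.
apply/eqP; rewrite -subr_eq0; apply/eqP.
move/eqP: E; rewrite -subr_eq0 => /eqP E; apply: etrans E; ring.
Qed.

(** Setting the last variable to 0 in the sum of all C_mu gives (x_1 + ... + x_n)^k again, and the
    mu with n + 1 parts disappear. The other restrictions are multiples of the C_mu in n variables;
    independence forces every factor to be 1. *)
Lemma restriction_jackC n kappa : (0 < n)%N -> is_part kappa -> (size kappa <= n)%N ->
  restriction (C n.+1 kappa) = C n kappa.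
Proof.
move=> n0 kp kn; set k := sumn kappa.
have /choice[c cE] mu : exists c, mu \in partns n k -> restriction (C n.+1 mu) = c *: C n mu.
  have [|] := boolP (mu \in partns n k); last by exists 0.
  rewrite mem_partns => /and3P[mp mn _].
  by have [c cE] := restriction_jack n0 mp mn; exists c.
have kk : kappa \in partns n k by rewrite mem_partns kp kn eqxx.
suff H : forall mu, mu \in partns n k -> c mu - 1 = 0.
  by rewrite cE// (subr0_eq (H _ kk)) scale1r.
apply: (@dominated_independent R n k (C n)).
- by move=> mu; rewrite mem_partns => /and3P[mp mn _]; apply: jack_dom (CJ n0 mp mn).
- by move=> mu; rewrite mem_partns => /and3P[mp mn _]; apply: jack_coef_neq0 (CJ n0 mp mn).
under eq_bigr => mu _ do rewrite scalerBl scale1r.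
rewrite sumrB (jackC_sum jC k n0); apply/eqP; rewrite subr_eq0; apply/eqP.
have -> : \sum_(mu <- partns n k) c mu *: C n mu = restriction (\sum_(mu <- partns n.+1 k) C n.+1 mu).
  have rsum (r : seq (seq nat)) (f : seq nat -> {mpoly R[n.+1]}) :
      restriction (\sum_(mu <- r) f mu) = \sum_(mu <- r) restriction (f mu).
    elim: r => [|mu r IHr]; first by rewrite !big_nil /restriction comp_mpoly0.
    by rewrite !big_cons -IHr /restriction raddfD.
  rewrite rsum [RHS](bigID (fun mu => size mu <= n)%N) /= [X in _ + X]big_seq_cond [X in _ + X]big1 ?addr0; last first.
    move=> mu; rewrite mem_partns -ltnNge => /andP[/and3P[mp mn mk] nm].
    have sm : size mu = n.+1 by apply/eqP; rewrite eqn_leq mn.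
    have dm : dom_supp mu (C n.+1 mu) := jack_dom (CJ (ltn0Sn n) mp mn).
    exact: restriction_dom_supp0 mp sm dm.
  rewrite -[RHS]big_filter; apply: etrans (_ : \sum_(mu <- partns n k) restriction (C n.+1 mu) = _).
    by rewrite !big_seq; apply: eq_bigr => mu mk; rewrite cE.
  apply: perm_big; apply: uniq_perm; rewrite ?filter_uniq ?uniq_partns// => mu.
  rewrite mem_filter !mem_partns; case: (is_part mu); rewrite ?andbF//=.
  by rewrite andbA; congr (_ && _); case: leqP => //= mn; rewrite ltnW.
rewrite (jackC_sum jC k (ltn0Sn n)); apply: mpoly_eq_eval => x.
rewrite eval_restriction !evalXn !eval_sum; congr (_ ^+ _).
rewrite (bigD1_ord ord_max)//= evalU extend_max add0r; apply: eq_bigr => j _.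
by rewrite !evalU extend_lift.
Qed.

Lemma jackC_coef_stable n kappa : (0 < n)%N -> is_part kappa -> (size kappa <= n)%N ->
  mcoeff (expo n.+1 kappa) (C n.+1 kappa) = mcoeff (expo n kappa) (C n kappa).
Proof.
by move=> n0 kp kn; rewrite -(extend_mnm_expo kn) -mcoeff_restriction restriction_jackC.
Qed.

End Stability.

Section ValueAtOnes.
Variables (R : realType) (n : nat) (beta : R).
Hypothesis beta0 : 0 < beta.

Lemma avg_at_ones (F : {mpoly R[n]}) :
  (avg (beta / 2) (comp_mpoly (mixes R n) F)).@[fun=> 1]
  = (comp_mpoly (esyms R n) F).@[fun=> 1] * @dirichlet_moment R n (beta / 2) (@mnm0 n.+1).
Proof.
rewrite eval_avg.
have -> : Exp (beta / 2) (specialize (fun=> 1) (comp_mpoly (mixes R n) F))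
    = Exp (beta / 2) ((comp_mpoly (esyms R n) F).@[fun=> 1] *: mpolyX R (@mnm0 n.+1)).
  apply: Exp_simplex => [|w w0 w1]; first by rewrite divr_gt0.
  rewrite evalZ mpolyX0 meval1 mulr1 eval_specialize !eval_comp; apply: meval_eq => r.
  rewrite !tnth_mktuple eval_mix_mesym// mesym_coef//; congr (_ * _`_ _); congr polyseq.
  have one (A : {set 'I_n.+1}) : prp (fun=> 1) A = ('X - 1%:P) ^+ #|A| :> {poly R}.
    by rewrite /prp prodr_const.
  rewrite /mixture; transitivity (\sum_i w i *: (('X - 1%:P) ^+ n : {poly R})).
    apply: eq_bigr => i _; rewrite one; congr (_ *: _ ^+ _).
    by have := cardsD1 i [set: 'I_n.+1]%SET; rewrite inE cardsT card_ord add1n => -[].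
  by rewrite -scaler_suml w1 scale1r /prp prodr_const cardsT card_ord.
by rewrite ExpZ /Exp mlinX.
Qed.

End ValueAtOnes.

(** * Nonvanishing at the identity and the recursion for J *)

Section JackFacts.
Variables (R : realType) (beta : R) (C : poly_family R).
Hypotheses (beta0 : 0 < beta) (jC : is_jackC beta C).
Implicit Types (n : nat) (kappa : seq nat).

Let CJ n kappa : (0 < n)%N -> is_part kappa -> (size kappa <= n)%N -> is_jack beta kappa (C n kappa).
Proof. exact: (jackC_jack jC). Qed.

Let moment0_neq0 n : @dirichlet_moment R n (beta / 2) (@mnm0 n.+1) != 0.
Proof.
have b2 : 0 < beta / 2 by rewrite divr_gt0.
rewrite gt_eqF// /dirichlet_moment divr_gt0//.
  by apply: prodr_gt0 => i _; rewrite mnm0E addr0 Gamma_gt0.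
rewrite mulr_gt0// Gamma_gt0// big_ord_recl ltr_pwDl// ?mnm0E ?addr0// sumr_ge0// => i _.
by rewrite mnm0E addr0 ltW.
Qed.

(** The relation for c is left multiplied out, because the nonvanishing of C_kappa(I_(n + 1)) is
    deduced from it. *)
Lemma jack_average_coef n kappa : (0 < n)%N -> is_part kappa -> (size kappa <= n)%N ->
  exists2 F, C n kappa = comp_mpoly (esyms R n) F &
    exists c, avg (beta / 2) (comp_mpoly (mixes R n) F) = c *: C n.+1 kappa
      /\ c * eval_id (C n.+1 kappa)
         = eval_id (C n kappa) * @dirichlet_moment R n (beta / 2) (@mnm0 n.+1).
Proof.
move=> n0 kp kn.
have [F fE [c cE]] := jack_average beta0 kp kn (CJ n0 kp kn) (CJ (ltn0Sn n) kp (leqW kn)).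
exists F => //; exists c; split => //.
by rewrite /eval_id -evalZ -cE avg_at_ones// -fE.
Qed.

Lemma jack_nil n : (0 < n)%N -> C n [::] = (mcoeff (expo n [::]) (C n [::])) *: mpolyX R (@mnm0 n).
Proof.
move=> n0; have J : is_jack beta [::] (C n [::]) by apply: CJ.
apply/mpolyP => m; rewrite mcoefZ mcoeffX.
have e0 : expo n [::] = @mnm0 n by apply/mnmP => i; rewrite expoE nth_nil mnm0E.
case: eqP => [<-|m0]; first by rewrite e0 mulr1.
rewrite mulr0; apply: memN_msupp_eq0; apply/negP => /(jack_dom J)/dom_mnm_sumn/= /eqP.
by rewrite mdeg_eq0 => /eqP /esym.
Qed.

(** Induction on n + |kappa|. For n parts, column removal leads to a smaller partition, the product
    of the variables being 1 at the identity; for fewer parts the averaging relation leads to n - 1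
    variables, the moment being nonzero. With one variable and no parts the polynomial is a nonzero
    constant. *)
Lemma eval_id_jack_neq0 n kappa : (0 < n)%N -> is_part kappa -> (size kappa <= n)%N ->
  eval_id (C n kappa) != 0.
Proof.
have [b] := ubnP (n + sumn kappa)%N; elim: b n kappa => // b IHb n kappa bk n0 kp kn.
have J := CJ n0 kp kn; have [E|lt] := eqVneq (size kappa) n.
  have kp' := is_part_remove_column kp.
  have kn' : (size (remove_column kappa) <= n)%N by rewrite -E size_remove_column.
  have := column_removal beta0 kp E J (CJ n0 kp' kn').
  move=> /(congr1 (@eval_id R n)); rewrite /eval_id evalM evalZ eval_all_ones big1 ?mul1r// => e.
  have := IHb n _ _ n0 kp' kn'; rewrite /eval_id e mulf_eq0 negb_or => /(_ _)/andP[]//.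
  by rewrite (sumn_remove_column kp) E in bk; move: bk n0; lia.
have {lt}kn' : (size kappa < n)%N by rewrite ltn_neqAle lt.
case: n n0 kn {J} kn' bk => // -[|n] _ kn kn' bk.
  case: kappa kp kn kn' {bk} => // kp kn _.
  rewrite jack_nil// /eval_id evalZ mpolyX0 meval1 mulr1.
  exact: jack_coef_neq0 (CJ _ kp _).
have [F _ [c [_ cE]]] := jack_average_coef (ltn0Sn n) kp kn'.
have : c * eval_id (C n.+2 kappa) != 0.
  by rewrite cE mulf_neq0// IHb//; move: bk; lia.
by rewrite mulf_eq0 negb_or => /andP[].
Qed.

Lemma jackJ_sym n kappa : (0 < n)%N -> is_part kappa -> (size kappa <= n)%N ->
  jackJ beta C n kappa \is symmetric (n := n) (R := R).
Proof. by move=> n0 kp kn; apply: symmetricZ; apply: jack_sym (CJ n0 kp kn). Qed.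

Lemma jackJ_one kappa : is_part kappa -> (size kappa <= 1)%N -> forall x : R,
  (jackJ beta C 1 kappa).@[fun=> x]
  = x ^+ nth 0%N kappa 0 * \prod_(1 <= j < nth 0%N kappa 0) (1 + j%:R * (2 / beta)).
Proof.
move=> kp k1 x; have J := CJ (ltn0Sn 0) kp k1.
have c0 := jack_coef_neq0 kp k1 J.
have e (m : multinom 1) : mdeg m = sumn kappa -> m = expo 1 kappa.
  move=> d; apply/mnmP => i; rewrite expoE ord1 /=.
  move: d; rewrite mdegE big_ord1 => ->.
  by case: (kappa) k1 => [|k [|]] //= _; rewrite addn0.
have CE : C 1%N kappa = mcoeff (expo 1 kappa) (C 1%N kappa) *: mpolyX R (expo 1 kappa).
  apply/mpolyP => m; rewrite mcoefZ mcoeffX; case: eqP => [<-|mk]; first by rewrite mulr1.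
  rewrite mulr0; apply: memN_msupp_eq0; apply/negP => /(jack_dom J)/dom_mnm_sumn/e E.
  by rewrite E in mk.
rewrite /jackJ {2}CE scalerA divfK// evalZ evalX big_ord1 expoE mulrC; congr (_ * _).
by case: (kappa) k1 => [|k [|]] //= _; rewrite ?hooks_nil ?hooks1// big_geq.
Qed.

Lemma jackJ_full n kappa : (0 < n)%N -> is_part kappa -> size kappa = n ->
  forall lam : 'rV[R]_n, eval_diag (jackJ beta C n kappa) lam
  = \det (diag_mx lam) * eval_diag (jackJ beta C n (strip (map predn kappa))) lam
    * \prod_(i < n) ((n - i)%N%:R + 2 / beta * ((nth 0%N kappa i)%:R - 1)).
Proof.
move=> n0 kp kn lam; rewrite -/(remove_column kappa).
have kp' := is_part_remove_column kp.
have kn' : (size (remove_column kappa) <= n)%N by rewrite -kn size_remove_column.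
have kn1 : (size kappa <= n)%N by rewrite kn.
have J := CJ n0 kp kn1; have J' := CJ n0 kp' kn'.
have c0 := jack_coef_neq0 kp kn1 J; have c0' := jack_coef_neq0 kp' kn' J'.
have := column_removal beta0 kp kn J J'.
move=> /(congr1 (meval (lam ord0))); rewrite evalM evalZ eval_all_ones => e.
rewrite /eval_diag /jackJ !evalZ det_diag (hooks_remove_column beta kp) kn.
transitivity (hooks beta (remove_column kappa) / mcoeff (expo n (remove_column kappa)) (C n (remove_column kappa))
  * ((\prod_i lam ord0 i) * (C n (remove_column kappa)).@[lam ord0])
  * \prod_(i < n) ((n - i)%:R + 2 / beta * ((nth 0%N kappa i)%:R - 1))); last by ring.
by rewrite e; field; rewrite c0 c0'.
Qed.

(** By [jackC_coef_stable] both sides carry the same quotient of the hook product by the leading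
    coefficient. The factor c of the average is C_kappa(I_n) / C_kappa(I_(n + 1)) times the total
    mass of the density. *)
Lemma jackJ_drop n kappa : (0 < n)%N -> is_part kappa -> (size kappa <= n)%N ->
  forall lam : 'rV[R]_n.+1, (eval_diag (jackJ beta C n.+1 kappa) lam)%:E
    = ((eval_id (C n.+1 kappa) / eval_id (C n kappa)
        * (2 ^+ n * Gamma (n.+1%:R * beta / 2) / Gamma (beta / 2) ^+ n.+1))%:E
      * pos_sphere_integral (fun q =>
          (\prod_i q i ord0 `^ (beta - 1))
            * (jackJ beta C n kappa).@[tnth (nu lam q)])%R)%E.
Proof.
move=> n0 kp kn lam; have [F fE [c [cE c1]]] := jack_average_coef n0 kp kn.
rewrite {2}/jackJ; set h := hooks beta kappa; set b := mcoeff _ _.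
have -> : h / b *: C n kappa = comp_mpoly (esyms R n) (h / b *: F) by rewrite fE -comp_mpolyZ.
rewrite sphere_integral_symmetric// comp_mpolyZ.
have -> : avg (beta / 2) (h / b *: comp_mpoly (mixes R n) F)
    = h / b *: (c *: C n.+1 kappa) by rewrite /avg mlinZ -/(avg _ _) cE.
rewrite -EFinM /eval_diag /jackJ !evalZ (jackC_coef_stable beta0 jC n0 kp kn) -/h -/b; congr EFin.
have i0 := eval_id_jack_neq0 n0 kp kn; have i1 := eval_id_jack_neq0 (ltn0Sn n) kp (leqW kn).
have M0 := moment0_neq0 n.
(* The Gamma quotient in (iii) is the inverse of the total mass of the density on the positive part
   of the sphere, which is the moment of the zero exponent. *)
have ME : 2 ^+ n * Gamma (n.+1%:R * beta / 2) / Gamma (beta / 2) ^+ n.+1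
    = (@dirichlet_moment R n (beta / 2) (@mnm0 n.+1))^-1.
  rewrite /dirichlet_moment invf_div; congr (_ * Gamma _ / _).
    rewrite (eq_bigr (fun=> beta / 2)); last by move=> i _; rewrite mnm0E addr0.
    by rewrite sumr_const card_ord -[RHS]mulr_natl mulrA.
  rewrite (eq_bigr (fun=> Gamma (beta / 2))); last by move=> i _; rewrite mnm0E addr0.
  by rewrite prodr_const card_ord.
have -> : c = eval_id (C n kappa) * dirichlet_moment (beta / 2) (@mnm0 n.+1) / eval_id (C n.+1 kappa).
  by rewrite -c1 mulfK.
have b0 : b != 0 by apply: jack_coef_neq0 (CJ n0 kp kn).
by rewrite ME; field; apply/and4P; split; [exact: i1|exact: b0|exact: M0|exact: i0].
Qed.

End JackFacts.

(** Induction on n + |kappa|: (ii) lowers |kappa| by n, (iii) lowers n. A polynomial is determined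
    by its values, and for n = 1 every point is a constant function, as in (i). *)
Lemma jack_recursion_unique (R : realType) (beta : R) (C F G : poly_family R) :
  jack_recursion beta C F -> jack_recursion beta C G ->
  forall n kappa, (0 < n)%N -> is_part kappa -> (size kappa <= n)%N -> F n kappa = G n kappa.
Proof.
move=> rF rG n kappa; have [b] := ubnP (n + sumn kappa)%N.
elim: b n kappa => // b IHb n kappa bk n0 kp kn; apply: mpoly_eq_eval => x.
pose lam : 'rV[R]_n := \row_i x i.
have xE (p : {mpoly R[n]}) : p.@[x] = eval_diag p lam.
  by apply: meval_eq => i; rewrite mxE.
case: n n0 kn bk x lam xE => // -[_ kn _ x _ _|n _ kn bk x lam xE].
  have -> : x = fun=> x ord0 by apply: funext => i; rewrite ord1.
  by rewrite (rec_one rF)// (rec_one rG).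
rewrite !xE; have [E|lt] := eqVneq (size kappa) n.+2.
  have kp' := is_part_remove_column kp.
  rewrite (rec_full rF _ kp E)// (rec_full rG _ kp E)// -/(remove_column kappa).
  congr (_ * eval_diag _ _ * _); apply: IHb => //.
    by move: bk; rewrite (sumn_remove_column kp) E; lia.
  by rewrite -E size_remove_column.
have {lt}kn' : (size kappa <= n.+1)%N by rewrite -ltnS ltn_neqAle lt.
apply: EFin_inj; rewrite (rec_drop rF _ kp kn')// (rec_drop rG _ kp kn')//.
by rewrite IHb//; move: bk; lia.
Qed.

Theorem corollary2 (R : realType) (beta : R) (C : poly_family R) :
  0 < beta -> is_jackC beta C ->
  jack_recursion beta C (jackJ beta C) /\
  (forall F : poly_family R, jack_recursion beta C F ->
     forall (n : nat) (kappa : seq nat),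
       (0 < n)%N -> is_part kappa -> (size kappa <= n)%N ->
       F n kappa = jackJ beta C n kappa).
Proof.
move=> beta0 jC; have rJ : jack_recursion beta C (jackJ beta C).
  split.
  - by move=> n kappa; apply: jackJ_sym.
  - by move=> kappa; apply: jackJ_one.
  - by move=> n kappa n1; apply: jackJ_full => //; apply: ltnW.
  - by move=> n kappa; apply: jackJ_drop.
by split=> // F rF n kappa n0 kp kn; apply: (jack_recursion_unique rF rJ).
Qed.
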